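(* Consider the model $y_i(t_{i,j})=x_i^{\top}\beta(t_{i,j})+\xi_i(t_{i,j})+\epsilon_i(t_{i,j})$ with $s_\beta=p<n$. Assume: (i) the errors $\epsilon_i(t_{i,j})$ are i.i.d. with mean zero and variance $\sigma_\epsilon^2$ and independent of the sampling times; (ii) $m_i=m$ for all $i=1,\dots,n$ and $t_{i,j}=j/m$ for all $i=1,\dots,n$, $j=1,\dots,m$; (iii) each coordinate of $\beta(\cdot)$ satisfies $\beta_k(\cdot)\in W^{\mathrm{per}}(\alpha,R)$ for some constants $\alpha\ge2$, $R>0$, with $s_\beta$ coordinates nonzero; moreover $x_i^{\top}\beta(\cdot)\in W^{\mathrm{per}}(\alpha,O(g(n)))$ uniformly in $i$ and $\sup_{i=1,\dots,n}\int_0^1(x_i^{\top}\beta(t))^2dt=O(g(n))$ for some function $g(n)$; (iv) $(\xi_i(\cdot))_{i=1}^n\subseteq W^{\mathrm{per}}(\alpha,R)$ almost surely and are i.i.d., with $\mathbb{E}\xi_i(t)=0$ for all $t\in(0,1)$ and $\mathbb{E}\int_0^1\xi_i^2(t)dt<\infty$. Then for $K_\beta\le m-1$ the least squares projection estimator $\hat\beta^{LD}$ with truncation level $K_\beta$ satisfies $$\mathrm{MISE}(\hat\beta^{LD})=O\Big(s_\beta m^{-2\alpha}+(1+K_\beta m^{-1})\operatorname{tr}[(X^{\top}X)^{-1}]+s_\beta K_\beta^{-2\alpha}\Big).$$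
   Context: All quantities may depend on $n$ (triangular array); $O$ refers to $n\to\infty$. Here $x_i\in\mathbb{R}^p$ are time invariant covariates, $X\in\mathbb{R}^{n\times p}$ has rows $x_i^{\top}$, $\beta:(0,1)\to\mathbb{R}^p$ is the coefficient function, $\xi_i$ are individual functional random effects, $\epsilon_i(t_{i,j})$ are independent errors. $\mathbb{E}$ is expectation over $(\xi_i)$ and $(\epsilon_i)$. Trigonometric basis: $\phi_1(t)=1$, $\phi_k(t)=\sqrt2\cos(\pi kt)$ for even $k$, $\phi_k(t)=\sqrt2\sin(\pi(k-1)t)$ for odd $k\ge3$. $W^{\mathrm{per}}(\alpha,R)$ is the periodic Sobolev class: functions $f$ on $[0,1]$ with $f^{(\alpha-1)}$ absolutely continuous, $\int_0^1(f^{(\alpha)})^2\le R^2$ and $f^{(j)}(0)=f^{(j)}(1)$ for $j=0,\dots,\alpha-1$; equivalently, the Fourier coefficients $\theta_k$ of $f$ in the basis $(\phi_k)$ satisfy $\sum_k a_k^2\theta_k^2\le R^2/\pi^{2\alpha}$ with $a_k=k^\alpha$ ($k$ even), $a_k=(k-1)^\alpha$ ($k$ odd). Estimator: $\omega_{i,k}=m^{-1}\sum_{j=1}^{m}y_i(t_{i,j})\phi_k(t_{i,j})$, $\Omega_k=(\omega_{1,k},\dots,\omega_{n,k})^{\top}$, $\hat\beth_k^{LD}=(X^{\top}X)^{-1}X^{\top}\Omega_k$ for $k=1,\dots,K_\beta$, $\hat\beth_k^{LD}=0$ for $k>K_\beta$, and $\hat\beta^{LD}(\cdot)=\sum_{k\ge1}\hat\beth_k^{LD}\phi_k(\cdot)$.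 The mean integrated squared error (the sampling times being deterministic) is $\mathrm{MISE}(\hat\beta)=\mathbb{E}\int_0^1\|\hat\beta(t)-\beta(t)\|_2^2dt$.
   Formalization: As quantities may depend on n, the error variance and the expected integral of ξ_i² are assumed bounded uniformly in n (the rate fails if the variance grows, e.g. like n with m=n, K_β=m-1); also K_β≥1 and XᵀX invertible, so that the rate is defined. *)

(* Defs.v *)
(* MathComp / MathComp-Analysis, over an arbitrary R : realType. *)
From HB Require Import structures.
From mathcomp Require Export all_boot all_order all_algebra.
From mathcomp Require Export all_classical all_reals all_analysis.

Set Implicit Arguments.
Unset Strict Implicit.
Unset Printing Implicit Defensive.

Import Order.TTheory GRing.Theory Num.Theory.
Import numFieldNormedType.Exports.

Local Open Scope classical_set_scope.
Local Open Scope ring_scope.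

(* Asymptotics: u_n = O(v_n) as n -> oo.  The left-hand side is extended-real,
   so the bound also asserts that u_n is eventually finite. *)
Definition bigO_seq (R : realType) (u : nat -> \bar R) (v : nat -> R) : Prop :=
  exists C : R, \forall n \near \oo, (`|u n| <= (C * `|v n|)%:E)%E.

(* [k] is 1-based; the value at k = 0 is never used. *)
Definition trig_basis (R : realType) (k : nat) (t : R) : R :=
  if k == 1%N then 1
  else if odd k then Num.sqrt 2 * sin (pi * k.-1%:R * t)
  else Num.sqrt 2 * cos (pi * k%:R * t).

(* A function on [0, 1] is represented by f : R -> R whose values outside
   [0, 1] are irrelevant.  In particular the derivative is taken within
   [0, 1], hence is one-sided at 0 and at 1. *)
Definition is_derive01 (R : realType) (f : R -> R) (t l : R) : Prop :=
  (f s - f t) / (s - t) @[s --> within `[0, 1]%classic t^'] --> l.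

Definition abs_continuous01 (R : realType) (f : R -> R) : Prop :=
  forall e : R, 0 < e -> exists2 del : R, 0 < del &
    forall (N : nat) (a b : 'I_N -> R),
      (forall i, 0 <= a i /\ a i <= b i /\ b i <= 1) ->
      trivIset setT (fun i => `]a i, b i[%classic) ->
      \sum_(i < N) (b i - a i) < del ->
      \sum_(i < N) `|f (b i) - f (a i)| < e.

(* The periodic Sobolev class W^per(alpha, L), for alpha >= 1.  [D j] is
   the j-th derivative of f on [0, 1]; it is a classical derivative for
   j < alpha, and the almost-everywhere derivative of the absolutely continuous
   function [D alpha.-1] for j = alpha. *)
Definition periodic_sobolev (R : realType) (alpha : nat) (L : R)
    (f : R -> R) : Prop :=
  exists D : nat -> R -> R,
    (forall t : R, t \in `[0, 1] -> D 0%N t = f t) /\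
    (forall j, (j.+1 < alpha)%N -> forall t : R, t \in `[0, 1] ->
       is_derive01 (D j) t (D j.+1 t)) /\
    abs_continuous01 (D alpha.-1) /\
    {ae @lebesgue_measure R, forall t : R, t \in `[0, 1] ->
       is_derive01 (D alpha.-1) t (D alpha t)} /\
    measurable_fun (`[0, 1]%classic : set R) (D alpha) /\
    (\int[@lebesgue_measure R]_(t in `[0%R, 1%R]%classic) ((D alpha t) ^+ 2)%:E
       <= (L ^+ 2)%:E)%E /\
    (forall j, (j < alpha)%N -> D j 0 = D j 1).

(* Mutual independence and equality in law of a finite family of random
   elements X_i : T -> E, with respect to a set system S on E. *)
Definition mutually_independent (d : measure_display) (T : measurableType d)
    (R : realType) (P : probability T R) (E : Type) (S : set (set E))
    (I : finType) (X : I -> T -> E) : Prop :=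
  forall (J : {set I}) (A : I -> set E), (forall i, S (A i)) ->
    P (\bigcap_(i in [set i | i \in J]) (X i @^-1` A i)) =
    (\prod_(i in J) P (X i @^-1` A i))%E.

Definition identically_distributed (d : measure_display)
    (T : measurableType d) (R : realType) (P : probability T R) (E : Type)
    (S : set (set E)) (I : finType) (X : I -> T -> E) : Prop :=
  forall (i i' : I) (A : set E), S A -> P (X i @^-1` A) = P (X i' @^-1` A).

Definition iid (d : measure_display) (T : measurableType d)
    (R : realType) (P : probability T R) (E : Type) (S : set (set E))
    (I : finType) (X : I -> T -> E) : Prop :=
  mutually_independent P S X /\ identically_distributed P S X.

(* The sigma-algebra on paths generated by the evaluations f |-> f t for
   t in [0, 1]: the law and the independence of random functions refer to it. *)
Definition path_sigma (R : realType) : set (set (R -> R)) :=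
  <<s [set A | exists2 t : R, t \in `[0, 1] &
         exists2 B : set R, measurable B & A = [set f | B (f t)]] >>.

Definition num_nonzero_coords (R : realType) (p : nat)
    (beta : R -> 'cV[R]_p) : nat :=
  #|[pred k : 'I_p | `[< exists2 t : R, t \in `]0, 1[ & beta t k 0 != 0 >]]|.

Definition sqnorm2 (R : realType) (p : nat) (v : 'cV[R]_p) : R :=
  \sum_(k < p) v k 0 ^+ 2.

(* omega_{i,k}, collected over i in the vector Omega_k *)
Definition emp_coef (R : realType) (n m : nat) (t y : 'I_n -> 'I_m -> R)
    (k : nat) : 'cV[R]_n :=
  \col_(i < n) (m%:R^-1 * \sum_(j < m) y i j * trig_basis k (t i j)).

Definition LD_coef (R : realType) (n p m : nat) (X : 'M[R]_(n, p))
    (t y : 'I_n -> 'I_m -> R) (K k : nat) : 'cV[R]_p :=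
  if (k <= K)%N then invmx (X^T *m X) *m X^T *m emp_coef t y k else 0.

(* The coefficients with index k > K vanish, so the series is a finite sum. *)
Definition LD_estimator (R : realType) (n p m : nat) (X : 'M[R]_(n, p))
    (t y : 'I_n -> 'I_m -> R) (K : nat) (s : R) : 'cV[R]_p :=
  \sum_(1 <= k < K.+1) trig_basis k s *: LD_coef X t y K k.

Definition MISE (d : measure_display) (T : measurableType d)
    (R : realType) (P : probability T R) (p : nat)
    (betahat : T -> R -> 'cV[R]_p) (beta : R -> 'cV[R]_p) : \bar R :=
  (\int[P]_w \int[@lebesgue_measure R]_(t in `[0%R, 1%R]%classic)
     (sqnorm2 (betahat w t - beta t))%:E)%E.

(* Main.v *)
Require Import Defs.
From HB Require Import structures.
From mathcomp Require Import measurable_realfun.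
From mathcomp Require Import zify ring lra.
Set Implicit Arguments.
Unset Strict Implicit.
Unset Printing Implicit Defensive.
Import Order.TTheory GRing.Theory Num.Theory.
Import numFieldNormedType.Exports.
Local Open Scope classical_set_scope.
Local Open Scope ring_scope.

(** Since [(X^T X)^-1 X^T X = 1], the error of the estimator is a deterministic
    bias, the discretized Fourier projection of [beta] minus [beta], plus the
    image of the random effects and errors under [(X^T X)^-1 X^T].

    Bias.  Interpolating a periodic function at M = 2N+1 equispaced points by a
    trigonometric polynomial costs O(1/M) times the L2 norm of its derivative:
    the error vanishes on the grid, and the energy of the interpolant is
    controlled by its discrete energy.  Hence a periodic function orthogonal to
    the first M basis functions has L2 norm at most O(1/M) times that of its
    derivative, which is again orthogonal to them; iterating alpha times bounds
    the Fourier residual by O(M^-alpha).  Discrete orthonormality on the grid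
    j/m transfers this bound to the discretized projection.

    Noise.  Independence makes the cross terms vanish, and what remains is
    [tr (X^T X)^-1] times the expected squared discrete Fourier coefficients of
    one individual: for the errors they are O(K/m), for the random effects they
    are O(1) by Bessel's inequality on the grid and the pointwise bound of
    xi(t)^2 by the integral of xi^2 and the Sobolev radius. *)

(** * Absolute continuity on [0, 1] *)

(** The class is given by derivatives on [0, 1], so the decay of the residual is obtained from
    finitely many orthonormality relations, on [0, 1] and on the grid, rather than from a Fourier
    series. An odd number M of basis functions is essential there: the constant and complete
    sine-cosine pairs form a space that is stable under differentiation, and M equispaced points
    determine its elements. The top derivative exists only almost everywhere, so all estimates rest
    on the fundamental theorem of calculus for absolutely continuous functions. Because K < m,
    evaluating the residual on the grid costs only m^-2 times the energy of its derivative, which is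
    again of order K^(-2 alpha). Two obstacles are probabilistic. The integrated squares are not
    known to be measurable in the sample point, so they are handled by monotonicity of the integral
    of nonnegative functions and by measurable minorants. The mean of xi is given on the open
    interval while the grid contains the point 1; a Lipschitz bound on the paths closes this gap. *)

Section absolute_continuity.
Context {R : realType}.
Implicit Types (f g h : R -> R).
Local Notation mu := (@lebesgue_measure R).

(** The multiplied-out form has no division to guard at s = t. It is one-sided at 0 and 1, because
    only points of [0, 1] are tested. *)
Definition derive_at01 f (t l : R) : Prop :=
  forall e : R, 0 < e -> exists2 d : R, 0 < d &
    forall s : R, 0 <= s <= 1 -> `|s - t| < d ->
      `|f s - f t - l * (s - t)| <= e * `|s - t|.

Lemma is_derive01_derive_at01 f t l : is_derive01 f t l -> derive_at01 f t l.
Proof.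
move=> /cvgrPdist_le h e e0.
have := h e e0; rewrite /= /within /dnbhs /within /= => /nbhs_ballP[d /= d0 hd].
exists d => // s s01 std.
have [->|st] := eqVneq s t; first by rewrite !subrr mulr0 subrr normr0 mulr0.
have := hd s; rewrite /ball /= distrC => /(_ std st).
rewrite in_itv /= => /(_ s01) hle.
have st0 : s - t != 0 by rewrite subr_eq0.
have -> : f s - f t - l * (s - t) = - ((l - (f s - f t) / (s - t)) * (s - t)).
  by field.
by rewrite normrN normrM ler_wpM2r.
Qed.

Definition chain (a b : R) (s : seq (R * R)) : bool :=
  all (fun x => [&& a <= x.1, x.1 <= x.2 & x.2 <= b]) s && pairwise (fun x y => x.2 <= y.1) s.

Lemma chain_nil (a b : R) : chain a b [::]. Proof. by []. Qed.

Lemma chain_cat (a b c : R) s1 s2 : a <= b -> b <= c ->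
  chain a b s1 -> chain b c s2 -> chain a c (s1 ++ s2).
Proof.
move=> ab bc /andP[/allP a1 p1] /andP[/allP a2 p2]; apply/andP; split.
  rewrite all_cat; apply/andP; split; apply/allP => x.
    by move=> /a1 /andP[-> /andP[-> xb]] /=; exact: le_trans xb bc.
  by move=> /a2 /andP[/(le_trans ab) -> /andP[-> ->]].
rewrite pairwise_cat p1 p2 !andbT; apply/allrelP => x y /a1 + /a2.
by move=> /andP[_ /andP[_ xb]] /andP[yb _]; exact: le_trans xb yb.
Qed.

Definition chain_variation f (s : seq (R * R)) : R := \sum_(x <- s) `|f x.2 - f x.1|.

Definition chain_length (s : seq (R * R)) : R := \sum_(x <- s) (x.2 - x.1).

Lemma trivIset_pairwise (s : seq (R * R)) : pairwise (fun x y => x.2 <= y.1) s ->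
  trivIset setT (fun i : 'I_(size s) =>
    `](nth (0, 0) s i).1, (nth (0, 0) s i).2[%classic).
Proof.
move=> /(pairwiseP (0, 0)) ps i j _ _ [z []] /=; rewrite !in_itv /=.
move=> /andP[i1 i2] /andP[j1 j2]; apply/val_inj => /=.
have [ij|ji|//] := ltngtP i j.
- have := ps i j (ltn_ord i) (ltn_ord j) ij.
  by move=> /(lt_le_trans i2) /lt_trans/(_ j1); rewrite ltxx.
- have := ps j i (ltn_ord j) (ltn_ord i) ji.
  by move=> /(lt_le_trans j2) /lt_trans/(_ i1); rewrite ltxx.
Qed.

Definition ac01 f : Prop := forall e : R, 0 < e -> exists2 d : R, 0 < d &
  forall s, chain 0 1 s -> chain_length s < d -> chain_variation f s < e.

Lemma abs_continuous01_ac01 f : abs_continuous01 f -> ac01 f.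
Proof.
move=> acf e e0; have [d d0 hd] := acf e e0; exists d => // s /andP[/allP a p].
rewrite /chain_length /chain_variation !(big_nth (0, 0)) !big_mkord => sd.
apply: hd sd => [i|]; last exact: trivIset_pairwise.
have /a := mem_nth (0, 0) (ltn_ord i).
by move=> /andP[? /andP[? ?]].
Qed.

Lemma eq_ac01 f g : (forall t, 0 <= t <= 1 -> f t = g t) -> ac01 f -> ac01 g.
Proof.
move=> fg acf e e0; have [d d0 hd] := acf e e0; exists d => // s cs ls.
suff -> : chain_variation g s = chain_variation f s by exact: hd.
rewrite /chain_variation !big_seq; apply: eq_bigr => x xs.
move: cs => /andP[/allP/(_ _ xs)/andP[x1 /andP[x12 x2]] _].
by rewrite !fg ?(le_trans x1 x12) ?x1//= (le_trans x12 x2).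
Qed.

(** Supremum argument: the supremum c of the points reachable from a is itself reachable, and if c <
    b the local hypothesis at c would carry past it. *)
Lemma cousin_induction (Q : R -> R -> Prop) (a b : R) : a <= b ->
  (forall u v w, a <= u -> u <= v -> v <= w -> w <= b ->
     Q u v -> Q v w -> Q u w) ->
  (forall x, a <= x <= b -> exists2 d, 0 < d &
     forall u v, a <= u -> u <= x -> x <= v -> v <= b -> v - u < d -> Q u v) ->
  Q a b.
Proof.
move=> ab Qadd Qloc.
pose S := [set x | a <= x <= b /\ Q a x].
have Sa : S a.
  split; first by rewrite lexx.
  have /Qloc[d d0 hd] : a <= a <= b by rewrite lexx.
  by apply: hd; rewrite ?subrr.
have ubS : ubound S b by move=> x [/andP[]].
have hS : has_sup S by split; [exists a|exists b; exact: ubS].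
set c := sup S.
have ac : a <= c by apply: (ub_le_sup hS.2).
have cb : c <= b by apply: ge_sup; [exact: hS.1|exact: ubS].
have /Qloc[d d0 hd] : a <= c <= b by rewrite ac.
have [x Sx cx] : exists2 x, S x & c - d / 2 < x.
  by apply: (sup_adherent _ hS); rewrite divr_gt0.
have xc : x <= c by apply: (ub_le_sup hS.2).
have [/andP[ax xb] Qax] := Sx.
(* Since x > c - d/2, the interval from x to c' contains c and is shorter than d/2 + d/3 < d. *)
set c' := Num.min b (c + d / 3).
have d3 : 0 < d / 3 by rewrite divr_gt0.
have cc' : c <= c' by rewrite le_min cb lerDl ltW.
have c'b : c' <= b by rewrite ge_min lexx.
have Qac' : Q a c'.
  apply: (Qadd a x c') => //; first exact: le_trans xc cc'.
  apply: hd => //.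
  have : c' <= c + d / 3 by rewrite ge_min lexx orbT.
  by move: cx d0; lra.
have : c' <= c by apply: (ub_le_sup hS.2); split=> //; rewrite c'b (le_trans ac).
rewrite /c' ge_min => /orP[bc|]; last by rewrite gerDl leNgt d3.
suff <- : c' = b by [].
by apply/eqP; rewrite eq_le c'b (le_trans bc cc').
Qed.

(* Cousin's lemma with tags: intervals tagged outside A satisfy the derivative
   bound, those tagged in A lie in an open set U of small measure, where
   absolute continuity controls the variation. *)
Lemma ac01_derive0_cst h (Z : set R) : ac01 h -> mu.-negligible Z ->
  (forall x : R, 0 <= x <= 1 -> ~ Z x -> derive_at01 h x 0) ->
  forall a b : R, 0 <= a -> a <= b -> b <= 1 -> h a = h b.
Proof.
move=> ach [A [mA A0 ZA]] hd a b a0 ab b1.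
suff small (e : R) : 0 < e -> `|h b - h a| <= e.
  apply/esym/eqP; rewrite -subr_eq0 -normr_le0; apply/ler_addgt0Pl => e e0.
  by rewrite addr0; exact: small.
move=> e0; have e2 : 0 < e / 2 by rewrite divr_gt0.
have [del del0 hdel] := ach _ e2.
have [U [oU AU UA]] := lebesgue_regularity_outer mA (eq_ind_r (fun x => (x < +oo)%E) (ltry 0) A0) del0.
have mU : measurable U by exact: open_measurable.
have {UA} muU : (mu U < del%:E)%E.
  have UA0 : mu (U `&` A) = 0%E.
    apply/eqP; rewrite eq_le measure_ge0 andbT -A0.
    by apply: le_measure; rewrite ?inE//; exact: measurableI.
  have -> : mu U = (mu (U `\` A) + mu (U `&` A))%E by exact: measureDI.
  by rewrite UA0 adde0.
(* The chain collects the intervals tagged in A. Bounding its length by the measure of the part of U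
   inside ]u, v] keeps the property additive; the remaining intervals contribute the slope e/2. *)
pose Q u v := exists s, [/\ chain u v s,
  ((chain_length s)%:E <= mu (U `&` `]u, v]%classic))%E &
  `|h v - h u| <= e / 2 * (v - u) + chain_variation h s].
suff [s [cs ls hs]] : Q a b.
  have c01 : chain 0 1 s.
    have := chain_cat a0 (le_trans ab b1) (chain_nil 0 a)
              (chain_cat ab b1 cs (chain_nil b 1)).
    by rewrite cats0.
  have ls' : chain_length s < del.
    rewrite -lte_fin; apply: (le_lt_trans ls); apply: le_lt_trans muU.
    apply: le_measure => [||z []//]; rewrite inE//.
    by apply: measurableI => //; exact: measurable_itv.
  have := hdel s c01 ls'.
  have : e / 2 * (b - a) <= e / 2 * 1 by rewrite ler_pM2l //; lra.
  by move: hs; lra.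
apply: cousin_induction => //.
  move=> u v w au uv vw wb [s1 [c1 l1 h1]] [s2 [c2 l2 h2]].
  exists (s1 ++ s2); split; first exact: chain_cat c1 c2.
    rewrite /chain_length big_cat /=.
    have -> : U `&` `]u, w]%classic =
              (U `&` `]u, v]%classic) `|` (U `&` `]v, w]%classic).
      rewrite -setIUr; congr (_ `&` _).
      by rewrite -itv_bndbnd_setU ?bnd_simp.
    rewrite measureU.
    - by rewrite EFinD leeD.
    - by apply: measurableI => //; exact: measurable_itv.
    - by apply: measurableI => //; exact: measurable_itv.
    - apply/seteqP; split => // z; rewrite /setI /= !in_itv /= => -[[_ +] [_ +]].
      by move=> /andP[_ zv] /andP[/lt_le_trans/(_ zv)]; rewrite ltxx.
  rewrite /chain_variation big_cat /= -/(chain_variation h s1)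
    -/(chain_variation h s2).
  have : `|h w - h u| <= `|h w - h v| + `|h v - h u|.
    by have := ler_normD (h w - h v) (h v - h u); rewrite addrA subrK.
  by move: h1 h2; lra.
move=> x /andP[ax xb].
have [Ax|nAx] := pselect (A x).
  have /nbhs_ballP[d /= d0 hball] : nbhs x U by apply: open_nbhs_nbhs; split=> //; exact: AU.
  exists d => // u v au ux xv vb uvd.
  exists [:: (u, v)]; split.
  - by rewrite /chain /= !lexx (le_trans ux xv).
  - rewrite /chain_length big_seq1 /=.
    have -> : U `&` `]u, v]%classic = `]u, v]%classic.
      apply/setIidPr => z; rewrite /= in_itv /= => /andP[uz zv].
      by apply: hball; rewrite /ball /= ltr_norml; move: uz zv uvd; lra.
    rewrite lebesgue_measure_itv /= lte_fin.
    by case: (ltP u v) => // vu; rewrite lee_fin subr_le0.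
  - rewrite /chain_variation big_seq1 /= lerDr mulr_ge0 ?(ltW e2) //.
    by rewrite subr_ge0 (le_trans ux xv).
have [d d0 hx] := hd x (introT andP (conj (le_trans a0 ax) (le_trans xb b1))) (fun z => nAx (ZA _ z)) _ e2.
exists d => // u v au ux xv vb uvd; exists [::]; split => //.
  by rewrite /chain_length big_nil measure_ge0.
rewrite /chain_variation big_nil addr0.
have /hx : 0 <= u <= 1 by lra.
have /hx : 0 <= v <= 1 by lra.
rewrite !mul0r !subr0 => h1 h2.
have hv : `|h v - h x| <= e / 2 * (v - x).
  by have := h1; rewrite (@ger0_norm _ (v - x)); [apply|]; lra.
have hu : `|h u - h x| <= e / 2 * (x - u).
  by have := h2; rewrite (@ler0_norm _ (u - x)) ?opprB; [apply|]; lra.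
have : `|h v - h u| <= `|h v - h x| + `|h u - h x|.
  rewrite [`|h u - h x|]distrC.
  by have := ler_normD (h v - h x) (h x - h u); rewrite addrA subrK.
by move: hu hv; lra.
Qed.

End absolute_continuity.

(** * Integration on [0, 1] *)

Section square_integrable.
Context {R : realType}.
Implicit Types (f g h : R -> R).
Local Notation mu := (@lebesgue_measure R).
Local Notation I01 := (`[0%R, 1%R]%classic : set R).

Lemma measurable_I01 : measurable (I01 : set (measurableTypeR R)).
Proof. exact: measurable_itv. Qed.
Local Hint Resolve measurable_I01 : core.

Lemma lebesgue_measure_I01 : mu I01 = 1%E.
Proof. by rewrite lebesgue_measure_itv /= lte_fin ltr01 oppr0 adde0. Qed.

Definition int01 f : R := \int[mu]_(t in I01) f t.

Definition integrable01 f : Prop := mu.-integrable I01 (EFin \o f).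

Definition sqint f : Prop :=
  measurable_fun I01 f /\ integrable01 (fun t => f t ^+ 2).

Lemma le_integrable01 f g : measurable_fun I01 f ->
  (forall t, 0 <= t <= 1 -> `|f t| <= g t) ->
  integrable01 g -> integrable01 f.
Proof.
move=> mf fg; apply: le_integrable => //; first exact/measurable_EFinP.
move=> t; rewrite /= in_itv /= => /fg h; rewrite lee_fin.
by rewrite (le_trans h)// ler_norm.
Qed.

Lemma eq_integrable01 f g : (forall t, 0 <= t <= 1 -> f t = g t) ->
  integrable01 f -> integrable01 g.
Proof.
move=> fg; apply: eq_integrable => // t; rewrite inE /= in_itv /= => t01.
by rewrite fg.
Qed.

Lemma integrable01_cst (c : R) : integrable01 (fun=> c).
Proof.
apply: measurable_bounded_integrable => //.
  by rewrite [ltLHS]lebesgue_measure_I01 ltry.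
exists `|c|; split; first by rewrite num_real.
by move=> x cx t _ /=; exact: ltW.
Qed.

Lemma integrable01D f g : integrable01 f -> integrable01 g ->
  integrable01 (fun t => f t + g t).
Proof.
move=> intf intg.
exact: (eq_integrable _ _ _ _ (integrableD measurable_I01 intf intg)).
Qed.

Lemma integrable01Z (c : R) f : integrable01 f ->
  integrable01 (fun t => c * f t).
Proof.
by move=> intf; exact: (eq_integrable _ _ _ _ (integrableZl measurable_I01 c intf)).
Qed.

Lemma integrable01N f : integrable01 f -> integrable01 (fun t => - f t).
Proof.
by move/(integrable01Z (-1)); apply: eq_integrable01 => t _; rewrite mulN1r.
Qed.

Lemma integrable01B f g : integrable01 f -> integrable01 g ->
  integrable01 (fun t => f t - g t).
Proof. by move=> intf intg; apply/integrable01D/integrable01N. Qed.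

Lemma integrable01_sum (J : Type) (s : seq J) (F : J -> R -> R) :
  (forall i, integrable01 (F i)) -> integrable01 (fun t => \sum_(i <- s) F i t).
Proof.
move=> iF; elim: s => [|i s IH].
  by apply: eq_integrable01 (integrable01_cst 0) => t _; rewrite big_nil.
by apply: eq_integrable01 (integrable01D (iF i) IH) => t _; rewrite big_cons.
Qed.

Lemma sqint_integrableM f g : sqint f -> sqint g ->
  integrable01 (fun t => f t * g t).
Proof.
move=> [mf intf] [mg intg].
apply: (le_integrable01 _ _ (integrable01D intf intg)).
  exact: measurable_funM.
move=> t _; rewrite normrM.
rewrite -(real_normK (num_real (f t))) -(real_normK (num_real (g t))).
have := sqr_ge0 (`|f t| - `|g t|).
have : 0 <= `|f t| * `|g t| by rewrite mulr_ge0.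
by nra.
Qed.

Lemma sqint_ext f g : (forall t, 0 <= t <= 1 -> f t = g t) ->
  sqint f -> sqint g.
Proof.
move=> fg [mf intf]; split.
  by apply: eq_measurable_fun mf => t; rewrite inE /= in_itv /=; exact: fg.
by apply: eq_integrable01 intf => t t01; rewrite fg.
Qed.

Lemma sqintD f g : sqint f -> sqint g -> sqint (fun t => f t + g t).
Proof.
move=> sf sg; split; first by apply: measurable_funD; [exact: sf.1|exact: sg.1].
have h := integrable01D sf.2 (integrable01D sg.2 (integrable01Z 2 (sqint_integrableM sf sg))).
by apply: eq_integrable01 h => t _; ring.
Qed.

Lemma sqintZ (c : R) f : sqint f -> sqint (fun t => c * f t).
Proof.
move=> sf; split; first by apply: measurable_funM => //; exact: sf.1.
by apply: eq_integrable01 (integrable01Z (c ^+ 2) sf.2) => t _; rewrite exprMn.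
Qed.

Lemma sqintN f : sqint f -> sqint (fun t => - f t).
Proof.
by move=> /(sqintZ (-1)); apply: sqint_ext => t _; rewrite mulN1r.
Qed.

Lemma sqintB f g : sqint f -> sqint g -> sqint (fun t => f t - g t).
Proof. by move=> sf sg; apply: sqintD => //; exact: sqintN. Qed.

Lemma sqint_bounded (c : R) f : measurable_fun I01 f ->
  (forall t, 0 <= t <= 1 -> `|f t| <= c) -> sqint f.
Proof.
move=> mf fc; split => //.
apply: (le_integrable01 _ _ (integrable01_cst (c ^+ 2))).
  exact: measurable_funX.
move=> t /fc ftc; rewrite ger0_norm ?sqr_ge0// -(real_normK (num_real (f t))).
by rewrite lerXn2r// nnegrE (le_trans _ ftc).
Qed.

Lemma sqint_cst (c : R) : sqint (fun=> c).
Proof. by apply: (@sqint_bounded `|c|) => //; exact: measurable_cst. Qed.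

Lemma sqint_sum (J : Type) (s : seq J) (Q : pred J) (F : J -> R -> R) :
  (forall i, Q i -> sqint (F i)) -> sqint (fun t => \sum_(i <- s | Q i) F i t).
Proof.
move=> sF; elim: s => [|i s IH].
  by apply: sqint_ext (sqint_cst 0) => t _; rewrite big_nil.
case Qi : (Q i).
  by apply: sqint_ext (sqintD (sF i Qi) IH) => t _; rewrite big_cons Qi.
by apply: sqint_ext IH => t _; rewrite big_cons Qi.
Qed.

Lemma sqint_integrable f : sqint f -> integrable01 f.
Proof.
move=> sf; have := sqint_integrableM sf (sqint_cst 1).
by apply: eq_integrable01 => t _; rewrite mulr1.
Qed.

Lemma eq_int01 f g : (forall t, 0 <= t <= 1 -> f t = g t) -> int01 f = int01 g.
Proof.
move=> fg; apply: eq_Rintegral => t; rewrite inE /= in_itv /=; exact: fg.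
Qed.

Lemma int01D f g : integrable01 f -> integrable01 g ->
  int01 (fun t => f t + g t) = int01 f + int01 g.
Proof. by move=> intf intg; apply: RintegralD. Qed.

Lemma int01B f g : integrable01 f -> integrable01 g ->
  int01 (fun t => f t - g t) = int01 f - int01 g.
Proof. by move=> intf intg; apply: RintegralB. Qed.

Lemma int01Z (c : R) f : integrable01 f ->
  int01 (fun t => c * f t) = c * int01 f.
Proof. by move=> intf; apply: RintegralZl. Qed.

Lemma int01_ge0 f : (forall t, 0 <= t <= 1 -> 0 <= f t) -> 0 <= int01 f.
Proof.
by move=> f0; apply: Rintegral_ge0 => t; rewrite /= in_itv /=; exact: f0.
Qed.

Lemma int01_cst (c : R) : int01 (fun=> c) = c.
Proof.
rewrite /int01 Rintegral_cst//=; first by rewrite lebesgue_measure_itv /= lte01 oppr0 adde0 mulr1.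
Qed.

Lemma int01_sum (J : Type) (s : seq J) (F : J -> R -> R) :
  (forall i, integrable01 (F i)) ->
  int01 (fun t => \sum_(i <- s) F i t) = \sum_(i <- s) int01 (F i).
Proof.
move=> iF; elim: s => [|i s IH].
  by rewrite big_nil -[RHS](int01_cst 0); apply: eq_int01 => t _; rewrite big_nil.
rewrite big_cons -IH -int01D//; last exact: integrable01_sum.
by apply: eq_int01 => t _; rewrite big_cons.
Qed.

Lemma le_int01 f g : integrable01 f -> integrable01 g ->
  (forall t, 0 <= t <= 1 -> f t <= g t) -> int01 f <= int01 g.
Proof.
move=> intf intg fg; rewrite -subr_ge0 -int01B//; apply: int01_ge0 => t t01.
by rewrite subr_ge0 fg.
Qed.

Lemma int01_fin f : integrable01 f ->
  (\int[mu]_(t in I01) (f t)%:E)%E = (int01 f)%:E.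
Proof.
by move=> intf; rewrite /int01 /Rintegral fineK//; exact: integrable_fin_num.
Qed.

End square_integrable.
#[global] Hint Resolve measurable_I01 : core.

(** * Integrals over subintervals and rules of differentiation *)

Section fundamental_theorem.
Context {R : realType}.
Implicit Types (f g h : R -> R).
Local Notation mu := (@lebesgue_measure R).

(** Half-open intervals, so that consecutive ones are disjoint and the integral is additive over
    them. *)
Definition intab (a b : R) f : R := \int[mu]_(t in `]a, b]%classic) f t.

Lemma integrable01S (a b : R) f : 0 <= a -> b <= 1 -> integrable01 f ->
  mu.-integrable `]a, b]%classic (EFin \o f).
Proof.
move=> a0 b1; apply: integrableS => //.
move=> t; rewrite /= !in_itv /= => /andP[/ltW/(le_trans a0) -> tb].
exact: le_trans tb b1.
Qed.

Lemma int01_intab f : integrable01 f -> int01 f = intab 0 1 f.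
Proof.
move=> intf; rewrite /int01 /intab Rintegral_itv_obnd_cbnd//.
exact: (integrable01S (lexx 0) (lexx 1) intf).
Qed.

Lemma intab_ge0 (a b : R) f : (forall t, a < t <= b -> 0 <= f t) ->
  0 <= intab a b f.
Proof.
by move=> f0; apply: Rintegral_ge0 => t; rewrite /= in_itv /=; exact: f0.
Qed.

Lemma intab_cst (a b c : R) : a <= b -> intab a b (fun=> c) = c * (b - a).
Proof.
move=> ab; rewrite /intab Rintegral_cst//=; congr (_ * _).
rewrite lebesgue_measure_itv /= lte_fin; case: ltP => // ba /=.
by apply/esym/eqP; rewrite subr_eq0 eq_le ab ba.
Qed.

Lemma intabD (a b : R) f g : 0 <= a -> b <= 1 -> integrable01 f ->
  integrable01 g -> intab a b (fun t => f t + g t) = intab a b f + intab a b g.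
Proof. by move=> a0 b1 intf intg; apply: RintegralD => //; exact: integrable01S. Qed.

Lemma intabZ (a b c : R) f : 0 <= a -> b <= 1 -> integrable01 f ->
  intab a b (fun t => c * f t) = c * intab a b f.
Proof. by move=> a0 b1 intf; apply: RintegralZl => //; exact: integrable01S. Qed.

Lemma le_intab (a b : R) f g : 0 <= a -> b <= 1 -> integrable01 f ->
  integrable01 g -> (forall t, a < t <= b -> f t <= g t) ->
  intab a b f <= intab a b g.
Proof.
move=> a0 b1 intf intg fg; rewrite -subr_ge0.
have -> : intab a b g - intab a b f = intab a b (fun t => g t + (-1) * f t).
  by rewrite intabD ?intabZ ?mulN1r//; exact: integrable01Z.
by apply: intab_ge0 => t /fg; rewrite mulN1r subr_ge0.
Qed.

Lemma intab_split (a b c : R) f : 0 <= a -> a <= b -> b <= c -> c <= 1 ->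
  integrable01 f -> intab a c f = intab a b f + intab b c f.
Proof.
move=> a0 ab bc c1 intf; rewrite /intab.
rewrite (@itv_bndbnd_setU _ _ _ (BRight b)) ?bnd_simp//.
rewrite Rintegral_setU//.
- rewrite -itv_bndbnd_setU ?bnd_simp//; exact: integrable01S.
- apply/disj_setPLR => t; rewrite /= !in_itv /= => /andP[_ tb].
  by apply/negP; rewrite negb_and -leNgt tb.
Qed.

(** Cauchy-Schwarz against the constant 1: expand the nonnegative integral of (g - c)^2, where c is
    the mean value of g on ]a, b]. *)
Lemma sqr_intab_le (a b : R) g : 0 <= a -> a <= b -> b <= 1 -> sqint g ->
  intab a b g ^+ 2 <= (b - a) * intab a b (fun t => g t ^+ 2).
Proof.
move=> a0 ab b1 sg; have intg := sqint_integrable sg.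
have [->|ab'] := eqVneq a b.
  by rewrite subrr mul0r /intab set_itvoc0 Rintegral_set0 expr0n.
have ba0 : 0 < b - a by rewrite subr_gt0 lt_neqAle ab' ab.
set s := intab a b g; pose c := s / (b - a).
have : 0 <= intab a b (fun t => g t ^+ 2 + ((- 2 * c) * g t + c ^+ 2)).
  by apply: intab_ge0 => t _; have := sqr_ge0 (g t - c); nra.
have i1 : integrable01 (fun t => - 2 * c * g t) by exact: integrable01Z.
rewrite intabD//; last 2 first.
- exact: sg.2.
- by apply: integrable01D => //; exact: integrable01_cst.
rewrite intabD//; last exact: integrable01_cst.
rewrite intabZ// intab_cst// -/s.
have -> : -2 * c * s + c ^+ 2 * (b - a) = - (s ^+ 2 / (b - a)).
  by rewrite /c; field; rewrite gt_eqF.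
by rewrite subr_ge0 ler_pdivrMr// mulrC.
Qed.

Lemma cvg_derive_at01 f (t l : R) :
  (h^-1 *: (f (h + t) - f t) @[h --> 0^'] --> l) -> derive_at01 f t l.
Proof.
move=> /cvgrPdist_le fl e e0.
have := fl e e0; rewrite /= /within /dnbhs /within /= => /nbhs_ballP[d /= d0 hd].
exists d => // s s01 std.
have [->|st] := eqVneq s t; first by rewrite !subrr mulr0 subrr normr0 mulr0.
have st0 : s - t != 0 by rewrite subr_eq0.
have := hd (s - t); rewrite /ball /= sub0r normrN => /(_ std st0).
rewrite subrK => hle.
have -> : f s - f t - l * (s - t) =
          - ((l - (s - t)^-1 *: (f s - f t)) * (s - t)).
  by rewrite /GRing.scale /=; field.
by rewrite normrN normrM ler_wpM2r.
Qed.

Lemma is_derive_derive_at01 f (t l : R) : is_derive t 1 f l ->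
  derive_at01 f t l.
Proof.
move=> fl; apply: cvg_derive_at01; have := @ex_derive _ _ _ _ _ _ _ fl.
rewrite -(@derive_val _ _ _ _ _ _ _ fl) => /cvg_ex[k kl].
suff -> : 'D_1 f t = k by move: kl; under eq_fun do rewrite [_ *: 1]mulr1.
by apply: cvg_lim.
Qed.

Lemma derive_at01D f g (t k l : R) : derive_at01 f t k -> derive_at01 g t l ->
  derive_at01 (fun s => f s + g s) t (k + l).
Proof.
move=> fk gl e e0; have e2 : 0 < e / 2 by rewrite divr_gt0.
have [d1 d10 h1] := fk _ e2; have [d2 d20 h2] := gl _ e2.
exists (Num.min d1 d2); first by rewrite lt_min d10.
move=> s s01; rewrite lt_min => /andP[/(h1 s s01) {}h1 /(h2 s s01) {}h2].
have -> : f s + g s - (f t + g t) - (k + l) * (s - t) =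
  (f s - f t - k * (s - t)) + (g s - g t - l * (s - t)) by ring.
by apply: (le_trans (ler_normD _ _)); move: h1 h2; lra.
Qed.

Lemma derive_at01Z (c : R) f (t k : R) : derive_at01 f t k ->
  derive_at01 (fun s => c * f s) t (c * k).
Proof.
move=> fk e e0; have c0 : 0 < `|c| + 1 by rewrite ltr_wpDl.
have [d d0 hd] := fk (e / (`|c| + 1)) (divr_gt0 e0 c0).
exists d => // s s01 /(hd s s01) {}hd.
have -> : c * f s - c * f t - c * k * (s - t) = c * (f s - f t - k * (s - t)) by ring.
rewrite normrM; apply: (le_trans (ler_wpM2l _ hd)) => //.
rewrite mulrA ler_wpM2r// mulrCA ler_piMr ?(ltW e0)//.
by rewrite ler_pdivrMr// mul1r lerDl.
Qed.

Lemma derive_at01B f g (t k l : R) : derive_at01 f t k -> derive_at01 g t l ->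
  derive_at01 (fun s => f s - g s) t (k - l).
Proof.
move=> fk /(derive_at01Z (-1)) gl; have := derive_at01D fk gl.
rewrite !mulN1r; suff -> : (fun s => f s + -1 * g s) = (fun s => f s - g s) by [].
by apply/funext => s; rewrite mulN1r.
Qed.

Lemma derive_at01_locally_lipschitz f (t k : R) : derive_at01 f t k ->
  exists2 d : R, 0 < d & forall s : R, 0 <= s <= 1 -> `|s - t| < d ->
    `|f s - f t| <= (`|k| + 1) * `|s - t|.
Proof.
move=> fk; have [d d0 hd] := fk 1 ltr01; exists d => // s s01 /(hd s s01).
rewrite mul1r => h.
have -> : f s - f t = (f s - f t - k * (s - t)) + k * (s - t) by ring.
by apply: (le_trans (ler_normD _ _)); rewrite normrM; lra.
Qed.

Lemma derive_at01M f g (t k l : R) : derive_at01 f t k -> derive_at01 g t l ->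
  derive_at01 (fun s => f s * g s) t (k * g t + f t * l).
Proof.
move=> fk gl e e0.
(* The three summands of the product expansion carry the factors |g t|, |f t| and (|k| + 1) (|l| +
   1), whose sum is below [A]. The condition |s - t| < e / A makes the product of the two increments
   linear in |s - t|. *)
pose A := `|g t| + 1 + `|f t| + (`|k| + 1) * (`|l| + 1).
have A0 : 0 < A.
  have := mulr_ge0 (addr_ge0 (normr_ge0 k) ler01) (addr_ge0 (normr_ge0 l) ler01).
  by rewrite /A; have := normr_ge0 (g t); have := normr_ge0 (f t); lra.
have eA : 0 < e / A by rewrite divr_gt0.
have [d1 d10 h1] := fk _ eA; have [d2 d20 h2] := gl _ eA.
have [d3 d30 h3] := derive_at01_locally_lipschitz fk.
have [d4 d40 h4] := derive_at01_locally_lipschitz gl.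
exists (Num.min (Num.min d1 d2) (Num.min (Num.min d3 d4) (e / A))).
  by rewrite !lt_min d10 d20 d30 d40.
move=> s s01; rewrite !lt_min.
move=> /andP[/andP[/(h1 s s01) {}h1 /(h2 s s01) {}h2]
  /andP[/andP[/(h3 s s01) {}h3 /(h4 s s01) {}h4] sA]].
have -> : f s * g s - f t * g t - (k * g t + f t * l) * (s - t) =
  (f s - f t - k * (s - t)) * g t + f t * (g s - g t - l * (s - t)) +
  (f s - f t) * (g s - g t) by ring.
have h5 : `|(f s - f t) * (g s - g t)| <=
    (`|k| + 1) * (`|l| + 1) * (e / A * `|s - t|).
  rewrite normrM; apply: (le_trans (ler_pM _ _ h3 h4)) => //.
  rewrite mulrACA ler_wpM2l ?mulr_ge0 ?addr_ge0//.
  by rewrite ler_wpM2r// ltW.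
have h6 : `|(f s - f t - k * (s - t)) * g t| <= `|g t| * (e / A * `|s - t|).
  by rewrite normrM mulrC ler_wpM2l.
have h7 : `|f t * (g s - g t - l * (s - t))| <= `|f t| * (e / A * `|s - t|).
  by rewrite normrM ler_wpM2l.
apply: (le_trans (ler_normD _ _)); apply: (le_trans (lerD (ler_normD _ _) h5)).
have -> : e * `|s - t| = A * (e / A * `|s - t|).
  by rewrite mulrA mulrCA divff ?mulr1// gt_eqF.
apply: (le_trans (lerD (lerD h6 h7) (lexx _))).
rewrite -!mulrDl ler_wpM2r//; first by rewrite mulr_ge0 ?(ltW eA).
by rewrite /A; lra.
Qed.

End fundamental_theorem.

(** * The Sobolev space H^1(0, 1) and the fundamental theorem of calculus *)

Section sobolev_one.
Context {R : realType}.
Implicit Types (f g h : R -> R).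
Local Notation mu := (@lebesgue_measure R).
Local Notation I01 := (`[0%R, 1%R]%classic : set R).

(** The space H^1(0, 1), as a relation between [f] and a chosen representative [g] of its
    derivative, which is determined only almost everywhere. *)
Definition sob1 f g : Prop := [/\ ac01 f,
  exists2 Z : set R, mu.-negligible Z &
    forall t : R, 0 <= t <= 1 -> ~ Z t -> derive_at01 f t (g t) &
  sqint g].

(** [G] stands for the indefinite integral of |g|. The intervals of a chain merge into one
    measurable set whose measure is the length of the chain, so the absolute continuity of [G] with
    respect to Lebesgue measure passes to [f]. *)
Lemma ac01_of_bounded_increments f (G : set R -> R) :
  (forall A, measurable (A : set (measurableTypeR R)) -> 0 <= G A) ->
  G set0 = 0 ->
  (forall A B, measurable (A : set (measurableTypeR R)) ->
     measurable (B : set (measurableTypeR R)) -> [disjoint A & B] ->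
     G (A `|` B) = G A + G B) ->
  (forall e : R, 0 < e -> exists2 d : R, 0 < d &
     forall A, measurable (A : set (measurableTypeR R)) ->
       (mu A < d%:E)%E -> G A < e) ->
  (forall a b : R, 0 <= a -> a <= b -> b <= 1 ->
     `|f b - f a| <= G `]a, b]%classic) ->
  ac01 f.
Proof.
move=> G0 Gset0 Gadd Gac fG e e0; have [d d0 hd] := Gac e e0.
exists d => // s.
(* The left end u is generalized so that, in the induction, the set built from the tail lies to the
   right of the first interval. *)
suff cover (u : R) : 0 <= u -> chain u 1 s ->
    exists A, [/\ measurable (A : set (measurableTypeR R)),
      A `<=` `]u, 1]%classic, mu A = (chain_length s)%:E &
      chain_variation f s <= G A].
  move=> /(cover 0 (lexx 0))[A [mA _ muA fGA]] sd.
  by apply: le_lt_trans fGA _; apply: hd => //; rewrite muA lte_fin.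
elim: s u => [|[a b] s IH] u u0.
  move=> _; exists set0; split => //.
    by rewrite measure0 /chain_length big_nil.
  by rewrite /chain_variation big_nil Gset0.
move=> /andP[/= /andP[/and3P[ua ab b1] al] /andP[sb p]].
have b0 : 0 <= b by exact: le_trans u0 (le_trans ua ab).
have /(IH b b0)[A [mA Ab muA fGA]] : chain b 1 s.
  rewrite /chain p andbT; apply/allP => x xs.
  move/allP: al => /(_ _ xs)/and3P[_ -> ->]; move/allP: sb => /(_ _ xs) /= ->.
  by [].
have abA : [disjoint `]a, b]%classic & A].
  apply/disj_setPLR => t; rewrite /= in_itv /= => /andP[_ tb] /Ab.
  by rewrite /= in_itv /= ltNge tb.
exists (`]a, b]%classic `|` A); split.
- by apply: measurableU => //; exact: measurable_itv.
- move=> t [|/Ab]; rewrite /= !in_itv /= => /andP[ta tb].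
    by rewrite (le_lt_trans ua ta) (le_trans tb b1).
  by rewrite (le_lt_trans _ ta) ?tb// (le_trans ua ab).
- rewrite measureU//; last exact/disj_set2P.
  rewrite /chain_length big_cons EFinD -/(chain_length s); congr (_ + _)%E => //.
  rewrite [LHS]lebesgue_measure_itv /= lte_fin; case: (ltP a b) => // ba.
  have /eqP -> : b == a by rewrite eq_le ba ab.
  by rewrite subrr.
- rewrite Gadd//.
  rewrite /chain_variation big_cons; apply: lerD => //=.
  by apply: fG => //; exact: le_trans u0 ua.
Qed.

Lemma ac01B f g : ac01 f -> ac01 g -> ac01 (fun t => f t - g t).
Proof.
move=> acf acg e e0; have e2 : 0 < e / 2 by rewrite divr_gt0.
have [d1 d10 h1] := acf _ e2; have [d2 d20 h2] := acg _ e2.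
exists (Num.min d1 d2); first by rewrite lt_min d10.
move=> s cs; rewrite lt_min => /andP[/(h1 s cs) {}h1 /(h2 s cs) {}h2].
apply: (@le_lt_trans _ _ (chain_variation f s + chain_variation g s)); last by lra.
rewrite /chain_variation -big_split /=; apply: ler_sum => x _.
have -> : f x.2 - g x.2 - (f x.1 - g x.1) = (f x.2 - f x.1) - (g x.2 - g x.1) by ring.
exact: ler_normB.
Qed.

Section primitive.
Variable g : R -> R.
Hypothesis intg : integrable01 g.

Let g0 := g \_ I01.

Let intg0 : mu.-integrable setT (EFin \o g0).
Proof.
rewrite /g0 -restrict_EFin; apply/integrable_restrict => //.
by rewrite setTI.
Qed.

(** Extending [g] by 0 and integrating from -oo gives a function on the whole line, to which the
    almost everywhere form of the fundamental theorem applies. *)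
Definition primitive (x : R) : R := \int[mu]_(t in `]-oo, x]%classic) g0 t.

Lemma primitiveB (a b : R) : 0 <= a -> a <= b -> b <= 1 ->
  primitive b - primitive a = intab a b g.
Proof.
move=> a0 ab b1; rewrite /primitive.
rewrite (@itv_bndbnd_setU _ _ _ (BRight a))//.
rewrite Rintegral_setU//.
- rewrite addrC addKr; apply: eq_Rintegral => t.
  rewrite inE /= in_itv /= => /andP[ta tb]; rewrite /g0 patchE mem_set//.
  by rewrite /= in_itv /= (le_trans a0 (ltW ta)) (le_trans tb b1).
- by apply: integrableS intg0 => //; apply: measurableU; exact: measurable_itv.
- apply/disj_setPLR => t; rewrite /= !in_itv /= => ta.
  by apply/negP; rewrite negb_and -leNgt ta.
Qed.

Lemma primitive_ac01 : ac01 primitive.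
Proof.
have intS A : measurable (A : set (measurableTypeR R)) ->
    mu.-integrable A (EFin \o (fun t => `|g0 t|)).
  by move=> mA; apply: integrableS (integrable_abse intg0).
apply: (@ac01_of_bounded_increments _ (fun A => \int[mu]_(t in A) `|g0 t|)).
- by move=> A mA; apply: Rintegral_ge0.
- by rewrite Rintegral_set0.
- move=> A B mA mB AB; rewrite Rintegral_setU//.
  by apply: intS; exact: measurableU.
- move=> e e0; have [d [d0 hd]] := integral_normr_continuous intg0 e0.
  by exists d.
- move=> a b a0 ab b1; rewrite primitiveB//.
  have -> : intab a b g = \int[mu]_(t in `]a, b]) g0 t.
    apply: eq_Rintegral => t.
    rewrite inE /= in_itv /= => /andP[ta tb]; rewrite /g0 patchE mem_set//.
    by rewrite /= in_itv /= (le_trans a0 (ltW ta)) (le_trans tb b1).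
  apply: le_normr_Rintegral => //.
  by apply: integrableS intg0.
Qed.

Lemma primitive_derive : exists2 Z : set R, mu.-negligible Z &
  forall t : R, 0 <= t <= 1 -> ~ Z t -> derive_at01 primitive t (g t).
Proof.
have locg0 : locally_integrable setT g0 by exact: integrable_locally.
have h : forall y, mu.-integrable `]-oo, y]%classic (EFin \o g0).
  by move=> y; apply: integrableS intg0.
have := FTC1Ny h locg0.
rewrite /= -/primitive => -[A [mA A0 AZ]].
exists A; first by exists A; split.
move=> t t01 nAt; apply: is_derive_derive_at01.
have [dt dE] : derivable primitive t 1 /\ derive1 primitive t = g0 t.
  by apply: contrapT => nt; apply: nAt; exact: AZ.
have g0t : g0 t = g t by rewrite /g0 patchE mem_set//= in_itv /=.
by apply: DeriveDef => //; rewrite -derive1E dE.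
Qed.

End primitive.

(** [f] minus the primitive of [g] is absolutely continuous with derivative 0 almost everywhere,
    hence constant. *)
Lemma sob1_FTC f g : sob1 f g -> forall a b : R, 0 <= a -> a <= b -> b <= 1 ->
  f b - f a = intab a b g.
Proof.
move=> [acf [Z Z0 fZ] sg] a b a0 ab b1.
have intg := sqint_integrable sg.
have [Z' Z'0 gZ'] := primitive_derive intg.
have : f a - primitive g a = f b - primitive g b.
  apply: (ac01_derive0_cst (ac01B acf (primitive_ac01 intg))
    (negligibleU Z0 Z'0)) => // t t01 nZ.
  rewrite -(subrr (g t)); apply: derive_at01B.
    by apply: fZ => // tZ; apply: nZ; left.
  by apply: gZ' => // tZ; apply: nZ; right.
by rewrite -(primitiveB intg)//; lra.
Qed.

End sobolev_one.

(** * Calculus in H^1(0, 1) *)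

Section sobolev_one_theory.
Context {R : realType}.
Implicit Types (f g h : R -> R).
Local Notation I01 := (`[0%R, 1%R]%classic : set R).

Lemma ac01_within_continuous f : ac01 f -> {within I01, continuous f}.
Proof.
move=> acf; apply/subspace_continuousP => x x01; apply/cvgrPdist_lt => e e0.
have [d d0 hd] := acf e e0.
rewrite /= /within /=; apply/nbhs_ballP; exists d => //= y xy y01.
move: x01 y01; rewrite /= !in_itv /= => /andP[x0 x1] /andP[y0 y1].
move: xy; rewrite /ball /= => xy.
wlog xley : x y x0 x1 y0 y1 xy / x <= y => [hw|].
  have [xley|/ltW ylex] := leP x y; first exact: hw.
  by rewrite distrC; apply: hw => //; rewrite distrC.
have := hd [:: (x, y)]; rewrite /chain_variation /chain_length !big_seq1 /=.
rewrite distrC; apply; first by rewrite /chain /= x0 xley y1.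
by move: xy; rewrite distrC ger0_norm// subr_ge0.
Qed.

Lemma ac01_measurable f : ac01 f -> measurable_fun I01 f.
Proof.
move=> /ac01_within_continuous.
exact: subspace_continuous_measurable_fun.
Qed.

Lemma sob1_bounded f g : sob1 f g -> exists2 c : R, 0 <= c &
  forall t, 0 <= t <= 1 -> `|f t| <= c.
Proof.
move=> s; have [_ _ sg] := s.
have i0 : 0 <= int01 (fun t => g t ^+ 2) by apply: int01_ge0 => t _; rewrite sqr_ge0.
(* By [sob1_FTC] and Cauchy-Schwarz, (f t - f 0)^2 is at most the integral i of g^2; the bound 1 + i
   on |f t - f 0| avoids a square root. *)
exists (`|f 0| + (1 + int01 (fun t => g t ^+ 2))); first by rewrite !addr_ge0.
move=> t /andP[t0 t1].
have := sob1_FTC s (lexx 0) t0 t1 => ft.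
have := sqr_intab_le (lexx 0) t0 t1 sg; rewrite -ft subr0 => fle.
have : t * intab 0 t (fun t => g t ^+ 2) <= int01 (fun t => g t ^+ 2).
  have gint := sg.2.
  rewrite int01_intab// (intab_split (lexx 0) t0 t1 (lexx 1))//.
  have p1 : 0 <= intab 0 t (fun t => g t ^+ 2) by apply: intab_ge0 => ? _; rewrite sqr_ge0.
  have p2 : 0 <= intab t 1 (fun t => g t ^+ 2) by apply: intab_ge0 => ? _; rewrite sqr_ge0.
  apply: (@le_trans _ _ (intab 0 t (fun t => g t ^+ 2))); last by rewrite lerDl.
  by rewrite -[leRHS]mul1r ler_wpM2r.
move=> /(le_trans fle); rewrite -(real_normK (num_real (f t - f 0))) => {}fle.
have fl : `|f t - f 0| <= 1 + int01 (fun t => g t ^+ 2).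
  by have := normr_ge0 (f t - f 0); move: fle i0; set u := `|_|; nra.
have : `|f t| <= `|f t - f 0| + `|f 0|.
  by have := ler_normD (f t - f 0) (f 0); rewrite subrK.
by move: fl; lra.
Qed.

Lemma sob1_sqint f g : sob1 f g -> sqint f.
Proof.
move=> s; have [c _ fc] := sob1_bounded s; have [acf _ _] := s.
by apply: (sqint_bounded (c := c)) => //; exact: ac01_measurable.
Qed.

Lemma sqint_boundedM (c : R) f g : measurable_fun I01 f ->
  (forall t, 0 <= t <= 1 -> `|f t| <= c) -> sqint g ->
  sqint (fun t => f t * g t).
Proof.
move=> mf fc sg; split; first by apply: measurable_funM => //; exact: sg.1.
apply: (le_integrable01 _ _ (integrable01Z (c ^+ 2) sg.2)).
  by apply: measurable_funX; apply: measurable_funM => //; exact: sg.1.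
move=> t /fc ftc; rewrite ger0_norm ?sqr_ge0// exprMn ler_wpM2r ?sqr_ge0//.
rewrite -(real_normK (num_real (f t))) lerXn2r// nnegrE.
exact: le_trans ftc.
Qed.

Lemma ac01D f g : ac01 f -> ac01 g -> ac01 (fun t => f t + g t).
Proof.
move=> acf acg; have acNg : ac01 (fun t => - g t).
  move=> e e0; have [d d0 hd] := acg e e0; exists d => // s cs /(hd s cs).
  rewrite /chain_variation; congr (_ < e); apply: eq_bigr => x _.
  by rewrite -opprD normrN.
apply: eq_ac01 (ac01B acf acNg) => t _.
by rewrite opprK.
Qed.

Lemma ac01M (c : R) f g : 0 <= c ->
  (forall t, 0 <= t <= 1 -> `|f t| <= c) ->
  (forall t, 0 <= t <= 1 -> `|g t| <= c) ->
  ac01 f -> ac01 g -> ac01 (fun t => f t * g t).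
Proof.
move=> c0 fc gc acf acg e e0.
have c1 : 0 < c + 1 by rewrite ltr_wpDl.
have e2 : 0 < e / (2 * (c + 1)) by rewrite divr_gt0// mulr_gt0.
have [d1 d10 h1] := acf _ e2; have [d2 d20 h2] := acg _ e2.
exists (Num.min d1 d2); first by rewrite lt_min d10.
move=> s cs; rewrite lt_min => /andP[/(h1 s cs) {}h1 /(h2 s cs) {}h2].
apply: (@le_lt_trans _ _ ((c + 1) * (chain_variation f s + chain_variation g s))).
  rewrite /chain_variation -big_split /= mulr_sumr !big_seq; apply: ler_sum => x xs.
  move: cs => /andP[/allP/(_ _ xs)/and3P[x1 x12 x2] _].
  have f1 : `|f x.1| <= c by apply: fc; rewrite x1 (le_trans x12).
  have g2 : `|g x.2| <= c by apply: gc; rewrite x2 (le_trans x1).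
  have -> : f x.2 * g x.2 - f x.1 * g x.1 =
    (f x.2 - f x.1) * g x.2 + f x.1 * (g x.2 - g x.1) by ring.
  apply: (le_trans (ler_normD _ _)); rewrite !normrM mulrDr mulrC.
  by apply: lerD; apply: ler_wpM2r => //; lra.
rewrite mulrC -ltr_pdivlMr//.
have -> : e / (c + 1) = e / (2 * (c + 1)) + e / (2 * (c + 1)).
  by field; rewrite gt_eqF.
exact: ltrD.
Qed.

Lemma sob1M f f' g g' : sob1 f f' -> sob1 g g' ->
  sob1 (fun t => f t * g t) (fun t => f' t * g t + f t * g' t).
Proof.
move=> sf sg; have [cf cf0 hf] := sob1_bounded sf.
have [cg cg0 hg] := sob1_bounded sg.
have [acf [Z Z0 fZ] sf'] := sf; have [acg [Z' Z'0 gZ'] sg'] := sg.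
split.
- apply: (@ac01M (cf + cg)) => //; first by rewrite addr_ge0.
  + by move=> t /hf /le_trans; apply; rewrite lerDl.
  + by move=> t /hg /le_trans; apply; rewrite lerDr.
- exists (Z `|` Z'); first exact: negligibleU.
  move=> t t01 nZ; apply: derive_at01M.
    by apply: fZ => // tZ; apply: nZ; left.
  by apply: gZ' => // tZ; apply: nZ; right.
- apply: sqintD.
    apply: (@sqint_ext _ (fun t => g t * f' t)); first by move=> t _; rewrite mulrC.
    by apply: (sqint_boundedM (c := cg)) => //; exact: ac01_measurable.
  by apply: (sqint_boundedM (c := cf)) => //; exact: ac01_measurable.
Qed.

Lemma sob1D f f' g g' : sob1 f f' -> sob1 g g' ->
  sob1 (fun t => f t + g t) (fun t => f' t + g' t).
Proof.
move=> [acf [Z Z0 fZ] sf'] [acg [Z' Z'0 gZ'] sg']; split.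
- exact: ac01D.
- exists (Z `|` Z'); first exact: negligibleU.
  move=> t t01 nZ; apply: derive_at01D.
    by apply: fZ => // tZ; apply: nZ; left.
  by apply: gZ' => // tZ; apply: nZ; right.
- exact: sqintD.
Qed.

Lemma lipschitz_ac01 (c : R) f :
  (forall a b : R, 0 <= a -> a <= b -> b <= 1 -> `|f b - f a| <= c * (b - a)) ->
  ac01 f.
Proof.
move=> fc e e0; have c0 : 0 <= c.
  have := fc 0 1 (lexx 0) ler01 (lexx 1); rewrite subr0 mulr1.
  exact: le_trans.
have c1 : 0 < c + 1 by rewrite ltr_wpDl.
exists (e / (c + 1)); first by rewrite divr_gt0.
move=> s cs; rewrite ltr_pdivlMr// mulrC; apply: le_lt_trans.
rewrite /chain_variation /chain_length mulr_sumr !big_seq; apply: ler_sum => x xs.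
move: cs => /andP[/allP/(_ _ xs)/and3P[x1 x12 x2] _].
apply: (le_trans (fc _ _ x1 x12 x2)).
by rewrite ler_wpM2r ?subr_ge0// lerDl.
Qed.

(** Mean value inequality for one-sided derivatives: with a slack e in the slope, the bound holds on
    short intervals around each point and is additive, so [cousin_induction] spreads it to
    [a, b]. *)
Lemma derive_at01_lipschitz (c : R) f g :
  (forall t : R, 0 <= t <= 1 -> derive_at01 f t (g t)) ->
  (forall t : R, 0 <= t <= 1 -> `|g t| <= c) ->
  forall a b : R, 0 <= a -> a <= b -> b <= 1 -> `|f b - f a| <= c * (b - a).
Proof.
move=> fg gc a b a0 ab b1; apply/ler_addgt0Pl => e e0.
have e2 : 0 < e / 2 by rewrite divr_gt0.
apply: (@le_trans _ _ ((c + e) * (b - a))); last first.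
  rewrite mulrDl addrC lerD2r ler_piMr ?(ltW e0)//; lra.
apply: (@cousin_induction _ (fun u v => `|f v - f u| <= (c + e) * (v - u))) => //.
  move=> u v w _ _ _ _ h1 h2.
  have -> : f w - f u = (f w - f v) + (f v - f u) by ring.
  by apply: (le_trans (ler_normD _ _)); move: h1 h2; lra.
move=> x /andP[ax xb]; have x01 : 0 <= x <= 1 by lra.
have [d d0 hd] := fg x x01 _ e0; exists d => // u v au ux xv vb uvd.
have /hd hu : 0 <= u <= 1 by lra.
have /hd hv : 0 <= v <= 1 by lra.
have gx := gc x x01.
have hv' : `|f v - f x| <= (c + e) * (v - x).
  have -> : f v - f x = (f v - f x - g x * (v - x)) + g x * (v - x) by ring.
  apply: (le_trans (ler_normD _ _)); rewrite addrC mulrDl; apply: lerD.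
    by rewrite normrM (@ger0_norm _ (v - x)) ?subr_ge0// ler_wpM2r ?subr_ge0.
  by move: hv; rewrite (@ger0_norm _ (v - x)) ?subr_ge0//; apply; lra.
have hu' : `|f u - f x| <= (c + e) * (x - u).
  have -> : f u - f x = (f u - f x - g x * (u - x)) + g x * (u - x) by ring.
  apply: (le_trans (ler_normD _ _)); rewrite addrC mulrDl; apply: lerD.
    by rewrite normrM (distrC u) (@ger0_norm _ (x - u)) ?subr_ge0// ler_wpM2r ?subr_ge0.
  by move: hu; rewrite (distrC u) (@ger0_norm _ (x - u)) ?subr_ge0//; apply; lra.
have -> : f v - f u = (f v - f x) - (f u - f x) by ring.
by apply: (le_trans (ler_normB _ _)); move: hu' hv'; lra.
Qed.

Lemma derive_at01_sob1 f g :
  (forall t : R, 0 <= t <= 1 -> derive_at01 f t (g t)) ->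
  (exists c : R, forall t : R, 0 <= t <= 1 -> `|g t| <= c) ->
  measurable_fun I01 g -> sob1 f g.
Proof.
move=> fg [c gc] mg; split.
- exact: lipschitz_ac01 (derive_at01_lipschitz fg gc).
- by exists set0; [exact: negligible_set0|move=> t t01 _; exact: fg].
- exact: sqint_bounded gc.
Qed.

(** Absolute continuity is given for [D alpha.-1] only. Descending from there, each [D j.+1] is
    bounded and measurable, so [D j], which has it as derivative everywhere, is Lipschitz. *)
Lemma periodic_sobolev_sob1 (alpha : nat) (L : R) f : (0 < alpha)%N ->
  periodic_sobolev alpha L f -> exists D : nat -> R -> R, [/\
    forall t : R, 0 <= t <= 1 -> D 0%N t = f t,
    forall j, (j < alpha)%N -> sob1 (D j) (D j.+1),
    int01 (fun t => D alpha t ^+ 2) <= L ^+ 2 &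
    forall j, (j < alpha)%N -> D j 0 = D j 1].
Proof.
move=> a0 [D [D0 [DS [acD [aeD [mD [Dle Dper]]]]]]]; exists D; split => //.
- have sq : sqint (D alpha).
    split => //; apply/integrableP; split.
      by apply/measurable_EFinP; exact: measurable_funX.
    apply: le_lt_trans (ltry (L ^+ 2)); apply: le_trans Dle.
    rewrite le_eqVlt; apply/orP; left; apply/eqP; apply: eq_integral => t _ /=.
    by rewrite ger0_norm// sqr_ge0.
  have last : sob1 (D alpha.-1) (D alpha).
    split => //; first exact: abs_continuous01_ac01.
    move: aeD => [A [mA A0 AZ]]; exists A; first by exists A; split.
    move=> t t01 nA; apply: is_derive01_derive_at01; apply: contrapT => nt.
    by apply: nA; apply: AZ => /= h; apply: nt; apply: h; rewrite in_itv.
  suff down k : (k < alpha)%N -> sob1 (D (alpha.-1 - k)%N) (D (alpha.-1 - k).+1).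
    move=> j ja; have := down (alpha.-1 - j)%N.
    have -> : (alpha.-1 - (alpha.-1 - j) = j)%N by lia.
    by apply; lia.
  elim: k => [_|k IH ka].
    have -> : (alpha.-1 - 0 = alpha.-1)%N by lia.
    by rewrite prednK.
  have {}IH := IH (ltnW ka).
  have E : (alpha.-1 - k.+1).+1 = (alpha.-1 - k)%N.
    by lia.
  rewrite E; apply: derive_at01_sob1.
  + move=> t t01; rewrite -E; apply: is_derive01_derive_at01; apply: DS.
      by lia.
    by rewrite in_itv.
  + by have [c _ hc] := sob1_bounded IH; exists c.
  + by have [acI _ _] := IH; exact: ac01_measurable.
- rewrite -lee_fin -int01_fin//.
  apply/integrableP; split; first by apply/measurable_EFinP; exact: measurable_funX.
  apply: le_lt_trans (ltry (L ^+ 2)); apply: le_trans Dle.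
  rewrite le_eqVlt; apply/orP; left; apply/eqP; apply: eq_integral => t _ /=.
  by rewrite ger0_norm// sqr_ge0.
Qed.

End sobolev_one_theory.

(** * The trigonometric basis *)

Section trigonometric.
Context {R : realType}.
Implicit Types (i j : int) (k l : nat) (t : R).

(** Frequencies are integers so that the product formulas hold for i - j of either sign. *)
Definition cosf i t : R := cos (2 * pi * i%:~R * t).
Definition sinf i t : R := sin (2 * pi * i%:~R * t).

Lemma cosf0 t : cosf 0 t = 1.
Proof. by rewrite /cosf mulr0 mul0r cos0. Qed.

Lemma sinf0 t : sinf 0 t = 0.
Proof. by rewrite /sinf mulr0 mul0r sin0. Qed.

Lemma cosf_sinf_add2pi i t :
  cosf i (t + 1) = cosf i t /\ sinf i (t + 1) = sinf i t.
Proof.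
have key (n : nat) (x : R) : cos (x + 2 * pi * n%:R) = cos x /\
    sin (x + 2 * pi * n%:R) = sin x.
  elim: n x => [|n IH] x; first by rewrite mulr0 addr0.
  have -> : x + 2 * pi * n.+1%:R = (x + 2 * pi * n%:R) + pi *+ 2.
    by rewrite -natr1 mulr2n; ring.
  by rewrite cosD2pi sinD2pi; exact: IH.
rewrite /cosf /sinf; move: key; move: (2 * pi) => p key.
rewrite !mulrDr !mulr1; case: (intP i) => [|n|n].
- by rewrite !(mulr0, mul0r, addr0).
- by rewrite -!pmulrn; exact: key.
- have := key n.+1 (p * (- n.+1%:Z)%:~R * t + p * (- n.+1%:Z)%:~R).
  by rewrite mulrNz -!pmulrn mulrN mulNr subrK => -[-> ->].
Qed.

Lemma cosf1 i : cosf i 1 = 1.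
Proof. by have [h _] := cosf_sinf_add2pi i 0; rewrite add0r in h; rewrite h /cosf mulr0 cos0. Qed.

Lemma sinf1 i : sinf i 1 = 0.
Proof. by have [_ h] := cosf_sinf_add2pi i 0; rewrite add0r in h; rewrite h /sinf mulr0 sin0. Qed.

Lemma cosfM i j t : cosf i t * cosf j t =
  2^-1 * cosf (i - j) t + 2^-1 * cosf (i + j) t.
Proof.
rewrite /cosf; move: (2 * pi) => p.
rewrite rmorphB rmorphD /= !(mulrBr, mulrDr) !(mulrBl, mulrDl) cosB cosD.
by field.
Qed.

Lemma sinfM i j t : sinf i t * sinf j t =
  2^-1 * cosf (i - j) t + (- 2^-1) * cosf (i + j) t.
Proof.
rewrite /cosf /sinf; move: (2 * pi) => p.
rewrite rmorphB rmorphD /= !(mulrBr, mulrDr) !(mulrBl, mulrDl) cosB cosD.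
by field.
Qed.

Lemma sinf_cosfM i j t : sinf i t * cosf j t =
  2^-1 * sinf (i + j) t + 2^-1 * sinf (i - j) t.
Proof.
rewrite /cosf /sinf; move: (2 * pi) => p.
rewrite rmorphB rmorphD /= !(mulrBr, mulrDr) !(mulrBl, mulrDl) sinB sinD.
by field.
Qed.

Lemma trig_basis_even k t : ~~ odd k ->
  trig_basis k t = Num.sqrt 2 * cosf (k./2) t.
Proof.
move=> ek; rewrite /trig_basis (negbTE ek).
case: eqVneq => [k1|_]; first by rewrite k1 in ek.
rewrite /cosf -pmulrn -{1}(even_halfK ek) -muln2 natrM; move: pi => q.
by congr (_ * cos _); ring.
Qed.

Lemma trig_basis_odd k t : odd k -> k != 1%N ->
  trig_basis k t = Num.sqrt 2 * sinf (k./2) t.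
Proof.
move=> ok /negbTE k1; rewrite /trig_basis k1 ok.
have k0 : (0 < k)%N by case: k ok {k1}.
have -> : k.-1 = (k./2).*2 by rewrite odd_halfK.
rewrite /sinf -pmulrn -muln2 natrM; move: pi => q.
by congr (_ * sin _); ring.
Qed.

Lemma trig_basis1 t : trig_basis 1 t = 1 :> R.
Proof. by []. Qed.

Lemma trig_basisD1 k t : (0 < k)%N -> trig_basis k (t + 1) = trig_basis k t :> R.
Proof.
move=> k0; have [->//|k1] := eqVneq k 1%N.
have [h1 h2] := cosf_sinf_add2pi (k./2) t.
have [ok|ek] := boolP (odd k); first by rewrite !trig_basis_odd// h2.
by rewrite !trig_basis_even// h1.
Qed.

Lemma trig_basis_bound k t : `|trig_basis k t| <= 2 :> R.
Proof.
have s2 : Num.sqrt 2 <= 2 :> R.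
  by rewrite -[leRHS](@ger0_norm R)// -sqrtr_sqr ler_sqrt ?exprn_ge0// expr2; lra.
rewrite /trig_basis; case: ifP => _; first by rewrite normr1 ler1n.
case: ifP => _; rewrite normrM ger0_norm ?sqrtr_ge0// -[leRHS]mulr1;
  apply: ler_pM => //; rewrite ler_norml ?sin_geN1 ?sin_le1 ?cos_geN1 ?cos_le1//.
Qed.

(** A common interface for the integral over [0, 1], where [Q] is integrability, and for the average
    over the grid j/m, where [Q] is trivial. Orthonormality and Parseval are proved once for
    both. *)
Definition sum_linear (L : (R -> R) -> R) (Q : (R -> R) -> Prop) : Prop :=
  forall (s : seq nat) (a : nat -> R) (F : nat -> R -> R),
    (forall k, Q (F k)) ->
    L (fun t => \sum_(k <- s) a k * F k t) = \sum_(k <- s) a k * L (F k).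

Section orthonormality.
Variables (L : (R -> R) -> R) (Q : (R -> R) -> Prop) (B : nat).
Hypothesis Lsum : sum_linear L Q.
Hypothesis Qcos : forall i, Q (cosf i).
Hypothesis Qsin : forall i, Q (sinf i).
Hypothesis Lcos : forall i, (`|i| < B)%N -> L (cosf i) = (i == 0)%:R.
Hypothesis Lsin : forall i, (`|i| < B)%N -> L (sinf i) = 0.

Let Llin2 (a b : R) (f g : R -> R) : Q f -> Q g ->
  L (fun t => a * f t + b * g t) = a * L f + b * L g.
Proof.
move=> Qf Qg; have := @Lsum [:: 0%N; 1%N] (fun k => if k == 0%N then a else b)
  (fun k => if k == 0%N then f else g).
rewrite !big_cons big_nil /= addr0 => <-; last by case=> [|k].
by congr L; apply/funext => t; rewrite !big_cons big_nil /= addr0.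
Qed.

(** The product-to-sum formulas leave the single frequencies k./2 - l./2 and k./2 + l./2. The bound
    [B] keeps both below the aliasing threshold, which is m on the grid and can be taken arbitrarily
    large for the integral. *)
Lemma orthonormal_trig_basis k l : (0 < k)%N -> (0 < l)%N ->
  (k./2 + l./2 < B)%N ->
  L (fun t => trig_basis k t * trig_basis l t) = (k == l)%:R.
Proof.
move=> k0 l0 klB.
have B1 : (`|((k./2)%:Z - (l./2)%:Z)%R| < B)%N by lia.
have B2 : (`|((k./2)%:Z + (l./2)%:Z)%R| < B)%N by lia.
have B3 : (`|((l./2)%:Z - (k./2)%:Z)%R| < B)%N by lia.
have B4 : (`|((l./2)%:Z + (k./2)%:Z)%R| < B)%N by lia.
have s2 : Num.sqrt 2 * Num.sqrt 2 = 2 :> R by rewrite -expr2 sqr_sqrtr.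
have nz (n : nat) : (0 < n)%N -> n != 1%N -> (0 < n./2)%N by case: n => [|[|n]].
(* Index 1 is treated as the cosine of frequency 0, with weight 1 in place of sqrt 2, so only the
   four sine-cosine combinations remain. *)
pose a (n : nat) : R := if n == 1%N then 1 else Num.sqrt 2.
have ecos (n : nat) : (n == 1%N) || ~~ odd n ->
    trig_basis n = (fun t => a n * cosf (n./2) t).
  move=> h; apply/funext => t; rewrite /a; case: eqVneq h => [-> _|n1 /= en].
    by rewrite cosf0 mulr1.
  exact: trig_basis_even.
have esin (n : nat) : ~~ ((n == 1%N) || ~~ odd n) ->
    trig_basis n = (fun t => Num.sqrt 2 * sinf (n./2) t).
  by rewrite negb_or negbK => /andP[n1 on]; apply/funext => t; rewrite trig_basis_odd.
have [ck|sk] := boolP ((k == 1%N) || ~~ odd k);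
  have [cl|sl] := boolP ((l == 1%N) || ~~ odd l).
- have -> : (fun t => trig_basis k t * trig_basis l t) =
    (fun t => (a k * a l / 2) * cosf ((k./2)%:Z - (l./2)%:Z) t +
              (a k * a l / 2) * cosf ((k./2)%:Z + (l./2)%:Z) t).
    apply/funext => t; rewrite (ecos _ ck) (ecos _ cl).
    by rewrite mulrACA cosfM; ring.
  rewrite Llin2// !Lcos//.
  have -> : ((k./2)%:Z + (l./2)%:Z == 0) = (k == 1%N) && (l == 1%N).
    by apply/idP/idP; move: ck cl k0 l0; lia.
  have -> : ((k./2)%:Z - (l./2)%:Z == 0) = (k == l).
    by apply/idP/idP; move: ck cl k0 l0; lia.
  rewrite /a; have [<-|kl] := eqVneq k l.
    case: eqVneq => [k1|k1] /=; first by rewrite !mulr1; field.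
    by rewrite s2 mulr0 mulr1 addr0 divff.
  have -> : (k == 1%N) && (l == 1%N) = false.
    by apply/negbTE; apply: contraNN kl => /andP[/eqP-> /eqP->].
  by rewrite !mulr0 addr0.
- have -> : (fun t => trig_basis k t * trig_basis l t) =
    (fun t => (a k * Num.sqrt 2 / 2) * sinf ((l./2)%:Z + (k./2)%:Z) t +
              (a k * Num.sqrt 2 / 2) * sinf ((l./2)%:Z - (k./2)%:Z) t).
    apply/funext => t; rewrite (ecos _ ck) (esin _ sl).
    by rewrite mulrACA [cosf _ _ * _]mulrC sinf_cosfM; ring.
  rewrite Llin2// !Lsin// !mulr0 addr0; case: eqVneq => // kl.
  by rewrite kl (negbTE sl) in ck.
- have -> : (fun t => trig_basis k t * trig_basis l t) =
    (fun t => (a l * Num.sqrt 2 / 2) * sinf ((k./2)%:Z + (l./2)%:Z) t +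
              (a l * Num.sqrt 2 / 2) * sinf ((k./2)%:Z - (l./2)%:Z) t).
    apply/funext => t; rewrite (esin _ sk) (ecos _ cl).
    by rewrite mulrACA sinf_cosfM; ring.
  rewrite Llin2// !Lsin// !mulr0 addr0; case: eqVneq => // kl.
  by rewrite -kl (negbTE sk) in cl.
- have -> : (fun t => trig_basis k t * trig_basis l t) =
    (fun t => 1 * cosf ((k./2)%:Z - (l./2)%:Z) t +
              (-1) * cosf ((k./2)%:Z + (l./2)%:Z) t).
    apply/funext => t; rewrite (esin _ sk) (esin _ sl).
    by rewrite mulrACA sinfM s2; field.
  rewrite Llin2// !Lcos//.
  have -> : ((k./2)%:Z + (l./2)%:Z == 0) = false.
    by apply/negbTE; move: sk sl k0 l0; lia.
  have -> : ((k./2)%:Z - (l./2)%:Z == 0) = (k == l).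
    by apply/idP/idP; move: sk sl k0 l0; lia.
  by rewrite mulr0 addr0 mul1r.
Qed.

End orthonormality.

End trigonometric.

(** * Integrals and grid averages of trigonometric functions *)

Section trig_functionals.
Context {R : realType}.
Implicit Types (i j : int) (k l : nat) (t : R).
Local Notation I01 := (`[0%R, 1%R]%classic : set R).

Lemma derive_cos_sin_scale (p t : R) :
  derive_at01 (fun s => cos (p * s)) t (- (p * sin (p * t))) /\
  derive_at01 (fun s => sin (p * s)) t (p * cos (p * t)).
Proof.
have dp : is_derive t 1 (fun s => p * s) p.
  have -> : (fun s => p * s) = p \*: id by [].
  have := @is_deriveZ R R^o R^o id p t 1 1 (is_derive_id _ _).
  by rewrite /GRing.scale /= mulr1.
split; apply: is_derive_derive_at01.
  have := is_derive1_comp (is_derive_cos (p * t)) dp.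
  by rewrite mulNr mulrC.
have := is_derive1_comp (is_derive_sin (p * t)) dp.
by rewrite mulrC.
Qed.

Lemma cosf_derive i t :
  derive_at01 (cosf i) t (- (2 * pi * i%:~R * sinf i t)).
Proof. exact: (derive_cos_sin_scale _ _).1. Qed.

Lemma sinf_derive i t : derive_at01 (sinf i) t (2 * pi * i%:~R * cosf i t).
Proof. exact: (derive_cos_sin_scale _ _).2. Qed.

Lemma continuous_cosf i : continuous (cosf i : R -> R).
Proof.
move=> t; apply: (@continuous_comp _ _ _ (fun s => 2 * pi * i%:~R * s) cos).
  exact: mulrl_continuous.
exact: continuous_cos.
Qed.

Lemma continuous_sinf i : continuous (sinf i : R -> R).
Proof.
move=> t; apply: (@continuous_comp _ _ _ (fun s => 2 * pi * i%:~R * s) sin).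
  exact: mulrl_continuous.
exact: continuous_sin.
Qed.

Lemma continuous_measurable_I01 (f : R -> R) : continuous f -> measurable_fun I01 f.
Proof. by move=> cf; apply: measurable_funTS; exact: continuous_measurable_fun. Qed.

Lemma sqint_cosf i : sqint (cosf i : R -> R).
Proof.
apply: (@sqint_bounded _ 1).
  by apply: continuous_measurable_I01; exact: continuous_cosf.
by move=> t _; rewrite ler_norml cos_geN1 cos_le1.
Qed.

Lemma sqint_sinf i : sqint (sinf i : R -> R).
Proof.
apply: (@sqint_bounded _ 1).
  by apply: continuous_measurable_I01; exact: continuous_sinf.
by move=> t _; rewrite ler_norml sin_geN1 sin_le1.
Qed.

Lemma sob1_sinf i : sob1 (sinf i) (fun t => 2 * pi * i%:~R * cosf i t).
Proof.
have mc := (sqintZ (2 * pi * i%:~R) (sqint_cosf i)).1.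
apply: derive_at01_sob1 => //; first by move=> t _; exact: sinf_derive.
exists `|2 * pi * i%:~R| => t _; rewrite normrM ler_piMr//.
by rewrite ler_norml cos_geN1 cos_le1.
Qed.

Lemma sob1_cosf i : sob1 (cosf i) (fun t => - (2 * pi * i%:~R * sinf i t)).
Proof.
have mc := (sqintN (sqintZ (2 * pi * i%:~R) (sqint_sinf i))).1.
apply: derive_at01_sob1 => //; first by move=> t _; exact: cosf_derive.
exists `|2 * pi * i%:~R| => t _; rewrite normrN normrM ler_piMr//.
by rewrite ler_norml sin_geN1 sin_le1.
Qed.

Lemma sob1_int01 (f g : R -> R) : sob1 f g -> int01 g = f 1 - f 0.
Proof.
move=> s; have [_ _ /sqint_integrable sg] := s.
by rewrite int01_intab// (sob1_FTC s).
Qed.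

Lemma two_pi_int_neq0 i : i != 0 -> 2 * pi * i%:~R != 0 :> R.
Proof.
by move=> i0; rewrite !mulf_neq0 ?intr_eq0 ?pnatr_eq0// gt_eqF// pi_gt0.
Qed.

(** For a nonzero frequency, a nonzero multiple of the cosine is the derivative of the sine, which
    takes equal values at 0 and 1. *)
Lemma int01_cosf i : int01 (cosf i) = (i == 0)%:R :> R.
Proof.
have [->|i0] := eqVneq i 0.
  by rewrite -[RHS](int01_cst 1); apply: eq_int01 => t _; rewrite cosf0.
have := sob1_int01 (sob1_sinf i).
rewrite int01Z; last exact/sqint_integrable/sqint_cosf.
rewrite sinf1 /sinf mulr0 sin0 subrr => /eqP.
by rewrite mulf_eq0 (negbTE (two_pi_int_neq0 i0)) => /eqP.
Qed.

Lemma int01_sinf i : int01 (sinf i) = 0 :> R.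
Proof.
have [->|i0] := eqVneq i 0.
  by rewrite -[RHS](int01_cst 0); apply: eq_int01 => t _; rewrite sinf0.
have := sob1_int01 (sob1_cosf i).
under eq_int01 do rewrite -mulNr.
rewrite int01Z; last exact/sqint_integrable/sqint_sinf.
rewrite cosf1 /cosf mulr0 cos0 subrr => /eqP.
by rewrite mulf_eq0 oppr_eq0 (negbTE (two_pi_int_neq0 i0)) => /eqP.
Qed.

Lemma sum_linear_int01 : sum_linear (@int01 R) integrable01.
Proof.
move=> s a F iF; rewrite int01_sum; last by move=> k; exact: integrable01Z.
by apply: eq_bigr => k _; rewrite int01Z.
Qed.

Lemma int01_trig_basis k l : (0 < k)%N -> (0 < l)%N ->
  int01 (fun t => trig_basis k t * trig_basis l t) = (k == l)%:R :> R.
Proof.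
move=> k0 l0.
apply: (@orthonormal_trig_basis _ _ integrable01 (k + l).+1) => //.
- exact: sum_linear_int01.
- by move=> i; exact/sqint_integrable/sqint_cosf.
- by move=> i; exact/sqint_integrable/sqint_sinf.
- by move=> i _; exact: int01_cosf.
- by move=> i _; exact: int01_sinf.
- by lia.
Qed.

Lemma sqint_trig_basis k : sqint (trig_basis k : R -> R).
Proof.
have [->|k1] := eqVneq k 1%N; first exact: sqint_cst.
have [ok|ek] := boolP (odd k).
  apply: sqint_ext (sqintZ (Num.sqrt 2) (sqint_sinf (k./2))) => t _.
  by rewrite trig_basis_odd.
apply: sqint_ext (sqintZ (Num.sqrt 2) (sqint_cosf (k./2))) => t _.
by rewrite trig_basis_even.
Qed.

(** Ordinals start at 0, so [j.+1] runs over the sampling points 1/m, ..., 1: the point 1 belongs to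
    the grid and 0 does not. *)
Definition davg (m : nat) (f : R -> R) : R :=
  m%:R^-1 * \sum_(j < m) f (j.+1%:R / m%:R).

Lemma sum_linear_davg m : sum_linear (davg m) (fun=> True).
Proof.
move=> s a F _; rewrite /davg exchange_big mulr_sumr /=; apply: eq_bigr => k _.
by rewrite -mulr_sumr mulrCA.
Qed.

(** A shift by one step permutes the grid modulo 1. *)
Lemma davg_shift (m : nat) (f : R -> R) : (forall t, f (t + 1) = f t) ->
  davg m (fun t => f (t + m%:R^-1)) = davg m f.
Proof.
move=> fper; rewrite /davg; congr (_ * _); case: m => [|m]; first by rewrite !big_ord0.
rewrite big_ord_recr big_ord_recl /= [RHS]addrC; congr (_ + _).
  apply: eq_bigr => j _; congr f.
  by rewrite /= /bump /= add1n -[in RHS]natr1 mulrDl mul1r.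
by rewrite divff ?pnatr_eq0// addrC fper mul1r.
Qed.

Lemma sin_pi_frac_neq0 (m : nat) i : i != 0 -> (`|i| < m)%N ->
  sin (pi * i%:~R / m%:R) != 0 :> R.
Proof.
have key (n : nat) : (0 < n < m)%N -> sin (pi * n%:R / m%:R) != 0 :> R.
  move=> /andP[n0 nm]; rewrite gt_eqF// sin_gt0_pi//.
  have m0 : 0 < m%:R :> R by rewrite ltr0n (leq_trans _ nm).
  have n0' : 0 < n%:R :> R by rewrite ltr0n.
  rewrite divr_gt0 ?mulr_gt0 ?pi_gt0//=.
  by rewrite ltr_pdivrMr// ltr_pM2l ?pi_gt0// ltr_nat.
move=> i0 im; case: (intP i) i0 im => [|k _ km|k _ km]; first by rewrite eqxx.
  by rewrite -pmulrn; exact: key.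
rewrite mulrNz -pmulrn.
by rewrite mulrN mulNr sinN oppr_eq0; apply: key; lia.
Qed.

(** By [davg_shift] the pair of averages (C, S) is fixed by the rotation of angle x = 2 pi i / m.
    Since 0 < |i| < m this is not a full turn, so the only fixed vector is 0. *)
Lemma davg_cosf_sinf (m : nat) i : i != 0 -> (`|i| < m)%N ->
  davg m (cosf i) = 0 /\ davg m (sinf i) = 0.
Proof.
move=> i0 im; set C := davg m (cosf i); set S := davg m (sinf i).
have m0 : (0 < m)%N by lia.
pose x : R := 2 * pi * i%:~R * m%:R^-1.
have lin (a b : R) : davg m (fun t => a * cosf i t + b * sinf i t) = a * C + b * S.
  rewrite /C /S /davg !(mulrCA _ m%:R^-1) -mulrDr !mulr_sumr -big_split /=.
  by rewrite mulr_sumr.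
have hC : C = cos x * C + (- sin x) * S.
  rewrite -lin /C -davg_shift; last by move=> t; exact: (cosf_sinf_add2pi i t).1.
  congr davg; apply/funext => t; rewrite /cosf /sinf mulrDr cosD -/x.
  by rewrite mulrC mulNr [sin x * _]mulrC.
have hS : S = sin x * C + cos x * S.
  rewrite -lin /S -davg_shift; last by move=> t; exact: (cosf_sinf_add2pi i t).2.
  congr davg; apply/funext => t; rewrite /cosf /sinf mulrDr sinD -/x.
  by rewrite mulrC [cos _ * sin x]mulrC addrC.
have cx : cos x != 1.
  have -> : x = (pi * i%:~R / m%:R) *+ 2 by rewrite mulr2n /x; move: pi => p; ring.
  rewrite cos_mulr2n.
  apply: contraNneq (sin_pi_frac_neq0 i0 im) => h.
  rewrite -sqrf_eq0 sin2cos2; apply/eqP.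
  by move: h; rewrite mulr2n; lra.
(* The determinant of the identity minus the rotation of angle x. *)
have key : ((1 - cos x) ^+ 2 + sin x ^+ 2) != 0.
  by rewrite gt_eqF// ltr_wpDr ?sqr_ge0// exprn_even_gt0//= subr_eq0 eq_sym.
have e1 : (1 - cos x) * C = - (sin x * S) by rewrite mulrBl mul1r {1}hC; ring.
have e2 : (1 - cos x) * S = sin x * C by rewrite mulrBl mul1r {1}hS; ring.
have C0 : ((1 - cos x) ^+ 2 + sin x ^+ 2) * C = 0.
  rewrite mulrDl !expr2 -!mulrA -e2 e1; ring.
have S0 : ((1 - cos x) ^+ 2 + sin x ^+ 2) * S = 0.
  rewrite mulrDl; have -> : sin x ^+ 2 * S = - (sin x * ((1 - cos x) * C)) by rewrite e1; ring.
  by rewrite expr2 -!mulrA e2; ring.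
by split; apply/eqP; [move/eqP: C0|move/eqP: S0]; rewrite mulf_eq0 (negbTE key).
Qed.

Lemma davg_trig_basis (m k l : nat) : (0 < k)%N -> (0 < l)%N ->
  (k./2 + l./2 < m)%N ->
  davg m (fun t => trig_basis k t * trig_basis l t) = (k == l)%:R :> R.
Proof.
move=> k0 l0 klm; have m0 : (0 < m)%N by lia.
apply: (@orthonormal_trig_basis _ _ (fun=> True) m) => //.
- exact: sum_linear_davg.
- move=> i im; have [->|i0] := eqVneq i 0; last by have [] := davg_cosf_sinf i0 im.
  rewrite /davg; under eq_bigr do rewrite cosf0.
  by rewrite sumr_const card_ord mulVf// pnatr_eq0 -lt0n.
- move=> i im; have [->|i0] := eqVneq i 0; last by have [] := davg_cosf_sinf i0 im.
  rewrite /davg; under eq_bigr do rewrite sinf0.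
  by rewrite big1 ?mulr0.
Qed.

End trig_functionals.

Section parseval.
Context {R : realType}.
Variables (L : (R -> R) -> R) (Q : (R -> R) -> Prop) (s : seq nat).
Variable (F : nat -> R -> R).
Hypothesis Lsum : sum_linear L Q.
Hypothesis us : uniq s.
Hypothesis QF : forall k l, Q (fun t => F k t * F l t).
Hypothesis Q_sum : forall (a : nat -> R) k,
  Q (fun t => F k t * \sum_(l <- s) a l * F l t).
Hypothesis LF : forall k l, k \in s -> l \in s ->
  L (fun t => F k t * F l t) = (k == l)%:R.

Lemma orthonormal_coef (a : nat -> R) k : k \in s ->
  L (fun t => F k t * \sum_(l <- s) a l * F l t) = a k.
Proof.
move=> ks.
have -> : (fun t => F k t * \sum_(l <- s) a l * F l t) =
  (fun t => \sum_(l <- s) a l * (F k t * F l t)).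
  by apply/funext => t; rewrite mulr_sumr; apply: eq_bigr => l _; rewrite mulrCA.
rewrite (Lsum s a (QF k)) (bigD1_seq k)//= LF// eqxx mulr1 big1_seq ?addr0// => l.
by move=> /andP[lk ls]; rewrite LF// eq_sym (negbTE lk) mulr0.
Qed.

Lemma parseval (a b : nat -> R) :
  L (fun t => (\sum_(k <- s) a k * F k t) * \sum_(k <- s) b k * F k t) =
  \sum_(k <- s) a k * b k.
Proof.
have -> : (fun t => (\sum_(k <- s) a k * F k t) * \sum_(k <- s) b k * F k t) =
  (fun t => \sum_(k <- s) a k * (F k t * \sum_(l <- s) b l * F l t)).
  by apply/funext => t; rewrite mulr_suml; apply: eq_bigr => k _; rewrite mulrA.
rewrite (Lsum s a (Q_sum b)); apply: eq_big_seq => k ks.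
by rewrite orthonormal_coef.
Qed.

End parseval.

(** * Trigonometric polynomials and their derivatives *)

Section trig_polynomial.
Context {R : realType}.
Implicit Types (k l M : nat) (a b c : nat -> R).

Definition trig_poly M c (t : R) : R := \sum_(1 <= k < M.+1) c k * trig_basis k t.

(* phi_k' is a multiple of phi_(trig_partner k): sines and cosines of the same
   frequency have consecutive indices. *)
Definition trig_partner k : nat := if odd k then k.-1 else k.+1.

(** At k = 1 the half is 0, so the constant function gets derivative 0 even though its partner
    index, 0, lies outside the basis. *)
Definition trig_dcoef k : R :=
  if odd k then 2 * pi * (k./2)%:R else - (2 * pi * (k./2)%:R).

Definition trig_poly_deriv M c (t : R) : R :=
  \sum_(1 <= k < M.+1) (c k * trig_dcoef k) * trig_basis (trig_partner k) t.

Lemma trig_basis_derive k (t : R) : (0 < k)%N ->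
  derive_at01 (trig_basis k) t (trig_dcoef k * trig_basis (trig_partner k) t).
Proof.
move=> k0; rewrite /trig_dcoef /trig_partner; have [ok|ek] := boolP (odd k).
  have [->|k1] := eqVneq k 1%N.
    rewrite /= mulr0 mul0r => e e0; exists 1 => // s _ _.
    by rewrite subrr mul0r subr0 normr0 mulr_ge0// ltW.
  have -> : trig_basis k = (fun t => Num.sqrt 2 * sinf (k./2) t) :> (R -> R).
    by apply/funext => s; rewrite trig_basis_odd.
  have -> : 2 * pi * (k./2)%:R * trig_basis k.-1 t =
      Num.sqrt 2 * (2 * pi * (k./2)%:Z%:~R * cosf (k./2) t) :> R.
    rewrite trig_basis_even; last by rewrite -oddS prednK.
    have -> : (k.-1)./2 = k./2 by lia.
    by rewrite -pmulrn mulrCA.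
  exact: derive_at01Z (sinf_derive _ _).
have -> : trig_basis k = (fun t => Num.sqrt 2 * cosf (k./2) t) :> (R -> R).
  by apply/funext => s; rewrite trig_basis_even.
have -> : - (2 * pi * (k./2)%:R) * trig_basis k.+1 t =
    Num.sqrt 2 * (- (2 * pi * (k./2)%:Z%:~R * sinf (k./2) t)) :> R.
  rewrite trig_basis_odd//; last by lia.
  have -> : (k.+1)./2 = k./2 by lia.
  by rewrite -pmulrn mulNr mulrN mulrCA.
exact: derive_at01Z (cosf_derive _ _).
Qed.

Lemma sob1_ext (f f' g g' : R -> R) :
  (forall t, 0 <= t <= 1 -> f t = g t) -> (forall t, 0 <= t <= 1 -> f' t = g' t) ->
  sob1 f f' -> sob1 g g'.
Proof.
move=> fg fg' [acf [Z Z0 fZ] sf]; split.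
- exact: eq_ac01 acf.
- exists Z => // t t01 nZ e e0; have [d d0 hd] := fZ t t01 nZ e e0.
  by exists d => // s s01 sd; rewrite -!fg// -fg'//; exact: hd.
- exact: sqint_ext sf.
Qed.

Lemma sob1_cst (x : R) : sob1 (fun=> x) (fun=> 0).
Proof.
apply: derive_at01_sob1.
- move=> t _ e e0; exists 1 => // s _ _.
  by rewrite subrr mul0r subr0 normr0 mulr_ge0// ltW.
- by exists 0 => t _; rewrite normr0.
- exact: measurable_cst.
Qed.

Lemma sob1Z (x : R) (f f' : R -> R) : sob1 f f' ->
  sob1 (fun t => x * f t) (fun t => x * f' t).
Proof.
move=> /(sob1M (sob1_cst x)); apply: sob1_ext => // t _.
by rewrite mul0r add0r.
Qed.

Lemma sob1B (f f' g g' : R -> R) : sob1 f f' -> sob1 g g' ->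
  sob1 (fun t => f t - g t) (fun t => f' t - g' t).
Proof.
move=> sf /(sob1Z (-1)) /(sob1D sf); apply: sob1_ext => t _;
  by rewrite mulN1r.
Qed.

Lemma sob1_sum (s : seq nat) (F F' : nat -> R -> R) :
  (forall k, k \in s -> sob1 (F k) (F' k)) ->
  sob1 (fun t => \sum_(k <- s) F k t) (fun t => \sum_(k <- s) F' k t).
Proof.
elim: s => [|k s IH] sF.
  by apply: sob1_ext (sob1_cst 0) => t _; rewrite big_nil.
have skF : sob1 (F k) (F' k) by apply: sF; rewrite mem_head.
have {}IH : sob1 (fun t => \sum_(k <- s) F k t) (fun t => \sum_(k <- s) F' k t).
  by apply: IH => l ls; apply: sF; rewrite in_cons ls orbT.
by apply: sob1_ext (sob1D skF IH) => t _; rewrite big_cons.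
Qed.

Lemma sob1_trig_basis k : (0 < k)%N -> sob1 (trig_basis k)
  (fun t => trig_dcoef k * trig_basis (trig_partner k) t).
Proof.
move=> k0; apply: derive_at01_sob1.
- by move=> t _; exact: trig_basis_derive.
- exists (`|trig_dcoef k| * 2) => t _; rewrite normrM ler_wpM2l//.
  exact: trig_basis_bound.
- exact: (sqintZ _ (sqint_trig_basis _)).1.
Qed.

Lemma sob1_trig_poly M c : sob1 (trig_poly M c) (trig_poly_deriv M c).
Proof.
apply: sob1_ext (@sob1_sum (index_iota 1 M.+1) (fun k t => c k * trig_basis k t)
  (fun k t => c k * (trig_dcoef k * trig_basis (trig_partner k) t)) _) => //.
- by move=> t _; apply: eq_bigr => k _; rewrite mulrA.
- by move=> k; rewrite mem_index_iota => /andP[k0 _]; apply/sob1Z/sob1_trig_basis.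
Qed.

Lemma sqint_trig_poly M c : sqint (trig_poly M c).
Proof. exact: sob1_sqint (sob1_trig_poly M c). Qed.

Lemma sqint_trig_poly_deriv M c : sqint (trig_poly_deriv M c).
Proof. by have [] := sob1_trig_poly M c. Qed.

Lemma trig_polyD1 M c t : trig_poly M c (t + 1) = trig_poly M c t.
Proof.
apply: eq_big_nat => k /andP[k0 _]; by rewrite trig_basisD1.
Qed.

Lemma int01_trig_poly_parseval M a b :
  int01 (fun t => trig_poly M a t * trig_poly M b t) =
  \sum_(1 <= k < M.+1) a k * b k.
Proof.
apply: (@parseval _ _ integrable01 (index_iota 1 M.+1) (@trig_basis R)) => //.
- exact: sum_linear_int01.
- exact: iota_uniq.
- by move=> k l; apply: sqint_integrableM; exact: sqint_trig_basis.
- move=> c k; apply: sqint_integrableM; first exact: sqint_trig_basis.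
  exact: sqint_trig_poly.
- move=> k l; rewrite !mem_index_iota => /andP[k0 _] /andP[l0 _].
  exact: int01_trig_basis.
Qed.

Lemma int01_trig_poly_deriv M c :
  int01 (fun t => trig_poly_deriv M c t ^+ 2) =
  \sum_(1 <= k < M.+1) (2 * pi * (k./2)%:R) ^+ 2 * c k ^+ 2.
Proof.
(* Index 1 is removed: its coefficient vanishes and its partner is 0. On the remaining indices the
   partners are positive and distinct, so Parseval applies to them. *)
pose s := [seq k <- index_iota 1 M.+1 | k != 1%N].
pose d k := c k * trig_dcoef k.
have E : trig_poly_deriv M c = (fun t => \sum_(k <- s) d k * trig_basis (trig_partner k) t).
  apply/funext => t; rewrite /trig_poly_deriv big_filter [LHS]big_mkcond [RHS]big_mkcond /=.
  apply: eq_bigr => k _; case: eqVneq => // ->.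
  by rewrite /d /trig_dcoef /= mulr0 mulr0 mul0r.
have -> : (fun t => trig_poly_deriv M c t ^+ 2) = (fun t =>
  (\sum_(k <- s) d k * trig_basis (trig_partner k) t) *
  (\sum_(k <- s) d k * trig_basis (trig_partner k) t)).
  by rewrite E; apply/funext => t; rewrite expr2.
rewrite (@parseval _ _ integrable01 _ (fun k => @trig_basis R (trig_partner k))) => //.
- rewrite /s big_filter [LHS]big_mkcond /=; apply: eq_bigr => k _.
  case: eqVneq => [->|_] /=; first by rewrite mulr0 expr0n mul0r.
  rewrite /d -expr2 exprMn mulrC; congr (_ * _); rewrite /trig_dcoef.
  by case: ifP => // _; rewrite sqrrN.
- exact: sum_linear_int01.
- exact/filter_uniq/iota_uniq.
- by move=> k l; apply: sqint_integrableM; exact: sqint_trig_basis.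
- move=> e k; apply: sqint_integrableM; first exact: sqint_trig_basis.
  by apply: sqint_sum => l _; apply: sqintZ; exact: sqint_trig_basis.
- move=> k l; rewrite !mem_filter !mem_index_iota => /and3P[k1 k0 _] /and3P[l1 l0 _].
  rewrite int01_trig_basis; last 2 first.
  + by rewrite /trig_partner; case: ifP => // ok; lia.
  + by rewrite /trig_partner; case: ifP => // ok; lia.
  congr (_%:R); congr nat_of_bool; rewrite /trig_partner.
  by apply/idP/idP => [|/eqP->//]; case: ifP; case: ifP; lia.
Qed.

Lemma davg_trig_poly_parseval (m M : nat) a b : (M./2 + M./2 < m)%N ->
  davg m (fun t => trig_poly M a t * trig_poly M b t) =
  \sum_(1 <= k < M.+1) a k * b k.
Proof.
move=> Mm; apply: (@parseval _ _ (fun=> True) (index_iota 1 M.+1) (@trig_basis R)) => //.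
- exact: sum_linear_davg.
- exact: iota_uniq.
- move=> k l; rewrite !mem_index_iota => /andP[k0 kM] /andP[l0 lM].
  by apply: davg_trig_basis => //; lia.
Qed.

Lemma davg_trig_coef (m M : nat) c k : (M./2 + M./2 < m)%N -> (0 < k <= M)%N ->
  davg m (fun t => trig_basis k t * trig_poly M c t) = c k.
Proof.
move=> Mm kM; apply: (@orthonormal_coef _ _ (fun=> True) (index_iota 1 M.+1) (@trig_basis R)) => //.
- exact: sum_linear_davg.
- exact: iota_uniq.
- move=> j l; rewrite !mem_index_iota => /andP[j0 jM] /andP[l0 lM].
  by apply: davg_trig_basis => //; lia.
- by rewrite mem_index_iota; lia.
Qed.

End trig_polynomial.

(** * Trigonometric interpolation *)

Section interpolation.
Context {R : realType}.

(** Write sin y = 2 sin(y/2) cos(y/2) and sin(y/2) = cos(c) y/2 by the mean value theorem. Both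
    angles are at most pi/4, so each squared cosine is at least 1/2 and the product of the cosines
    is at least 1/2. *)
Lemma half_le_sin (y : R) : 0 <= y <= pi / 2 -> y / 2 <= sin y.
Proof.
move=> /andP[y0 yp].
have [->|yn0] := eqVneq y 0; first by rewrite mul0r sin0.
have y0' : 0 < y by rewrite lt_neqAle eq_sym yn0.
have cos_bound (c : R) : 0 <= c <= y / 2 -> 2^-1 <= cos c ^+ 2 /\ 0 <= cos c.
  move=> /andP[c0 cy]; split; last by apply: cos_ge0_pihalf; move: (pi / 2) yp => q yp; lra.
  have : 0 <= cos (c *+ 2) by apply: cos_ge0_pihalf; rewrite mulr2n; move: (pi / 2) yp => q yp; lra.
  by rewrite cos_mulr2n mulr2n; lra.
have [c] := @MVT R sin cos 0 (y / 2) ltac:(lra)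
  (fun x _ => is_derive_sin x) (continuous_subspaceT (@continuous_sin R)).
rewrite in_itv /= sin0 !subr0 => /andP[c0 cy] hs.
have [c1 c2] : 2^-1 <= cos c ^+ 2 /\ 0 <= cos c by apply: cos_bound; lra.
have [s1 s2] : 2^-1 <= cos (y / 2) ^+ 2 /\ 0 <= cos (y / 2) by apply: cos_bound; lra.
have -> : sin y = cos (y / 2) * sin (y / 2) *+ 2.
  by rewrite -sin_mulr2n; congr sin; rewrite mulr2n; lra.
rewrite hs.
have : 2^-1 <= cos c * cos (y / 2).
  have p0 : 0 <= cos c * cos (y / 2) by rewrite mulr_ge0.
  have : 2^-1 * 2^-1 <= (cos c * cos (y / 2)) ^+ 2.
    by rewrite exprMn; apply: ler_pM; rewrite ?invr_ge0.
  move=> hp; rewrite leNgt; apply/negP => lt_p; move: hp; apply/negP.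
  by rewrite -ltNge -expr2 ltr_pXn2r// nnegrE invr_ge0.
move=> hp; have y2 : 0 <= y / 2 by rewrite divr_ge0.
have -> : cos (y / 2) * (cos c * (y / 2)) = cos c * cos (y / 2) * (y / 2) by ring.
by have := ler_wpM2r y2 hp; lra.
Qed.

(** The eigenvalue of the negative second difference of step [h] at frequency k./2, that is 4
    sin^2(pi (k./2) h). *)
Definition sdiff_coef (h : R) (k : nat) : R := 2 - 2 * cos (2 * pi * (k./2)%:R * h).

Lemma sdiff_trig_basis (k : nat) (h t : R) : (0 < k)%N ->
  2 * trig_basis k t - trig_basis k (t + h) - trig_basis k (t - h) =
  sdiff_coef h k * trig_basis k t :> R.
Proof.
move=> k0; rewrite /sdiff_coef; have [->|k1] := eqVneq k 1%N.
  by rewrite /= mulr0 mul0r cos0 !trig_basis1; ring.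
have [ok|ek] := boolP (odd k).
  rewrite !trig_basis_odd// /sinf -pmulrn; move: (2 * pi) => p.
  by rewrite !(mulrDr, mulrN) sinD sinB; ring.
rewrite !trig_basis_even// /cosf -pmulrn; move: (2 * pi) => p.
by rewrite !(mulrDr, mulrN) cosD cosB; ring.
Qed.

(** The eigenvalue is 4 sin^2 y, and k <= M keeps y in [0, pi/2], where [half_le_sin] gives 4 sin^2
    y >= y^2. *)
Lemma sdiff_coef_ge (N k : nat) : (k <= N.*2.+1)%N ->
  (pi * (k./2)%:R / (N.*2.+1)%:R) ^+ 2 <= sdiff_coef ((N.*2.+1)%:R^-1) k.
Proof.
move=> kN; set y := pi * (k./2)%:R / (N.*2.+1)%:R.
have M0 : 0 < (N.*2.+1)%:R :> R by rewrite ltr0n.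
have -> : sdiff_coef ((N.*2.+1)%:R^-1) k = 4 * sin y ^+ 2.
  rewrite /sdiff_coef.
  have -> : 2 * pi * (k./2)%:R * (N.*2.+1)%:R^-1 = y *+ 2 :> R.
    by rewrite mulr2n /y; move: pi => p; ring.
  by rewrite cos_mulr2n sin2cos2 mulr2n; ring.
have y0 : 0 <= y by rewrite /y !mulr_ge0 ?invr_ge0 ?pi_ge0// ltW.
have yp : y <= pi / 2.
  rewrite /y -mulrA ler_wpM2l ?pi_ge0// ler_pdivrMr// mulrC ler_pdivlMr//.
  by rewrite -natrM ler_nat; lia.
have := half_le_sin (introT andP (conj y0 yp)).
by set s := sin y; nra.
Qed.

(** Both sides are diagonal in the coefficients. Summation by parts, with periodicity, turns the
    squared increments into M times the average of T against its negative second difference, with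
    eigenvalues [sdiff_coef]. By [sdiff_coef_ge], 4 M^2 times the eigenvalue dominates the squared
    frequency (2 pi (k./2))^2. *)
Lemma trig_poly_energy_le (N : nat) (c : nat -> R) (T := trig_poly N.*2.+1 c) :
  int01 (fun t => trig_poly_deriv N.*2.+1 c t ^+ 2) <=
  4 * (N.*2.+1)%:R * \sum_(j < N.*2.+1)
    (T (j.+1%:R / (N.*2.+1)%:R) - T (j%:R / (N.*2.+1)%:R)) ^+ 2.
Proof.
set M := N.*2.+1; pose h : R := M%:R^-1.
have M0 : 0 < M%:R :> R by rewrite ltr0n.
have Tper t : T (t + 1) = T t by exact: trig_polyD1.
have lin1 f g : davg M (fun t => f t + g t) = davg M f + davg M g :> R.
  by rewrite /davg -mulrDr -big_split.
have linZ a f : davg M (fun t => a * f t) = a * davg M f :> R.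
  by rewrite /davg -mulr_sumr mulrCA.
have E : \sum_(j < M) (T (j.+1%:R / M%:R) - T (j%:R / M%:R)) ^+ 2 =
    M%:R * davg M (fun t => (T t - T (t - h)) ^+ 2).
  rewrite /davg mulrA divff ?gt_eqF// mul1r; apply: eq_bigr => j _.
  congr ((_ - T _) ^+ 2); rewrite /h -[in RHS]natr1; field.
  by rewrite gt_eqF.
have E1 : davg M (fun t => T (t - h) ^+ 2) = davg M (fun t => T t ^+ 2).
  rewrite -(davg_shift M (f := fun t => T (t - h) ^+ 2)).
    by congr davg; apply/funext => t; rewrite addrK.
  by move=> t; rewrite (addrAC t 1) Tper.
have E2 : davg M (fun t => T t * T (t - h)) = davg M (fun t => T t * T (t + h)).
  rewrite -(davg_shift M (f := fun t => T t * T (t - h))).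
    by congr davg; apply/funext => t; rewrite addrK mulrC.
  by move=> t; rewrite (addrAC t 1) !Tper.
have E3 : davg M (fun t => (T t - T (t - h)) ^+ 2) =
    davg M (fun t => T t * trig_poly M (fun k => c k * sdiff_coef h k) t).
  have -> : (fun t => (T t - T (t - h)) ^+ 2) =
     (fun t => (T t ^+ 2 + T (t - h) ^+ 2) + (-2) * (T t * T (t - h))).
    by apply/funext => t; ring.
  rewrite lin1 lin1 linZ E1.
  have -> : (fun t => T t * trig_poly M (fun k => c k * sdiff_coef h k) t) =
     (fun t => (T t ^+ 2 + T t ^+ 2) + ((-1) * (T t * T (t - h)) + (-1) * (T t * T (t + h)))).
    apply/funext => t.
    have -> : trig_poly M (fun k => c k * sdiff_coef h k) t =
        2 * T t - T (t + h) - T (t - h).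
      rewrite /T /trig_poly mulr_sumr -!sumrB; apply: eq_big_nat => k /andP[k0 _].
      by rewrite -mulrA -sdiff_trig_basis//; ring.
    by ring.
  by rewrite !lin1 !linZ -E2; ring.
rewrite E E3 davg_trig_poly_parseval; last by rewrite /M; lia.
rewrite int01_trig_poly_deriv -mulrA mulrA mulr_sumr mulr_sumr; apply: ler_sum_nat => k kM.
have kM' : (k <= M)%N by lia.
have := sdiff_coef_ge kM'; rewrite -/M -/h => hk.
have -> : (2 * pi * (k./2)%:R) ^+ 2 * c k ^+ 2 =
   4 * M%:R * M%:R * ((pi * (k./2)%:R / M%:R) ^+ 2 * c k ^+ 2).
  by move: pi => p; field; rewrite gt_eqF.
have -> : 4 * M%:R * (M%:R * (c k * (c k * sdiff_coef h k))) =
  4 * M%:R * M%:R * (sdiff_coef h k * c k ^+ 2) by ring.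
rewrite ler_wpM2l ?mulr_ge0 ?(ltW M0)// ler_wpM2r ?sqr_ge0//.
Qed.

(** Discrete orthonormality says A B = 1 for square matrices; then B A = 1, which says that the
    discrete coefficients reproduce the grid values. Since [M] is odd, k./2 + l./2 stays below M for
    all indices up to M. *)
Lemma trig_interpolation (M : nat) (G : R -> R) (i : 'I_M) : odd M ->
  trig_poly M (fun k => davg M (fun t => trig_basis k t * G t)) (i.+1%:R / M%:R) =
  G (i.+1%:R / M%:R).
Proof.
move=> oM.
pose A : 'M[R]_M := \matrix_(k, j) trig_basis k.+1 (j.+1%:R / M%:R).
pose B : 'M[R]_M := \matrix_(j, k) (M%:R^-1 * trig_basis k.+1 (j.+1%:R / M%:R)).
have AB : A *m B = 1%:M.
  apply/matrixP => k l; rewrite !mxE.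
  have := @davg_trig_basis R M k.+1 l.+1 isT isT.
  rewrite eqSS /davg => <-; last first.
    by have := ltn_ord k; have := ltn_ord l; lia.
  by rewrite mulr_sumr; apply: eq_bigr => j _; rewrite !mxE mulrCA.
have /matrixP BA := mulmx1C AB.
rewrite /trig_poly big_add1 /= big_mkord.
under eq_bigr do rewrite /davg mulr_sumr mulr_suml.
rewrite exchange_big /= (bigD1 i)//= [X in _ + X]big1 ?addr0.
  have := BA i i; rewrite !mxE eqxx mulr1n => hi.
  rewrite -[RHS]mulr1 -[X in _ = _ * X]hi mulr_sumr; apply: eq_bigr => k _.
  by rewrite !mxE; ring.
move=> j ji; have := BA j i; rewrite !mxE (negbTE ji) mulr0n => hi.
rewrite -[RHS](mulr0 (G (j.+1%:R / M%:R))) -[X in _ = _ * X]hi mulr_sumr; apply: eq_bigr => k _.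
by rewrite !mxE; ring.
Qed.

Lemma grid_bounds (M j : nat) : (j < M)%N ->
  [/\ 0 <= j%:R / M%:R :> R, j%:R / M%:R <= j.+1%:R / M%:R :> R,
      j.+1%:R / M%:R <= 1 :> R & j.+1%:R / M%:R - j%:R / M%:R = M%:R^-1 :> R].
Proof.
move=> jM; have M0 : 0 < M%:R :> R by rewrite ltr0n; lia.
split.
- by rewrite divr_ge0// ltW.
- by rewrite ler_pM2r ?invr_gt0// ler_nat.
- by rewrite ler_pdivrMr// mul1r ler_nat.
- by rewrite -mulrBl -natr1 addrC addKr mul1r.
Qed.

Lemma intab_sum (M : nat) (f : R -> R) (n : nat) : (0 < M)%N -> (n <= M)%N ->
  integrable01 f ->
  \sum_(j < n) intab (j%:R / M%:R) (j.+1%:R / M%:R) f = intab 0 (n%:R / M%:R) f.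
Proof.
move=> M0 + intf; elim: n => [|n IH] nM.
  by rewrite big_ord0 mul0r /intab set_itvoc0 Rintegral_set0.
have [h1 h2 h3 _] := grid_bounds nM.
by rewrite big_ord_recr /= IH 1?ltnW// -intab_split.
Qed.

Lemma int01_sum_intab (M : nat) (f : R -> R) : (0 < M)%N -> integrable01 f ->
  int01 f = \sum_(j < M) intab (j%:R / M%:R) (j.+1%:R / M%:R) f.
Proof.
move=> M0 intf; rewrite intab_sum// divff ?pnatr_eq0 -?lt0n//.
exact: int01_intab.
Qed.

(** On each cell, of length 1/M, the increment is the integral of [g], and Cauchy-Schwarz
    applies. *)
Lemma discrete_dirichlet_le (M : nat) (G g : R -> R) : (0 < M)%N -> sob1 G g ->
  \sum_(j < M) (G (j.+1%:R / M%:R) - G (j%:R / M%:R)) ^+ 2 <=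
  M%:R^-1 * int01 (fun t => g t ^+ 2).
Proof.
move=> M0 sG; have [_ _ sg] := sG; have ig := sg.2.
rewrite (int01_sum_intab M0)// mulr_sumr; apply: ler_sum => j _.
have [h1 h2 h3 h4] := grid_bounds (ltn_ord j).
by rewrite (sob1_FTC sG)// -[X in _ <= X * _]h4; apply: sqr_intab_le.
Qed.

(** [u] vanishes at the left end of every cell, so Cauchy-Schwarz bounds u^2 there by 1/M times the
    energy of [u'] on the cell. Integration over the cell gives the second factor 1/M. *)
Lemma poincare_grid (M : nat) (u u' : R -> R) : (0 < M)%N -> sob1 u u' ->
  (forall j, (j < M)%N -> u (j%:R / M%:R) = 0) ->
  int01 (fun t => u t ^+ 2) <= M%:R ^- 2 * int01 (fun t => u' t ^+ 2).
Proof.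
move=> M0 su uz; have [_ _ su'] := su; have iu' := su'.2.
have iu := (sob1_sqint su).2.
rewrite !(int01_sum_intab M0)// mulr_sumr; apply: ler_sum => j _.
have [a0 ab b1 ba] := grid_bounds (ltn_ord j).
set a : R := _ / _ in a0 ab b1 ba *; set b : R := _.+1%:R / _ in a0 ab b1 ba *.
have M0' : 0 <= (M%:R^-1 : R) by rewrite invr_ge0.
apply: (@le_trans _ _ (intab a b (fun=> M%:R^-1 * intab a b (fun t => u' t ^+ 2)))); last first.
  by rewrite intab_cst// ba mulrC mulrA -expr2 -exprVn.
apply: le_intab => //; first exact: integrable01_cst.
move=> t /andP[ta tb]; have at' := ltW ta; have t1 := le_trans tb b1.
have -> : u t = u t - u a by rewrite uz// subr0.
rewrite (sob1_FTC su)//; apply: (le_trans (sqr_intab_le _ _ _ _)) => //.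
apply: ler_pM.
- by rewrite subr_ge0.
- by apply: intab_ge0 => s _; rewrite sqr_ge0.
- by rewrite -ba lerD2r.
- rewrite (intab_split a0 at' tb b1)// lerDl.
  by apply: intab_ge0 => s _; rewrite sqr_ge0.
Qed.

Lemma trig_interpolation_error (N : nat) (G g : R -> R) (M := N.*2.+1) :
  sob1 G g -> G 0 = G 1 -> exists c : nat -> R,
  int01 (fun t => (G t - trig_poly M c t) ^+ 2) <=
  10 / M%:R ^+ 2 * int01 (fun t => g t ^+ 2).
Proof.
move=> sG Gper; pose c k := davg M (fun t => trig_basis k t * G t).
exists c; set T := trig_poly M c; pose T' := trig_poly_deriv M c.
have M0 : 0 < M%:R :> R by rewrite ltr0n.
have [_ _ sg] := sG; have sT' := sqint_trig_poly_deriv M c.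
(* The case j = 0, outside the interpolation grid, follows from periodicity of both functions. *)
have TG j : (j <= M)%N -> T (j%:R / M%:R) = G (j%:R / M%:R).
  case: j => [_|j jM].
    have -> : T (0 / M%:R) = T 1 by rewrite mul0r -(add0r 1) /T trig_polyD1.
    rewrite mul0r Gper.
    have := @trig_interpolation M G ord_max; rewrite /= divff ?gt_eqF//.
    by apply; rewrite /M /= odd_double.
  have := @trig_interpolation M G (Ordinal jM); apply.
  by rewrite /M /= odd_double.
have su := sob1B sG (sob1_trig_poly M c).
have := poincare_grid (isT : (0 < M)%N) su.
rewrite -/T => /(_ _)/le_trans; apply.
  by move=> j jM; rewrite TG ?subrr// ltnW.
have eT : int01 (fun t => T' t ^+ 2) <= 4 * int01 (fun t => g t ^+ 2).
  apply: (le_trans (trig_poly_energy_le N c)); rewrite -/M -/T.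
  have := discrete_dirichlet_le (isT : (0 < M)%N) sG.
  under eq_bigr => j _ do rewrite -!TG ?(ltnW (ltn_ord j))//.
  move=> h; rewrite -mulrA ler_pM2l//.
  by have := ler_wpM2l (ltW M0) h; rewrite mulrA divff ?gt_eqF// mul1r.
(* With the energy of T' at most 4 times that of g, this yields the constant 10 = 2 + 2 . 4. *)
have bnd : int01 (fun t => (g t - T' t) ^+ 2) <=
    2 * int01 (fun t => g t ^+ 2) + 2 * int01 (fun t => T' t ^+ 2).
  have i1 := sg.2; have i2 := sT'.2.
  rewrite -!int01Z// -int01D; [|exact: integrable01Z..].
  apply: le_int01.
  - exact: (sqintB sg sT').2.
  - by apply: integrable01D; exact: integrable01Z.
  - move=> t _; have := sqr_ge0 (g t + T' t); nra.
have -> : 10 / M%:R ^+ 2 * int01 (fun t => g t ^+ 2) =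
   M%:R ^- 2 * (10 * int01 (fun t => g t ^+ 2)) by ring.
by rewrite ler_wpM2l ?invr_ge0 ?sqr_ge0//; lra.
Qed.

End interpolation.

(** * Fourier residuals and discretization bias *)

Section trig_projection.
Context {R : realType}.
Implicit Types (f g u v : R -> R) (M N k : nat).

Definition fourier_coef f k : R := int01 (fun t => f t * trig_basis k t).

Definition trig_residual M f (t : R) : R := f t - trig_poly M (fourier_coef f) t.

Definition trig_orthogonal M u : Prop :=
  forall k, (0 < k <= M)%N -> int01 (fun t => u t * trig_basis k t) = 0.

Lemma sqint_trig_residual M f : sqint f -> sqint (trig_residual M f).
Proof. by move=> sf; apply: sqintB => //; exact: sqint_trig_poly. Qed.

Lemma trig_residual_orthogonal M f : sqint f ->
  trig_orthogonal M (trig_residual M f).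
Proof.
move=> sf k kM; rewrite /trig_residual.
have -> : (fun t => (f t - trig_poly M (fourier_coef f) t) * trig_basis k t) =
  (fun t => f t * trig_basis k t - trig_basis k t * trig_poly M (fourier_coef f) t).
  by apply/funext => t; ring.
have sk := @sqint_trig_basis R k; have sp := sqint_trig_poly M (fourier_coef f).
rewrite int01B; [|exact: sqint_integrableM..].
rewrite /trig_poly (@orthonormal_coef _ _ integrable01 (index_iota 1 M.+1) (@trig_basis R)).
- by rewrite subrr.
- exact: sum_linear_int01.
- exact: iota_uniq.
- by move=> j l; apply: sqint_integrableM; exact: sqint_trig_basis.
- move=> j l; rewrite !mem_index_iota => /andP[j0 jM] /andP[l0 lM].
  by apply: int01_trig_basis.
- by rewrite mem_index_iota; lia.
Qed.

(** The alternative c k = 0 serves index 1 of a derivative polynomial, whose partner 0 is not among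
    the orthogonality relations. *)
Lemma int01_orthogonal_sum u (s : seq nat) (c : nat -> R) (F : nat -> R -> R) :
  sqint u -> (forall k, sqint (F k)) ->
  (forall k, k \in s -> c k = 0 \/ int01 (fun t => u t * F k t) = 0) ->
  int01 (fun t => u t * \sum_(k <- s) c k * F k t) = 0.
Proof.
move=> su sF uF.
have -> : (fun t => u t * \sum_(k <- s) c k * F k t) =
  (fun t => \sum_(k <- s) c k * (u t * F k t)).
  by apply/funext => t; rewrite mulr_sumr; apply: eq_bigr => k _; rewrite mulrCA.
rewrite (@sum_linear_int01 R s c (fun k t => u t * F k t)); last first.
  by move=> k; exact: sqint_integrableM.
by rewrite big1_seq// => k /andP[_ /uF[->|->]]; rewrite ?mul0r ?mulr0.
Qed.

Lemma trig_orthogonal_poly M u (c : nat -> R) : sqint u -> trig_orthogonal M u ->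
  int01 (fun t => u t * trig_poly M c t) = 0.
Proof.
move=> su uo; apply: int01_orthogonal_sum => // [k|k]; first exact: sqint_trig_basis.
by rewrite mem_index_iota => kM; right; apply: uo; lia.
Qed.

(** For odd [M] the pairs (2, 3), ..., (M - 1, M) are complete, so differentiation maps the span of
    the first M basis functions into itself. *)
Lemma trig_partner_range M k : odd M -> (1 < k <= M)%N -> (0 < trig_partner k <= M)%N.
Proof. by rewrite /trig_partner; case: ifP; lia. Qed.

Lemma trig_orthogonal_poly_deriv M u (c : nat -> R) : odd M -> sqint u ->
  trig_orthogonal M u -> int01 (fun t => u t * trig_poly_deriv M c t) = 0.
Proof.
move=> oM su uo.
apply: (@int01_orthogonal_sum _ _ _ (fun k => @trig_basis R (trig_partner k))) => // [k|k].
  exact: sqint_trig_basis.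
rewrite mem_index_iota => kM; have [->|k1] := eqVneq k 1%N.
  by left; rewrite /trig_dcoef /= mulr0 mulr0.
by right; apply: uo; apply: trig_partner_range => //; lia.
Qed.

(** Pythagoras, with the square of [v] dropped. *)
Lemma int01_sqr_le_orthogonal u v : sqint u -> sqint v ->
  int01 (fun t => u t * v t) = 0 ->
  int01 (fun t => u t ^+ 2) <= int01 (fun t => (u t - v t) ^+ 2).
Proof.
move=> su sv uv.
have -> : (fun t => (u t - v t) ^+ 2) = (fun t => u t ^+ 2 + ((-2) * (u t * v t) + v t ^+ 2)).
  by apply/funext => t; ring.
have iuv := sqint_integrableM su sv.
rewrite int01D; last 2 first.
- exact: su.2.
- by apply: integrable01D; [exact: integrable01Z|exact: sv.2].
rewrite int01D; last 2 first.
- exact: integrable01Z.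
- exact: sv.2.
rewrite int01Z// uv mulr0 add0r lerDl; apply: int01_ge0 => t _; exact: sqr_ge0.
Qed.

(** Integration by parts: the boundary term of u phi_k vanishes by periodicity, and phi_k' is a
    multiple of the partner of phi_k, again orthogonal to [u], or is 0 when k = 1. *)
Lemma sob1_trig_orthogonal M u u' : odd M -> sob1 u u' -> u 0 = u 1 ->
  trig_orthogonal M u -> trig_orthogonal M u'.
Proof.
move=> oM su uper uo k kM; have k0 : (0 < k)%N by lia.
have := sob1_int01 (sob1M su (sob1_trig_basis k0)).
have pk : trig_basis k 1 = trig_basis k 0 :> R by rewrite -(add0r 1) trig_basisD1.
have [_ _ su'] := su; have squ := sob1_sqint su.
rewrite pk uper subrr.
have -> : (fun t => u' t * trig_basis k t + u t * (trig_dcoef k * trig_basis (trig_partner k) t)) =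
  (fun t => u' t * trig_basis k t + trig_dcoef k * (u t * trig_basis (trig_partner k) t)).
  by apply/funext => t; rewrite [u t * (_ * _)]mulrCA.
have sk := @sqint_trig_basis R.
rewrite int01D; last 2 first.
- exact: sqint_integrableM.
- by apply: integrable01Z; exact: sqint_integrableM.
rewrite int01Z; last exact: sqint_integrableM.
suff -> : trig_dcoef k * int01 (fun t => u t * trig_basis (trig_partner k) t) = 0.
  by rewrite addr0.
have [->|k1] := eqVneq k 1%N; first by rewrite /trig_dcoef /= mulr0 mul0r.
by rewrite uo ?mulr0//; apply: trig_partner_range => //; lia.
Qed.

(* r' differs from f' by a trigonometric polynomial and is orthogonal to all of
   them, so its norm is at most that of the residual of f'. *)
Lemma trig_residual_step N f f' (M := N.*2.+1) : sob1 f f' -> f 0 = f 1 ->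
  exists r' : R -> R, [/\ sob1 (trig_residual M f) r',
    int01 (fun t => r' t ^+ 2) <= int01 (fun t => trig_residual M f' t ^+ 2) &
    int01 (fun t => trig_residual M f t ^+ 2) <=
      10 / M%:R ^+ 2 * int01 (fun t => trig_residual M f' t ^+ 2)].
Proof.
move=> sf fper; have oM : odd M by rewrite /M /= odd_double.
have [_ _ sf'] := sf; have sqf := sob1_sqint sf.
set r := trig_residual M f; set c := fourier_coef f.
pose r' t := f' t - trig_poly_deriv M c t.
have sr : sob1 r r' by apply: sob1B => //; exact: sob1_trig_poly.
have [_ _ sr'] := sr; have sqr := sob1_sqint sr.
have rper : r 0 = r 1.
  by rewrite /r /trig_residual fper; congr (_ - _); rewrite -(add0r 1) trig_polyD1.
have ro : trig_orthogonal M r by exact: trig_residual_orthogonal.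
have r'o := sob1_trig_orthogonal oM sr rper ro.
have le1 : int01 (fun t => r' t ^+ 2) <= int01 (fun t => trig_residual M f' t ^+ 2).
  pose v t := trig_poly M (fourier_coef f') t - trig_poly_deriv M c t.
  have sp := sqint_trig_poly M (fourier_coef f').
  have sd := sqint_trig_poly_deriv M c.
  have sv : sqint v by exact: sqintB.
  have -> : trig_residual M f' = (fun t => r' t - v t).
    by apply/funext => t; rewrite /trig_residual /r' /v; ring.
  apply: int01_sqr_le_orthogonal => //.
  have -> : (fun t => r' t * v t) = (fun t => r' t * trig_poly M (fourier_coef f') t -
      r' t * trig_poly_deriv M c t).
    by apply/funext => t; rewrite mulrBr.
  rewrite int01B; [|exact: sqint_integrableM..].
  by rewrite trig_orthogonal_poly// trig_orthogonal_poly_deriv// subrr.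
exists r'; split => //.
(* [r] is orthogonal to its own interpolant, so its norm is at most the interpolation error, which
   the energy of r' controls. *)
have [d hd] := trig_interpolation_error N sr rper.
have h1 := int01_sqr_le_orthogonal sqr (sqint_trig_poly M d)
  (trig_orthogonal_poly d sqr ro).
apply: (le_trans h1); apply: (le_trans hd); exact: ler_wpM2l.
Qed.

(** The induction descends from the top derivative, where the bound is Bessel's inequality; each
    application of [trig_residual_step] gains the factor 10 / M^2. *)
Lemma trig_residual_le N alpha (D : nat -> R -> R) (L : R) (M := N.*2.+1) :
  (forall j, (j < alpha)%N -> sob1 (D j) (D j.+1)) ->
  (forall j, (j < alpha)%N -> D j 0 = D j 1) ->
  sqint (D alpha) -> int01 (fun t => D alpha t ^+ 2) <= L ^+ 2 ->
  forall j, (j <= alpha)%N ->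
  int01 (fun t => trig_residual M (D (alpha - j)%N) t ^+ 2) <=
    (10 / M%:R ^+ 2) ^+ j * L ^+ 2.
Proof.
move=> sD Dper sDa DL; elim=> [_|j IH ja].
  rewrite subn0 mul1r; apply: le_trans DL.
  have sr := sqint_trig_residual M sDa.
  (* The coefficients are negated so that D alpha is the residual minus a polynomial, the form
     expected by [int01_sqr_le_orthogonal]. *)
  have sp := sqint_trig_poly M (fun k => - fourier_coef (D alpha) k).
  have E : (fun t => D alpha t ^+ 2) = (fun t => (trig_residual M (D alpha) t -
      trig_poly M (fun k => - fourier_coef (D alpha) k) t) ^+ 2).
    apply/funext => t; congr (_ ^+ 2); rewrite /trig_residual /trig_poly.
    rewrite -addrA -opprD -big_split /= big1 ?subr0// => k _.
    by rewrite mulNr subrr.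
  rewrite [leRHS](_ : _ = int01 (fun t => (trig_residual M (D alpha) t -
      trig_poly M (fun k => - fourier_coef (D alpha) k) t) ^+ 2)); last by rewrite E.
  apply: int01_sqr_le_orthogonal => //.
  by apply: trig_orthogonal_poly => //; exact: trig_residual_orthogonal.
have {}IH := IH (ltnW ja).
have lt1 : (alpha - j.+1 < alpha)%N by lia.
have E : (alpha - j.+1).+1 = (alpha - j)%N by lia.
have [r' [_ _ h]] := trig_residual_step N (sD _ lt1) (Dper _ lt1).
apply: (le_trans h); rewrite E (exprS _ j) -[leRHS]mulrA; exact: ler_wpM2l.
Qed.

End trig_projection.

Section discretization_bias.
Context {R : realType}.
Implicit Types (f g u v : R -> R) (m M K k : nat).

(* The estimator applied to the values of [f] on the grid j/m. *)
Definition discrete_projection m K f : R -> R :=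
  trig_poly K (fun k => davg m (fun t => trig_basis k t * f t)).

Lemma davgD m f g : davg m (fun t => f t + g t) = davg m f + davg m g.
Proof. by rewrite /davg -mulrDr -big_split. Qed.

Lemma davgZ m (a : R) f : davg m (fun t => a * f t) = a * davg m f.
Proof. by rewrite /davg -mulr_sumr mulrCA. Qed.

Lemma davg_ge0 m f : (forall t, 0 <= f t) -> 0 <= davg m f.
Proof. by move=> f0; rewrite /davg mulr_ge0 ?invr_ge0// sumr_ge0. Qed.

(** Expand the nonnegative grid average of (u - T)^2, where T is the discrete projection; K < m
    makes the basis functions orthonormal on the grid. *)
Lemma davg_bessel m K u : (K < m)%N ->
  \sum_(1 <= k < K.+1) davg m (fun t => trig_basis k t * u t) ^+ 2 <=
  davg m (fun t => u t ^+ 2).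
Proof.
move=> Km; set c := fun k => davg m (fun t => trig_basis k t * u t).
pose T := trig_poly K c.
have KK : (K./2 + K./2 < m)%N by lia.
have TT : davg m (fun t => T t * T t) = \sum_(1 <= k < K.+1) c k ^+ 2.
  by rewrite davg_trig_poly_parseval//; apply: eq_bigr => k _; rewrite expr2.
have uT : davg m (fun t => u t * T t) = \sum_(1 <= k < K.+1) c k ^+ 2.
  have -> : (fun t => u t * T t) =
      (fun t => \sum_(1 <= k < K.+1) c k * (trig_basis k t * u t)).
    apply/funext => t; rewrite /T /trig_poly mulr_sumr; apply: eq_bigr => k _.
    by ring.
  rewrite (@sum_linear_davg R m (index_iota 1 K.+1) c (fun k t => trig_basis k t * u t))//.
have := @davg_ge0 m (fun t => (u t - T t) ^+ 2) (fun t => sqr_ge0 _).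
have -> : (fun t => (u t - T t) ^+ 2) =
   (fun t => u t ^+ 2 + ((-2) * (u t * T t) + T t * T t)).
  by apply/funext => t; ring.
by rewrite davgD davgD davgZ uT TT; lra.
Qed.

(** On the cell ]a, b], u(b)^2 <= 2 u(t)^2 + 2 (u(b) - u(t))^2, and the increment is bounded by
    Cauchy-Schwarz. Integrating over t replaces the grid value by an integral. *)
Lemma davg_sqr_le m u u' : (0 < m)%N -> sob1 u u' ->
  davg m (fun t => u t ^+ 2) <=
  2 * int01 (fun t => u t ^+ 2) + 2 * m%:R ^- 2 * int01 (fun t => u' t ^+ 2).
Proof.
move=> m0 su; have [_ _ su'] := su; have iu' := su'.2; have iu := (sob1_sqint su).2.
rewrite !(int01_sum_intab m0)// /davg !mulr_sumr -big_split /=.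
apply: ler_sum => j _; have [a0 ab b1 ba] := @grid_bounds R m j (ltn_ord j).
set a : R := _ / _ in a0 ab b1 ba *; set b : R := _.+1%:R / _ in a0 ab b1 ba *.
have h0 : 0 <= (m%:R^-1 : R) by rewrite invr_ge0.
set V := intab a b (fun t => u' t ^+ 2).
have V0 : 0 <= V by apply: intab_ge0 => t _; exact: sqr_ge0.
have -> : m%:R^-1 * u b ^+ 2 = intab a b (fun=> u b ^+ 2).
  by rewrite intab_cst// ba mulrC.
have -> : 2 * intab a b (fun t => u t ^+ 2) + 2 * m%:R ^- 2 * V =
    intab a b (fun t => 2 * u t ^+ 2 + 2 * m%:R^-1 * V).
  rewrite intabD//; [|exact: integrable01Z|exact: integrable01_cst].
  rewrite intabZ// intab_cst// ba.
  by rewrite -exprVn expr2; ring.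
apply: le_intab => //; first exact: integrable01_cst.
  by apply: integrable01D; [exact: integrable01Z|exact: integrable01_cst].
move=> t /andP[/ltW at' tb].
have t0 := le_trans a0 at'.
have d : (u b - u t) ^+ 2 <= m%:R^-1 * V.
  rewrite (sob1_FTC su)//; apply: (le_trans (sqr_intab_le _ _ _ _)) => //.
  apply: ler_pM.
  - by rewrite subr_ge0.
  - by apply: intab_ge0 => s _; exact: sqr_ge0.
  - by rewrite -ba lerD2l lerN2.
  - rewrite /V (intab_split a0 at' tb b1)// lerDr.
    by apply: intab_ge0 => s _; exact: sqr_ge0.
have := sqr_ge0 (u t - (u b - u t)).
by move: d; rewrite -mulrA; set w := _ * V; nra.
Qed.

Lemma discrete_projection_trig_poly m M K c : (M <= K)%N -> (K < m)%N ->
  discrete_projection m K (trig_poly M c) = trig_poly M c.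
Proof.
move=> MK Km; pose c' k := if (k <= M)%N then c k else 0.
have E : trig_poly M c = trig_poly K c'.
  apply/funext => t; rewrite /trig_poly (@big_cat_nat _ _ _ M.+1 1 K.+1)//=.
  rewrite [X in _ = _ + X]big1_seq ?addr0; last first.
    move=> k; rewrite mem_index_iota /c' => /andP[_ /andP[Mk _]].
    by rewrite leqNgt Mk mul0r.
  by apply: eq_big_nat => k /andP[_ kM]; rewrite /c' -ltnS kM.
rewrite E /discrete_projection; apply/funext => t; apply: eq_big_nat => k /andP[k0 kK].
by rewrite davg_trig_coef//; lia.
Qed.

Lemma discrete_projectionD m K f g t :
  discrete_projection m K (fun s => f s + g s) t =
  discrete_projection m K f t + discrete_projection m K g t.
Proof.
rewrite /discrete_projection /trig_poly -big_split /=; apply: eq_bigr => k _.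
rewrite -mulrDl -davgD; congr (davg _ _ * _); apply/funext => s.
by rewrite mulrDr.
Qed.

Lemma discrete_projection_sqr_le m K u : (K < m)%N ->
  int01 (fun t => discrete_projection m K u t ^+ 2) <= davg m (fun t => u t ^+ 2).
Proof.
move=> Km; apply: le_trans (davg_bessel u Km).
rewrite -[leLHS]/(int01 (fun t => discrete_projection m K u t * discrete_projection m K u t)).
rewrite int01_trig_poly_parseval le_eqVlt; apply/orP; left; apply/eqP.
by apply: eq_bigr => k _; rewrite expr2.
Qed.

Lemma eq_discrete_projection m K f g :
  (forall t, 0 <= t <= 1 -> f t = g t) ->
  discrete_projection m K f = discrete_projection m K g.
Proof.
move=> fg; apply/funext => t; apply: eq_bigr => k _; congr (_ * _).
rewrite /davg; congr (_ * _); apply: eq_bigr => j _; rewrite fg//.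
have [h1 h2 h3 _] := @grid_bounds R m j (ltn_ord j).
by rewrite h3 (le_trans h1 h2).
Qed.

Lemma sqr_subr_le (x y : R) : (x - y) ^+ 2 <= 2 * x ^+ 2 + 2 * y ^+ 2.
Proof. by have := sqr_ge0 (x + y); nra. Qed.

Lemma inv_sqr_nat_le M K : (0 < K)%N -> (0 < M)%N -> (K <= 2 * M)%N ->
  M%:R ^- 2 <= 4 / K%:R ^+ 2 :> R.
Proof.
move=> K0 M0 KM; have K0' : 0 < K%:R ^+ 2 :> R by rewrite exprn_gt0// ltr0n.
have M0' : 0 < M%:R ^+ 2 :> R by rewrite exprn_gt0// ltr0n.
rewrite ler_pdivlMr// mulrC ler_pdivrMr// -!natrX -natrM ler_nat.
have -> : (4 * M ^ 2 = (2 * M) ^ 2)%N by rewrite expnMn.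
by rewrite leq_exp2r.
Qed.

(** The discrete projection reproduces trigonometric polynomials of order at most K, so the bias of
    [f] is that of its Fourier residual r, whose size and derivative are controlled by
    [trig_residual_le]. *)
Lemma sobolev_bias m K alpha (L : R) f : (0 < alpha)%N -> (0 < K < m)%N ->
  periodic_sobolev alpha L f ->
  sqint f /\
  int01 (fun t => (discrete_projection m K f t - f t) ^+ 2) <=
    10 * 40 ^+ alpha * L ^+ 2 * K%:R ^- (2 * alpha).
Proof.
(* Here a is the bias, q and r are the squared norms of the projected residual and of the residual,
   and s is m^-2 times the energy of its derivative: a <= 6 r + 4 s, whence the constant 10. *)
have lin (a q r s z : R) : a <= 2 * q + 2 * r -> q <= 2 * r + 2 * s ->
  r <= z -> s <= z -> a <= 10 * z by lra.
move=> a0 /andP[K0 Km] /(periodic_sobolev_sob1 a0)[D [Df sD DL Dper]].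
have sqf : sqint f by apply: sqint_ext Df (sob1_sqint (sD _ a0)).
split => //.
have E : int01 (fun t => (discrete_projection m K f t - f t) ^+ 2) =
    int01 (fun t => (discrete_projection m K (D 0%N) t - D 0%N t) ^+ 2).
  apply: eq_int01 => t t01; rewrite Df//; congr ((_ - _) ^+ 2).
  by rewrite (eq_discrete_projection m K Df).
rewrite {}E.
have sDa : sqint (D alpha).
  have [_ _] := sD alpha.-1 ltac:(lia).
  by rewrite prednK.
(* M is the largest odd number up to K. From K <= 2 M comes 10 / M^2 <= 40 / K^2, the origin of the
   40. *)
pose N := (K.-1)./2; pose M := N.*2.+1.
have MK : (M <= K)%N by rewrite /M /N; lia.
have KM : (K <= 2 * M)%N by rewrite /M /N; lia.
have res := trig_residual_le N sD Dper sDa DL.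
have [r1 [sr r1le _]] := trig_residual_step N (sD _ a0) (Dper _ a0).
rewrite -/M in res sr r1le; set r := trig_residual M (D 0%N) in sr.
have rle := res alpha (leqnn _); rewrite subnn -/r in rle.
have r1le' := res alpha.-1 (leq_pred _).
have aE : (alpha - alpha.-1 = 1)%N by lia.
rewrite aE in r1le'; have {}r1le := le_trans r1le r1le'.
have sqr := sob1_sqint sr; have [_ _ sr1] := sr.
have Qr : forall t, discrete_projection m K (D 0%N) t - D 0%N t =
    discrete_projection m K r t - r t.
  move=> t; pose S := trig_poly M (fourier_coef (D 0%N)).
  have -> : D 0%N = (fun s => r s + S s).
    by apply/funext => s; rewrite /r /trig_residual subrK.
  rewrite discrete_projectionD -/S.
  have -> : discrete_projection m K S = S by exact: discrete_projection_trig_poly.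
  by ring.
rewrite (eq_int01 (g := fun t => (discrete_projection m K r t - r t) ^+ 2)); last first.
  by move=> t _; rewrite Qr.
have sQ : sqint (discrete_projection m K r) by exact: sqint_trig_poly.
have b1 : int01 (fun t => (discrete_projection m K r t - r t) ^+ 2) <=
   2 * int01 (fun t => discrete_projection m K r t ^+ 2) + 2 * int01 (fun t => r t ^+ 2).
  have i1 := sQ.2; have i2 := sqr.2.
  rewrite -!int01Z// -int01D; [|exact: integrable01Z..].
  apply: le_int01.
  - exact: (sqintB sQ sqr).2.
  - by apply: integrable01D; exact: integrable01Z.
  - by move=> t _; exact: sqr_subr_le.
have m0 : (0 < m)%N by lia.
have b2 := le_trans (discrete_projection_sqr_le r Km) (davg_sqr_le m0 sr).
have K0' : 0 < K%:R :> R by rewrite ltr0n.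
have q0 : 0 <= 40 / K%:R ^+ 2 :> R by rewrite divr_ge0 ?exprn_ge0.
have qM : 10 / M%:R ^+ 2 <= 40 / K%:R ^+ 2 :> R.
  have -> : 40 = 10 * 4 :> R by rewrite -natrM.
  by rewrite -[leRHS]mulrA ler_pM2l//; exact: inv_sqr_nat_le.
have qM0 : 0 <= 10 / M%:R ^+ 2 :> R by rewrite divr_ge0 ?exprn_ge0.
set q := 40 / K%:R ^+ 2 in q0 qM.
have r_bound : int01 (fun t => r t ^+ 2) <= q ^+ alpha * L ^+ 2.
  apply: (le_trans rle); rewrite ler_wpM2r ?sqr_ge0// lerXn2r// nnegrE//.
(* The derivative of the residual has one factor q less than the residual; m^-2 <= q, a consequence
   of K < m, restores it. *)
have r1_bound : m%:R ^- 2 * int01 (fun t => r1 t ^+ 2) <= q ^+ alpha * L ^+ 2.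
  have mK : m%:R ^- 2 <= q.
    apply: (le_trans (inv_sqr_nat_le K0 m0 _)).
      by rewrite (leq_trans (ltnW Km))// leq_pmull.
    by rewrite /q ler_pM2r ?invr_gt0 ?exprn_gt0// ler_nat.
  rewrite -(prednK a0) (exprS q) -mulrA; apply: ler_pM => //.
  - by apply: int01_ge0 => t _; exact: sqr_ge0.
  - by apply: (le_trans r1le); rewrite ler_wpM2r ?sqr_ge0// lerXn2r// nnegrE.
have -> : 10 * 40 ^+ alpha * L ^+ 2 * K%:R ^- (2 * alpha) = 10 * (q ^+ alpha * L ^+ 2).
  by rewrite /q expr_div_n exprM -exprVn; ring.
by rewrite -(mulrA 2) in b2; exact: lin b1 b2 r_bound r1_bound.
Qed.

End discretization_bias.

(** * Pointwise bounds for Sobolev paths *)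

Section path_bounds.
Context {R : realType}.
Implicit Types (f g : R -> R).

Lemma sob1_osc f g : sob1 f g -> forall s t : R, 0 <= s <= 1 -> 0 <= t <= 1 ->
  (f t - f s) ^+ 2 <= int01 (fun t => g t ^+ 2).
Proof.
move=> sf s t; wlog st : s t / s <= t => [hw s01 t01|/andP[s0 _] /andP[_ t1]].
  have [st|/ltW ts] := leP s t; first exact: hw.
  by rewrite -opprB sqrrN; exact: hw.
have [_ _ sg] := sf; have ig := sg.2.
have t0 := le_trans s0 st; have s1 := le_trans st t1.
have nn (a b : R) : 0 <= intab a b (fun t => g t ^+ 2).
  by apply: intab_ge0 => ? _; exact: sqr_ge0.
rewrite (sob1_FTC sf)//; apply: (le_trans (sqr_intab_le s0 st t1 sg)).
apply: (@le_trans _ _ (intab s t (fun t => g t ^+ 2))).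
  by apply: ler_piMl => //; lra.
rewrite int01_intab// (intab_split (lexx 0) s0 s1 (lexx 1))//.
rewrite (intab_split s0 st t1 (lexx 1))//.
by have := nn 0 s; have := nn t 1; lra.
Qed.

Lemma sqr_le_norm (x L : R) : x ^+ 2 <= L ^+ 2 -> `|x| <= `|L|.
Proof.
move=> h; rewrite -(@ler_pXn2r _ 2)// ?nnegrE//.
by rewrite !real_normK ?num_real.
Qed.

(** The oscillation of [f] is at most |L|; averaging f t - f s over s, where [f] has mean 0, turns
    this into a bound on [f] itself. *)
Lemma mean_zero_sup_le (L : R) f g : sob1 f g -> int01 f = 0 ->
  int01 (fun t => g t ^+ 2) <= L ^+ 2 ->
  (forall t, 0 <= t <= 1 -> `|f t| <= `|L|) /\ int01 (fun t => f t ^+ 2) <= L ^+ 2.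
Proof.
move=> sf f0 gL; have sqf := sob1_sqint sf; have intf := sqint_integrable sqf.
have fL t : 0 <= t <= 1 -> `|f t| <= `|L|.
  move=> t01.
  have osc s : 0 <= s <= 1 -> `|f t - f s| <= `|L|.
    by move=> s01; apply: sqr_le_norm; apply: le_trans gL; exact: sob1_osc.
  rewrite ler_norml; apply/andP; split.
    have : int01 (fun s => f s - `|L|) <= int01 (fun=> f t).
      apply: le_int01; first by apply: integrable01B => //; exact: integrable01_cst.
        exact: integrable01_cst.
      by move=> s /osc; rewrite ler_norml => /andP[]; lra.
    rewrite int01B//; last exact: integrable01_cst.
    by rewrite !int01_cst f0; lra.
  have : int01 (fun=> f t) <= int01 (fun s => f s + `|L|).
    apply: le_int01; first exact: integrable01_cst.
      by apply: integrable01D => //; exact: integrable01_cst.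
    by move=> s /osc; rewrite ler_norml => /andP[]; lra.
  rewrite int01D//; last exact: integrable01_cst.
  by rewrite !int01_cst f0; lra.
split => //; rewrite -[leRHS]int01_cst; apply: le_int01.
- exact: sqf.2.
- exact: integrable01_cst.
- move=> t /fL; rewrite -(real_normK (num_real (f t))) -(real_normK (num_real L)) => h.
  by rewrite lerXn2r// nnegrE.
Qed.

(** By periodicity, every D j with 0 < j < alpha has mean 0, so the bound by L descends in mean
    square from D alpha to D 2 and then holds for D 1 uniformly. The Lipschitz estimate at 1 serves
    the mean of the random effects at the last grid point. *)
Lemma periodic_sobolev_path alpha (L : R) f : (1 < alpha)%N ->
  periodic_sobolev alpha L f -> [/\ sqint f,
    forall t, 0 <= t <= 1 -> f t ^+ 2 <= 2 * int01 (fun s => f s ^+ 2) + 2 * L ^+ 2 &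
    forall s, 0 <= s <= 1 -> `|f 1 - f s| <= `|L| * (1 - s)].
Proof.
move=> a1 /(periodic_sobolev_sob1 (ltnW a1))[D [Df sD DL Dper]].
have a0 := ltnW a1.
have sq0 := sob1_sqint (sD _ a0).
have sqf : sqint f by apply: sqint_ext Df sq0.
have mean0 j : (j.+1 < alpha)%N -> int01 (D j.+1) = 0.
  move=> ja; have ja' : (j < alpha)%N by lia.
  by rewrite (sob1_int01 (sD _ ja')) (Dper _ ja') subrr.
have down k : (k < alpha.-1)%N ->
    int01 (fun t => D (alpha - k)%N t ^+ 2) <= L ^+ 2.
  elim: k => [|k IH] ka; first by rewrite subn0.
  have ja : (alpha - k.+1 < alpha)%N by lia.
  have E : (alpha - k.+1).+1 = (alpha - k)%N by lia.
  have := sD _ ja; rewrite E => sj.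
  have m0 : int01 (D (alpha - k.+1)%N) = 0.
    have -> : (alpha - k.+1 = (alpha - k.+2).+1)%N by lia.
    by apply: mean0; lia.
  exact: (mean_zero_sup_le sj m0 (IH ltac:(lia))).2.
have D2 : int01 (fun t => D 2%N t ^+ 2) <= L ^+ 2.
  have := down (alpha - 2)%N ltac:(lia).
  by have -> : (alpha - (alpha - 2) = 2)%N by lia.
have [D1 D1sq] := mean_zero_sup_le (sD _ a1) (mean0 0%N a1) D2.
have osc s t : 0 <= s <= 1 -> 0 <= t <= 1 -> (f t - f s) ^+ 2 <= L ^+ 2.
  by move=> s01 t01; rewrite -!Df//; apply: le_trans D1sq; apply: sob1_osc (sD _ a0) _ _ _ _.
split => //.
(* Integrate f t ^ 2 <= 2 f s ^ 2 + 2 L ^ 2 over s. *)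
- move=> t t01; rewrite -[X in X <= _]int01_cst.
  have -> : 2 * int01 (fun s => f s ^+ 2) + 2 * L ^+ 2 =
      int01 (fun s => 2 * f s ^+ 2 + 2 * L ^+ 2).
    rewrite int01D; [|by apply: integrable01Z; exact: sqf.2|exact: integrable01_cst].
    by rewrite int01Z ?int01_cst//; exact: sqf.2.
  apply: le_int01; first exact: integrable01_cst.
    by apply: integrable01D; [apply: integrable01Z; exact: sqf.2|exact: integrable01_cst].
  move=> s s01; have := osc s t s01 t01; have := sqr_ge0 (f s - (f t - f s)); nra.
- move=> s s01; rewrite -!Df//; last by rewrite ler01 lexx.
  have [_ _ /sqint_integrable i1] := sD _ a0; move: (s01) => /andP[s0 s1].
  rewrite (sob1_FTC (sD _ a0))// -intab_cst//.
  have bd t : s < t <= 1 -> `|D 1%N t| <= `|L| by move=> ?; apply: D1; lra.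
  rewrite ler_norml -mulN1r -intabZ//; last exact: integrable01_cst.
  apply/andP; split; apply: le_intab => //.
  + exact/integrable01Z/integrable01_cst.
  + by move=> t /bd; rewrite ler_norml mulN1r => /andP[].
  + exact: integrable01_cst.
  + by move=> t /bd; rewrite ler_norml => /andP[].
Qed.

End path_bounds.

(** * Second moments *)

Section second_moments.
Context {d : measure_display} {T : measurableType d} {R : realType}.
Variable P : probability T R.
Implicit Types (X Y : T -> R).

Definition expect X : R := \int[P]_w X w.

Definition integrable_P X : Prop := P.-integrable setT (EFin \o X).

Definition sqintP X : Prop :=
  measurable_fun setT X /\ integrable_P (fun w => X w ^+ 2).

Lemma le_integrable_P X Y : measurable_fun setT X ->
  (forall w, `|X w| <= Y w) -> integrable_P Y -> integrable_P X.
Proof.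
move=> mX XY; apply: le_integrable => //; first exact/measurable_EFinP.
by move=> w _; rewrite lee_fin (le_trans (XY w))// ler_norm.
Qed.

Lemma eq_integrable_P X Y : (forall w, X w = Y w) -> integrable_P X -> integrable_P Y.
Proof. by move=> XY; apply: eq_integrable => // w _; rewrite /= XY. Qed.

Lemma integrable_PD X Y : integrable_P X -> integrable_P Y ->
  integrable_P (fun w => X w + Y w).
Proof.
move=> iX iY.
exact: (eq_integrable _ _ _ _ (integrableD measurableT iX iY)).
Qed.

Lemma integrable_PZ (a : R) X : integrable_P X -> integrable_P (fun w => a * X w).
Proof.
by move=> iX; exact: (eq_integrable _ _ _ _ (integrableZl measurableT a iX)).
Qed.

Lemma integrable_P_cst (a : R) : integrable_P (fun=> a).
Proof.
apply: measurable_bounded_integrable => //.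
  by rewrite [ltLHS]probability_setT ltry.
exists `|a|; split; first by rewrite num_real.
by move=> x ax w _ /=; exact: ltW.
Qed.

Lemma sqintP_integrableM X Y : sqintP X -> sqintP Y ->
  integrable_P (fun w => X w * Y w).
Proof.
move=> [mX iX] [mY iY]; apply: (le_integrable_P _ _ (integrable_PD iX iY)).
  exact: measurable_funM.
move=> w; rewrite normrM.
rewrite -(real_normK (num_real (X w))) -(real_normK (num_real (Y w))).
have := sqr_ge0 (`|X w| - `|Y w|).
have : 0 <= `|X w| * `|Y w| by rewrite mulr_ge0.
by nra.
Qed.

Lemma sqintP_ext X Y : (forall w, X w = Y w) -> sqintP X -> sqintP Y.
Proof. by move=> /funext ->. Qed.

Lemma sqintP_cst (a : R) : sqintP (fun=> a).
Proof. by split; [exact: measurable_cst|exact: integrable_P_cst]. Qed.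

Lemma sqintP_integrable X : sqintP X -> integrable_P X.
Proof.
move=> sX; apply: eq_integrable_P (sqintP_integrableM sX (sqintP_cst 1)) => w.
by rewrite mulr1.
Qed.

Lemma sqintPD X Y : sqintP X -> sqintP Y -> sqintP (fun w => X w + Y w).
Proof.
move=> sX sY; split; first by apply: measurable_funD; [exact: sX.1|exact: sY.1].
have h := integrable_PD sX.2 (integrable_PD sY.2 (integrable_PZ 2 (sqintP_integrableM sX sY))).
by apply: eq_integrable_P h => w; ring.
Qed.

Lemma sqintPZ (a : R) X : sqintP X -> sqintP (fun w => a * X w).
Proof.
move=> sX; split; first by apply: measurable_funM => //; exact: sX.1.
by apply: eq_integrable_P (integrable_PZ (a ^+ 2) sX.2) => w; rewrite exprMn.
Qed.

Lemma sqintP_sum (J : Type) (s : seq J) (F : J -> T -> R) :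
  (forall i, sqintP (F i)) -> sqintP (fun w => \sum_(i <- s) F i w).
Proof.
move=> sF; elim: s => [|i s IH].
  by apply: sqintP_ext (sqintP_cst 0) => w; rewrite big_nil.
by apply: sqintP_ext (sqintPD (sF i) IH) => w; rewrite big_cons.
Qed.

Lemma expectD X Y : integrable_P X -> integrable_P Y ->
  expect (fun w => X w + Y w) = expect X + expect Y.
Proof. by move=> iX iY; apply: RintegralD. Qed.

Lemma expectZ (a : R) X : integrable_P X ->
  expect (fun w => a * X w) = a * expect X.
Proof. by move=> iX; apply: RintegralZl. Qed.

Lemma expect_cst (a : R) : expect (fun=> a) = a.
Proof. by rewrite /expect Rintegral_cst//= probability_setT mulr1. Qed.

Lemma expect_ge0 X : (forall w, 0 <= X w) -> 0 <= expect X.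
Proof. by move=> X0; apply: Rintegral_ge0. Qed.

Lemma le_expect X Y : integrable_P X -> integrable_P Y ->
  (forall w, X w <= Y w) -> expect X <= expect Y.
Proof.
move=> iX iY XY; rewrite -subr_ge0 -mulN1r -expectZ// -expectD//; last exact: integrable_PZ.
by apply: expect_ge0 => w; rewrite mulN1r subr_ge0.
Qed.

Lemma expect_fin X : integrable_P X -> (\int[P]_w (X w)%:E)%E = (expect X)%:E.
Proof. by move=> iX; rewrite /expect /Rintegral fineK//; exact: integrable_fin_num. Qed.

Lemma integrable_P_sum (J : Type) (s : seq J) (F : J -> T -> R) :
  (forall i, integrable_P (F i)) -> integrable_P (fun w => \sum_(i <- s) F i w).
Proof.
move=> iF; elim: s => [|i s IH].
  by apply: eq_integrable_P (integrable_P_cst 0) => w; rewrite big_nil.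
by apply: eq_integrable_P (integrable_PD (iF i) IH) => w; rewrite big_cons.
Qed.

Lemma expect_sum (J : Type) (s : seq J) (F : J -> T -> R) :
  (forall i, integrable_P (F i)) ->
  expect (fun w => \sum_(i <- s) F i w) = \sum_(i <- s) expect (F i).
Proof.
move=> iF; elim: s => [|i s IH].
  by rewrite big_nil -[RHS](expect_cst 0); congr expect; apply/funext => w; rewrite big_nil.
rewrite big_cons -IH -expectD//; last exact: integrable_P_sum.
by congr expect; apply/funext => w; rewrite big_cons.
Qed.

Lemma expect_sqr_sum (J : finType) (a : J -> R) (Z : J -> T -> R) :
  (forall i, sqintP (Z i)) ->
  (forall i j, i != j -> expect (fun w => Z i w * Z j w) = 0) ->
  expect (fun w => (\sum_i a i * Z i w) ^+ 2) =
  \sum_i a i ^+ 2 * expect (fun w => Z i w ^+ 2).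
Proof.
move=> sZ Z0.
have -> : (fun w => (\sum_i a i * Z i w) ^+ 2) =
    (fun w => \sum_i \sum_j a i * a j * (Z i w * Z j w)).
  apply/funext => w; rewrite expr2 mulr_suml; apply: eq_bigr => i _.
  by rewrite mulr_sumr; apply: eq_bigr => j _; rewrite mulrACA.
have iZ i j : integrable_P (fun w => a i * a j * (Z i w * Z j w)).
  by apply: integrable_PZ; exact: sqintP_integrableM.
rewrite expect_sum; last by move=> i; exact: integrable_P_sum.
apply: eq_bigr => i _; rewrite expect_sum// (bigD1 i)//= big1 ?addr0.
  rewrite expectZ; last exact: sqintP_integrableM.
  by rewrite expr2.
move=> j ji; rewrite expectZ; last exact: sqintP_integrableM.
by rewrite Z0 ?mulr0// eq_sym.
Qed.

(* Under independence the joint law is the product of the laws, by uniqueness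
   of the product measure; then Fubini. *)
Lemma expect_mul_indep X Y : sqintP X -> sqintP Y ->
  (forall A B : set R, measurable A -> measurable B ->
     P (X @^-1` A `&` Y @^-1` B) = (P (X @^-1` A) * P (Y @^-1` B))%E) ->
  expect Y = 0 -> expect (fun w => X w * Y w) = 0.
Proof.
move=> sX sY XY Y0.
have iXY := sqintP_integrableM sX sY.
have mX := sX.1; have mY := sY.1.
pose X' : {RV P >-> R} := HB.pack X (isMeasurableFun.Build _ _ _ _ X mX).
pose Y' : {RV P >-> R} := HB.pack Y (isMeasurableFun.Build _ _ _ _ Y mY).
have mXY : measurable_fun setT (fun w => (X w, Y w)) by exact: measurable_fun_pair.
pose XYf : {RV P >-> (R * R)%type} := HB.pack (fun w => (X w, Y w))
  (isMeasurableFun.Build _ _ _ _ _ mXY).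
pose f (z : R * R) : \bar R := (z.1 * z.2)%:E.
have mf : measurable_fun setT f.
  by apply/measurable_EFinP; apply: measurable_funM; [exact: measurable_fst|exact: measurable_snd].
have joint : (\int[P]_w (X w * Y w)%:E)%E = (\int[distribution P XYf]_z f z)%E.
  by rewrite (@integral_distribution _ _ _ _ _ P XYf).
have law A : measurable A ->
    distribution P XYf A = (distribution P X' \x distribution P Y')%E A.
  move=> mA; apply/esym; exact: product_measure_unique.
have prodE (g : R * R -> \bar R) : (\int[distribution P XYf]_z g z)%E =
    (\int[distribution P X' \x distribution P Y']_z g z)%E.
  by apply: eq_measure_integral => A mA _; exact: law.
have ifp : (distribution P X' \x distribution P Y')%E.-integrable setT f.
  apply/integrableP; split => //; rewrite -prodE.
  rewrite ge0_integral_distribution//; last exact: measurableT_comp.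
  by have /integrableP[] := iXY.
rewrite /expect /Rintegral joint prodE -integral12_prod_meas1//.
rewrite integral0_eq// => x _; rewrite /fubini_F /f /=.
have iY := sqintP_integrable sY.
have -> : (\int[distribution P Y']_y (x * y)%:E = \int[P]_w (x * Y w)%:E)%E.
  rewrite (@integral_distribution _ _ _ _ _ P Y' (fun y => (x * y)%:E))//.
    by apply/measurable_EFinP; exact: measurable_funM.
  exact: (integrable_PZ x iY).
by rewrite expect_fin; [rewrite expectZ// Y0 mulr0|exact: integrable_PZ].
Qed.

End second_moments.

(** * Expectation bounds almost everywhere and without measurability *)

Section lower_integral.
Context {d : measure_display} {T : measurableType d} {R : realType}.

(* No measurability is needed: the integral of a nonnegative function is the
   supremum of the integrals of the simple functions below it. *)
Lemma le_integral_nonneg (mu : {measure set T -> \bar R}) (f g : T -> \bar R) :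
  (forall x, (0 <= f x)%E) -> (forall x, (f x <= g x)%E) ->
  (\int[mu]_x f x <= \int[mu]_x g x)%E.
Proof.
move=> f0 fg; have g0 x : (0 <= g x)%E by exact: le_trans (f0 x) (fg x).
rewrite !ge0_integralE// !patch_setT; apply: le_ereal_sup => _ [h hf <-].
by exists h => // x; exact: le_trans (hf x) (fg x).
Qed.

Variable P : probability T R.
Implicit Types (X Y : T -> R).

Lemma expect_ae_eq X Y : measurable_fun setT X -> measurable_fun setT Y ->
  {ae P, forall w, X w = Y w} -> expect P X = expect P Y.
Proof.
move=> mX mY XY; rewrite /expect /Rintegral; congr fine.
apply: ae_eq_integral => //; try exact/measurable_EFinP.
by apply: filterS XY => w -> .
Qed.

Lemma ae_le_expect X Y : integrable_P P X -> integrable_P P Y ->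
  {ae P, forall w, X w <= Y w} -> expect P X <= expect P Y.
Proof.
move=> iX iY XY.
have mX : measurable_fun setT X by apply/measurable_EFinP; exact: measurable_int iX.
have mY : measurable_fun setT Y by apply/measurable_EFinP; exact: measurable_int iY.
rewrite -subr_ge0 -mulN1r -expectZ// -expectD//; last exact: integrable_PZ.
(* The absolute value agrees with Y - X almost everywhere and is nonnegative at every point. *)
rewrite (@expect_ae_eq _ (fun w => `|Y w + -1 * X w|)).
- by apply: expect_ge0.
- by apply: measurable_funD => //; apply: measurable_funM.
- by apply: measurableT_comp => //; apply: measurable_funD => //; apply: measurable_funM.
- by apply: filterS XY => w h; rewrite mulN1r ger0_norm// subr_ge0.
Qed.

Lemma ae_norm_expect_le (c : R) X : integrable_P P X ->
  {ae P, forall w, `|X w| <= c} -> `|expect P X| <= c.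
Proof.
move=> iX Xc; rewrite ler_norml; apply/andP; split.
  rewrite -[X in X <= _](expect_cst P); apply: ae_le_expect => //.
    exact: integrable_P_cst.
  by apply: filterS Xc => w; rewrite ler_norml => /andP[].
rewrite -[X in _ <= X](expect_cst P); apply: ae_le_expect => //.
  exact: integrable_P_cst.
by apply: filterS Xc => w; rewrite ler_norml => /andP[].
Qed.

(** [F] will be the integral of a squared path, which need not be measurable, so the bound on X^2
    cannot be integrated directly. Solved for [F], it gives a measurable minorant [h] of [F]; the
    integral of [h] is at most V, and X^2 <= 2 h + 2 c almost everywhere. *)
Lemma second_moment_le (V c : R) (F : T -> \bar R) X : 0 <= c ->
  measurable_fun setT X -> (forall w, (0 <= F w)%E) ->
  (\int[P]_w F w <= V%:E)%E ->
  {ae P, forall w, ((X w ^+ 2)%:E <= 2%:E * F w + (2 * c)%:E)%E} ->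
  sqintP P X /\ expect P (fun w => X w ^+ 2) <= 2 * V + 2 * c.
Proof.
move=> c0 mX F0 FV [N [mN N0 XN]].
have mX2 : measurable_fun setT (fun w => X w ^+ 2) by exact: measurable_funX.
(* The indicator makes [h] vanish on the null set where the bound may fail, so that h <= F holds
   everywhere. *)
pose h w := \1_(~` N) w * (Num.max (X w ^+ 2 - 2 * c) 0 / 2) : R.
have h0 w : 0 <= h w by rewrite mulr_ge0// divr_ge0// le_max lexx orbT.
have mh : measurable_fun setT h.
  apply: measurable_funM; first exact: measurable_indic (measurableC mN).
  apply: measurable_funM => //; apply: measurable_maxr => //.
  by apply: measurable_funB.
have hF w : ((h w)%:E <= F w)%E.
  rewrite /h indicE; case: (boolP (w \in ~` N)) => wN; last by rewrite mul0r.
  rewrite mul1r; have XF : ((X w ^+ 2)%:E <= 2%:E * F w + (2 * c)%:E)%E.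
    by apply: contrapT => nX; move: wN; rewrite inE; apply; exact: XN.
  have := F0 w; move: XF; case: (F w) => [r|_ _|//]; last by rewrite leey.
  rewrite -EFinM -EFinD !lee_fin => XF r0.
  by rewrite ler_pdivrMr// ge_max; apply/andP; split; lra.
have hV : (\int[P]_w (h w)%:E <= V%:E)%E.
  by apply: le_trans FV; apply: le_integral_nonneg => // w; rewrite lee_fin.
have ih : integrable_P P h.
  apply/integrableP; split; first exact/measurable_EFinP.
  apply: le_lt_trans (ltry V); apply: le_trans hV.
  rewrite le_eqVlt; apply/orP; left; apply/eqP; apply: eq_integral => w _ /=.
  by rewrite ger0_norm.
have ib : integrable_P P (fun w => 2 * h w + 2 * c).
  by apply: integrable_PD; [exact: integrable_PZ|exact: integrable_P_cst].
pose X2 w := \1_(~` N) w * X w ^+ 2 : R.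
have mX2' : measurable_fun setT X2.
  by apply: measurable_funM => //; exact: measurable_indic (measurableC mN).
have X2b w : `|X2 w| <= 2 * h w + 2 * c.
  rewrite /X2 /h indicE; case: (w \in ~` N); last by rewrite !mul0r normr0; lra.
  rewrite !mul1r ger0_norm ?sqr_ge0//.
  have : X w ^+ 2 - 2 * c <= Num.max (X w ^+ 2 - 2 * c) 0 by rewrite le_max lexx.
  by lra.
have iX2' : integrable_P P X2 by exact: le_integrable_P X2b ib.
have aeX : {ae P, forall w, X w ^+ 2 = X2 w}.
  exists N; split => // w /= hw; apply: contrapT => wN.
  by apply: hw; rewrite /X2 indicE mem_set// mul1r.
have iX2 : integrable_P P (fun w => X w ^+ 2).
  apply/integrableP; split; first exact/measurable_EFinP.
  have /integrableP[_] := iX2'; congr (_ < _)%E; apply: ae_eq_integral => //.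
  - by apply: measurableT_comp => //; exact/measurable_EFinP.
  - by apply: measurableT_comp => //; exact/measurable_EFinP.
  - by apply: filterS aeX => w /= ->.
split => //.
rewrite (expect_ae_eq mX2 mX2' aeX).
apply: (@le_trans _ _ (expect P (fun w => 2 * h w + 2 * c))).
  by apply: le_expect => // w; apply: le_trans (X2b w); exact: ler_norm.
rewrite expectD; [|exact: integrable_PZ|exact: integrable_P_cst].
rewrite expectZ// expect_cst lerD2r ler_pM2l//.
by rewrite -lee_fin -expect_fin.
Qed.

End lower_integral.

(** * The least squares projection estimator *)

Section estimator_algebra.
Context {R : realType}.
Variables (n p m K : nat) (X : 'M[R]_(n, p)) (beta : R -> 'cV[R]_p).
Variables (t y z : 'I_n -> 'I_m -> R).
Hypothesis unitX : X^T *m X \in unitmx.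
Hypothesis design : forall i j, t i j = j.+1%:R / m%:R.
Hypothesis model : forall i j, y i j = (X *m beta (t i j)) i 0 + z i j.

(** The Moore-Penrose inverse of [X], not the projection X (X^T X)^-1 X^T that usually bears this
    name. *)
Definition hat_mx : 'M[R]_(p, n) := invmx (X^T *m X) *m X^T.

Definition noise_coef (u : 'I_n -> 'I_m -> R) k : 'cV[R]_n :=
  \col_i (m%:R^-1 * \sum_(j < m) u i j * trig_basis k (j.+1%:R / m%:R)).

Lemma hat_mxK : hat_mx *m X = 1%:M.
Proof. by rewrite /hat_mx -mulmxA mulVmx. Qed.

Lemma emp_coef_decomp k : emp_coef t y k =
  X *m (\col_l davg m (fun s => trig_basis k s * beta s l 0)) + noise_coef z k.
Proof.
apply/colP => i; rewrite !mxE.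
under eq_bigr => j _ do rewrite model mulrDl.
rewrite big_split /= mulrDr; congr (_ + _).
  under [RHS]eq_bigr do rewrite mxE /davg.
  under eq_bigr => j _ do rewrite mxE mulr_suml.
  rewrite exchange_big mulr_sumr /=; apply: eq_bigr => l _.
  rewrite !mulr_sumr; apply: eq_bigr => j _.
  by rewrite design; ring.
by congr (_ * _); apply: eq_bigr => j _; rewrite design.
Qed.

Lemma LD_estimator_error s l : (LD_estimator X t y K s - beta s) l 0 =
  (discrete_projection m K (fun s => beta s l 0) s - beta s l 0) +
  trig_poly K (fun k => (hat_mx *m noise_coef z k) l 0) s.
Proof.
rewrite !mxE /LD_estimator summxE addrAC; congr (_ - _).
rewrite /discrete_projection /trig_poly -big_split /=.
apply: eq_big_nat => k /andP[_ kK].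
rewrite mxE /LD_coef -ltnS kK emp_coef_decomp -/hat_mx mulmxDr mulmxA hat_mxK mul1mx.
by rewrite !mxE mulrC mulrDl.
Qed.

(** The squared Frobenius norm of H is the trace of H H^T, and H H^T = (X^T X)^-1 because H X =
    1. *)
Lemma trace_hat_mx : \sum_l \sum_i hat_mx l i ^+ 2 = \tr (invmx (X^T *m X)).
Proof.
have -> : \sum_l \sum_i hat_mx l i ^+ 2 = \tr (hat_mx *m hat_mx^T).
  apply: eq_bigr => l _; rewrite mxE; apply: eq_bigr => i _.
  by rewrite [_^T _ _]mxE expr2.
congr mxtrace; rewrite {2}/hat_mx trmx_mul trmxK mulmxA hat_mxK mul1mx.
by rewrite trmx_inv trmx_mul trmxK.
Qed.

Lemma LD_integrated_error_le (b : 'I_p -> R) :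
  (forall l, sqint (fun s => beta s l 0) /\
     int01 (fun s => (discrete_projection m K (fun s => beta s l 0) s - beta s l 0) ^+ 2)
       <= b l) ->
  (\int[@lebesgue_measure R]_(s in `[0%R, 1%R]%classic)
     (sqnorm2 (LD_estimator X t y K s - beta s))%:E <=
   (2 * \sum_l b l + 2 * \sum_(1 <= k < K.+1) \sum_l
      (hat_mx *m noise_coef z k) l 0 ^+ 2)%:E)%E.
Proof.
move=> hb.
pose B l s := discrete_projection m K (fun s => beta s l 0) s - beta s l 0.
pose N l s := trig_poly K (fun k => (hat_mx *m noise_coef z k) l 0) s.
have sB l : sqint (B l) by apply: sqintB; [exact: sqint_trig_poly|exact: (hb l).1].
have sN l : sqint (N l) by exact: sqint_trig_poly.
have E s : sqnorm2 (LD_estimator X t y K s - beta s) = \sum_l (B l s + N l s) ^+ 2.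
  by apply: eq_bigr => l _; rewrite LD_estimator_error.
under eq_integral do rewrite E.
have i1 l : integrable01 (fun s => (B l s + N l s) ^+ 2) by exact: (sqintD (sB l) (sN l)).2.
have i2 : integrable01 (fun s => \sum_l (B l s + N l s) ^+ 2) by exact: integrable01_sum.
rewrite int01_fin// lee_fin.
rewrite int01_sum// exchange_big /= !mulr_sumr -big_split /=.
apply: ler_sum => l _.
have iB := (sB l).2; have iN := (sN l).2.
apply: (@le_trans _ _ (int01 (fun s => 2 * B l s ^+ 2 + 2 * N l s ^+ 2))).
  apply: le_int01 => //; first by apply: integrable01D; exact: integrable01Z.
  by move=> s _; have := sqr_ge0 (B l s - N l s); nra.
rewrite int01D; [|exact: integrable01Z..].
rewrite !int01Z//; apply: lerD; first by rewrite ler_pM2l//; exact: (hb l).2.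
rewrite ler_pM2l//.
rewrite -[leLHS]/(int01 (fun s => N l s * N l s)) /N int01_trig_poly_parseval.
by rewrite le_eqVlt; apply/orP; left; apply/eqP; apply: eq_bigr => k _; rewrite expr2.
Qed.

End estimator_algebra.

(** * Expected energy of the noise coefficients *)

Section noise.
Context {d : measure_display} {T : measurableType d} {R : realType}.
Variable P : probability T R.
Variables (n p m K : nat) (H : 'M[R]_(p, n)) (Z : 'I_n -> 'I_m -> T -> R).
Hypothesis sZ : forall i j, sqintP P (Z i j).

Let N k i w := noise_coef (fun i j => Z i j w) k i 0.

Let NE k i : N k i = (fun w => \sum_(j < m)
  (m%:R^-1 * trig_basis k (j.+1%:R / m%:R)) * Z i j w).
Proof.
apply/funext => w; rewrite /N mxE mulr_sumr; apply: eq_bigr => j _; ring.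
Qed.

Let sN k i : sqintP P (N k i).
Proof. by rewrite NE; apply: sqintP_sum => j; exact: sqintPZ. Qed.

(** Coefficients of different individuals are uncorrelated, so the second moment of a coordinate of
    H N_k is a sum of H_li^2 E N_ki^2. Summing over k first leaves S times the squared Frobenius
    norm of H. *)
Lemma noise_energy_expect (S : R) :
  (forall i i' j j', i != i' -> expect P (fun w => Z i j w * Z i' j' w) = 0) ->
  (forall i, \sum_(1 <= k < K.+1) expect P (fun w => N k i w ^+ 2) <= S) ->
  integrable_P P (fun w => \sum_(1 <= k < K.+1) \sum_l
    (H *m noise_coef (fun i j => Z i j w) k) l 0 ^+ 2) /\
  expect P (fun w => \sum_(1 <= k < K.+1) \sum_l
    (H *m noise_coef (fun i j => Z i j w) k) l 0 ^+ 2) <=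
  S * \sum_l \sum_i H l i ^+ 2.
Proof.
move=> Z0 hS.
have N0 k i i' : i != i' -> expect P (fun w => N k i w * N k i' w) = 0.
  move=> ii'; have -> : (fun w => N k i w * N k i' w) = (fun w =>
      \sum_(j < m) \sum_(j' < m)
        ((m%:R^-1 * trig_basis k (j.+1%:R / m%:R)) *
         (m%:R^-1 * trig_basis k (j'.+1%:R / m%:R))) * (Z i j w * Z i' j' w)).
    rewrite !NE; apply/funext => w; rewrite mulr_suml; apply: eq_bigr => j _.
    by rewrite mulr_sumr; apply: eq_bigr => j' _; rewrite mulrACA.
  have iZ j j' : integrable_P P (fun w => Z i j w * Z i' j' w).
    exact: sqintP_integrableM.
  rewrite expect_sum => [|j]; last by apply: integrable_P_sum => j'; exact: integrable_PZ.
  rewrite big1// => j _; rewrite expect_sum => [|j']; last exact: integrable_PZ.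
  by rewrite big1// => j' _; rewrite expectZ// Z0// mulr0.
have E k l : (fun w => (H *m noise_coef (fun i j => Z i j w) k) l 0 ^+ 2) =
    (fun w => (\sum_i H l i * N k i w) ^+ 2).
  by apply/funext => w; rewrite mxE.
have iE k l : integrable_P P (fun w => (H *m noise_coef (fun i j => Z i j w) k) l 0 ^+ 2).
  rewrite E; have sS : sqintP P (fun w => \sum_i H l i * N k i w).
    by apply: sqintP_sum => i; exact: sqintPZ.
  exact: sS.2.
have iEk k : integrable_P P (fun w => \sum_l (H *m noise_coef (fun i j => Z i j w) k) l 0 ^+ 2).
  exact: integrable_P_sum.
split; first exact: integrable_P_sum.
rewrite expect_sum//.
have -> : \sum_(1 <= k < K.+1) expect P (fun w => \sum_l (H *m noise_coef (fun i j => Z i j w) k) l 0 ^+ 2) =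
   \sum_l \sum_i H l i ^+ 2 * \sum_(1 <= k < K.+1) expect P (fun w => N k i w ^+ 2).
  have Ek k : expect P (fun w => \sum_l (H *m noise_coef (fun i j => Z i j w) k) l 0 ^+ 2) =
      \sum_l \sum_i H l i ^+ 2 * expect P (fun w => N k i w ^+ 2).
    rewrite expect_sum//; apply: eq_bigr => l _; rewrite E.
    by rewrite expect_sqr_sum// => i i'; exact: N0.
  under eq_bigr do rewrite Ek.
  rewrite exchange_big /=; apply: eq_bigr => l _; rewrite exchange_big /=.
  by apply: eq_bigr => i _; rewrite mulr_sumr.
rewrite mulr_sumr; apply: ler_sum => l _; rewrite mulr_sumr; apply: ler_sum => i _.
by rewrite mulrC ler_wpM2r ?sqr_ge0.
Qed.

(** Values along one path may be fully correlated, so [davg_bessel] is applied path by path: the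
    energy of the first K coefficients is at most the grid average of the squared path, with
    expectation at most S. *)
Lemma noise_coef_sum_le (S : R) (u : 'I_n -> T -> R -> R) : (0 < m)%N -> (K < m)%N ->
  (forall i (j : 'I_m) w, Z i j w = u i w (j.+1%:R / m%:R)) ->
  (forall i j, expect P (fun w => Z i j w ^+ 2) <= S) ->
  forall i, \sum_(1 <= k < K.+1) expect P (fun w => N k i w ^+ 2) <= S.
Proof.
move=> m0 Km Zu ZS i.
rewrite -expect_sum; last by move=> k; exact: (sN k i).2.
have iZ j : integrable_P P (fun w => Z i j w ^+ 2) by exact: (sZ i j).2.
have isZ : integrable_P P (fun w => \sum_(j < m) Z i j w ^+ 2) by exact: integrable_P_sum.
apply: (@le_trans _ _ (expect P (fun w => m%:R^-1 * \sum_(j < m) Z i j w ^+ 2))).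
  apply: le_expect; first by apply: integrable_P_sum => k; exact: (sN k i).2.
    exact: integrable_PZ.
  move=> w; have := davg_bessel (u i w) Km.
  rewrite [leRHS]/davg; under [X in _ <= _ * X]eq_bigr do rewrite -Zu.
  apply: le_trans; rewrite le_eqVlt; apply/orP; left; apply/eqP.
  apply: eq_bigr => k _; congr (_ ^+ 2); rewrite /N mxE /davg; congr (_ * _).
  by apply: eq_bigr => j _; rewrite Zu mulrC.
rewrite expectZ// expect_sum// ler_pdivrMl ?ltr0n//.
apply: (@le_trans _ _ (\sum_(j < m) S)); first by apply: ler_sum => j _.
by rewrite sumr_const card_ord mulr_natl.
Qed.

(** Without correlation along the grid each coefficient averages out: its variance is at most 4 S /
    m, where 4 is the square of the bound 2 on the basis functions. *)
Lemma noise_coef_sum_le_uncorrelated (S : R) : (0 < m)%N ->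
  (forall i j j', j != j' -> expect P (fun w => Z i j w * Z i j' w) = 0) ->
  (forall i j, expect P (fun w => Z i j w ^+ 2) <= S) ->
  forall i, \sum_(1 <= k < K.+1) expect P (fun w => N k i w ^+ 2) <=
    4 * S * (K%:R / m%:R).
Proof.
move=> m0 Z0 ZS i.
have m0' : 0 < m%:R :> R by rewrite ltr0n.
apply: (@le_trans _ _ (\sum_(1 <= k < K.+1) 4 * S / m%:R)); last first.
  by rewrite sumr_const_nat subn1 /= -mulr_natr; rewrite le_eqVlt; apply/orP; left; apply/eqP; ring.
apply: ler_sum => k _; rewrite NE expect_sqr_sum//; last by move=> j j'; exact: Z0.
apply: (@le_trans _ _ (\sum_(j < m) m%:R^-1 ^+ 2 * 4 * S)).
  apply: ler_sum => j _; apply: ler_pM => //.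
  - exact: sqr_ge0.
  - by apply: expect_ge0 => w; exact: sqr_ge0.
  - rewrite exprMn ler_wpM2l ?sqr_ge0//.
    rewrite -(real_normK (num_real (trig_basis _ _))).
    have := trig_basis_bound k (j.+1%:R / m%:R : R).
    have := normr_ge0 (trig_basis k (j.+1%:R / m%:R : R)).
    by set v := `|_|; nra.
rewrite sumr_const card_ord -mulr_natl; rewrite le_eqVlt; apply/orP; left; apply/eqP; field.
by rewrite gt_eqF.
Qed.

End noise.

(** * Moments of the random effects and of the errors *)

Section model_moments.
Context {d : measure_display} {T : measurableType d} {R : realType}.
Variable P : probability T R.
Local Notation mu := (@lebesgue_measure R).

Lemma mutually_independent_pair (E : Type) (S : set (set E)) (I : finType)
    (X : I -> T -> E) (i j : I) (A B : set E) :
  mutually_independent P S X -> i != j -> S A -> S B ->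
  P (X i @^-1` A `&` X j @^-1` B) = (P (X i @^-1` A) * P (X j @^-1` B))%E.
Proof.
move=> ind ij SA SB.
have := ind [set i; j]%SET (fun k => if k == i then A else B).
rewrite big_setU1 ?inE//= big_set1 eqxx eq_sym (negbTE ij) => <-; last first.
  by move=> k; case: ifP.
congr (P _); apply/seteqP; split => w /=.
  move=> [Ai Bj] k /=; rewrite !inE => /orP[/eqP->|/eqP->]; first by rewrite eqxx.
  by rewrite eq_sym (negbTE ij).
move=> h; split; first by have := h i; rewrite /= !inE eqxx; apply.
by have := h j; rewrite /= !inE eqxx orbT eq_sym (negbTE ij); apply.
Qed.

Section random_effects.
Variables (n alpha : nat) (rad V : R) (xi : 'I_n -> T -> R -> R).
Hypothesis alpha_gt1 : (1 < alpha)%N.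
Hypothesis xi_meas : forall (i : 'I_n) (s : R), s \in `[0, 1] ->
  measurable_fun [set: T] (fun w => xi i w s).
Hypothesis xi_sobolev :
  {ae P, forall w, forall i, periodic_sobolev alpha rad (xi i w)}.
Hypothesis xi_ind : mutually_independent P (@path_sigma R) xi.
Hypothesis xi_mean : forall (i : 'I_n) (s : R), s \in `]0, 1[ ->
  ('E_P[fun w => xi i w s] = 0)%E.
Hypothesis xi_L2 : forall i : 'I_n,
  (\int[P]_w \int[mu]_(s in `[0%R, 1%R]%classic) ((xi i w s) ^+ 2)%:E <= V%:E)%E.

Lemma random_effect_sqint i s : 0 <= s <= 1 ->
  sqintP P (fun w => xi i w s) /\
  expect P (fun w => xi i w s ^+ 2) <= 2 * V + 2 * rad ^+ 2.
Proof.
move=> s01.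
apply: (second_moment_le _ _ _ (xi_L2 i)) => //.
- exact: sqr_ge0.
- by apply: xi_meas; rewrite in_itv.
- by move=> w; apply: integral_ge0 => t _; rewrite lee_fin sqr_ge0.
- apply: filterS xi_sobolev => w /(_ i)/(periodic_sobolev_path alpha_gt1)[sq bnd _].
  rewrite int01_fin; last exact: sq.2.
  by rewrite -EFinM -EFinD lee_fin; exact: bnd.
Qed.

(** Means are given inside ]0, 1[ only, whereas the grid contains 1. There xi(1) is compared with
    xi(1 - h), at almost sure distance at most |rad| h. *)
Lemma random_effect_mean i s : 0 < s <= 1 -> expect P (fun w => xi i w s) = 0.
Proof.
have inner t : 0 < t < 1 -> expect P (fun w => xi i w t) = 0.
  move=> t01; have := @xi_mean i t; rewrite in_itv /= t01 unlock => /(_ isT) h.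
  by rewrite /expect /Rintegral h.
have sq t (t01 : 0 <= t <= 1) := sqintP_integrable (random_effect_sqint i t01).1.
move=> /andP[s0]; rewrite le_eqVlt => /orP[/eqP ->|s1]; last by apply: inner; rewrite s0.
apply/eqP; rewrite -normr_le0; apply/ler_addgt0Pl => e e0; rewrite addr0.
have r1 : 0 < `|rad| + 1 by rewrite ltr_wpDl.
(* The bound 1/2 keeps 1 - h inside ]0, 1[, and the other makes |rad| h at most e. *)
pose h := Num.min 2^-1 (e / (`|rad| + 1)).
have h0 : 0 < h by rewrite lt_min invr_gt0 ltr0n divr_gt0.
have h1 : h <= 2^-1 by rewrite ge_min lexx.
have he : h <= e / (`|rad| + 1) by rewrite ge_min lexx orbT.
have i1 : integrable_P P (fun w => xi i w 1) by apply: sq; rewrite ler01 lexx.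
have ih : integrable_P P (fun w => xi i w (1 - h)) by apply: sq; lra.
have -> : expect P (fun w => xi i w 1) =
    expect P (fun w => xi i w 1 + (-1) * xi i w (1 - h)).
  rewrite expectD//; last exact: integrable_PZ.
  have h01 : 0 < 1 - h < 1 by lra.
  by rewrite expectZ// (inner _ h01) mulr0 addr0.
apply: ae_norm_expect_le.
  by apply: integrable_PD => //; exact: integrable_PZ.
apply: filterS xi_sobolev => w /(_ i)/(periodic_sobolev_path alpha_gt1)[_ _ bnd].
have /bnd : 0 <= 1 - h <= 1 by lra.
rewrite mulN1r => /le_trans; apply.
rewrite opprB addrC subrK.
have : h * (`|rad| + 1) <= e by rewrite -ler_pdivlMr.
by have := normr_ge0 rad; nra.
Qed.

Lemma random_effect_uncorrelated i i' s s' : i != i' -> 0 < s <= 1 -> 0 < s' <= 1 ->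
  expect P (fun w => xi i w s * xi i' w s') = 0.
Proof.
move=> ii' s01 s01'.
have t01 : 0 <= s <= 1 by lra.
have t01' : 0 <= s' <= 1 by lra.
apply: expect_mul_indep.
- exact: (random_effect_sqint i t01).1.
- exact: (random_effect_sqint i' t01').1.
- move=> A B mA mB.
  have pA : path_sigma [set f | A (f s)].
    by apply: sub_sigma_algebra; exists s; [rewrite in_itv|exists A].
  have pB : path_sigma [set f | B (f s')].
    by apply: sub_sigma_algebra; exists s'; [rewrite in_itv|exists B].
  exact: (mutually_independent_pair xi_ind ii' pA pB).
- exact: random_effect_mean.
Qed.

End random_effects.

Section errors.
Variables (n m : nat) (sigma2 : R) (eps : 'I_n -> 'I_m -> {RV P >-> R}).
Hypothesis eps_ind : mutually_independent P measurable
  (fun ij : 'I_n * 'I_m => eps ij.1 ij.2 : T -> R).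
Hypothesis eps_mean : forall i j, ('E_P[eps i j] = 0)%E.
Hypothesis eps_var : forall i j, 'V_P[eps i j] = sigma2%:E.

Lemma error_sqint i j : sqintP P (eps i j) /\
  expect P (fun w => eps i j w ^+ 2) = sigma2.
Proof.
have h : (\int[P]_w (eps i j w ^+ 2)%:E = sigma2%:E)%E.
  rewrite -(eps_var i j) /variance covariance.unlock eps_mean expectation.unlock.
  apply: eq_integral => w _ /=; congr EFin.
  by rewrite -[RHS]/((eps i j w - 0) * (eps i j w - 0)) subr0.
have me : measurable_fun setT (eps i j) by exact: measurable_funPT.
split; last by rewrite /expect /Rintegral h.
split => //; apply/integrableP; split.
  by apply/measurable_EFinP; exact: measurable_funX.
apply: le_lt_trans (ltry sigma2); rewrite -h le_eqVlt; apply/orP; left; apply/eqP.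
by apply: eq_integral => w _ /=; rewrite ger0_norm// sqr_ge0.
Qed.

Lemma error_uncorrelated i j i' j' : (i, j) != (i', j') ->
  expect P (fun w => eps i j w * eps i' j' w) = 0.
Proof.
move=> ij; apply: expect_mul_indep.
- exact: (error_sqint i j).1.
- exact: (error_sqint i' j').1.
- move=> A B mA mB; exact: (mutually_independent_pair eps_ind ij mA mB).
- have := eps_mean i' j'; rewrite expectation.unlock => h.
  by rewrite /expect /Rintegral h.
Qed.

End errors.

End model_moments.

(** * Nonasymptotic bound on the mean integrated squared error *)

Section mise_bound.
Context {d : measure_display} {T : measurableType d} {R : realType}.
Variable P : probability T R.

Lemma LD_MISE_le (n p m K alpha : nat) (rad V sigma2 : R) (X : 'M[R]_(n, p))
    (beta : R -> 'cV[R]_p) (t : 'I_n -> 'I_m -> R) (xi : 'I_n -> T -> R -> R)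
    (eps : 'I_n -> 'I_m -> {RV P >-> R}) (y : T -> 'I_n -> 'I_m -> R) :
  (forall w i j, y w i j = (X *m beta (t i j)) i 0 + xi i w (t i j) + eps i j w) ->
  X^T *m X \in unitmx ->
  mutually_independent P measurable
    (fun ij : 'I_n * 'I_m => eps ij.1 ij.2 : T -> R) ->
  (forall i j, ('E_P[eps i j] = 0)%E) ->
  (forall i j, 'V_P[eps i j] = sigma2%:E) ->
  (forall i j, t i j = (nat_of_ord j).+1%:R / m%:R) ->
  (1 < alpha)%N ->
  (forall k : 'I_p, periodic_sobolev alpha rad (fun s => beta s k 0)) ->
  (forall (i : 'I_n) (s : R), s \in `[0, 1] ->
     measurable_fun [set: T] (fun w => xi i w s)) ->
  {ae P, forall w, forall i, periodic_sobolev alpha rad (xi i w)} ->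
  mutually_independent P (@path_sigma R) xi ->
  (forall (i : 'I_n) (s : R), s \in `]0, 1[ ->
     ('E_P[fun w => xi i w s] = 0)%E) ->
  (forall i : 'I_n, (\int[P]_w \int[@lebesgue_measure R]_(s in `[0%R, 1%R]%classic)
     ((xi i w s) ^+ 2)%:E <= V%:E)%E) ->
  (0 < K < m)%N ->
  (MISE P (fun w => LD_estimator X t (y w) K) beta <=
   (2 * (p%:R * (10 * 40 ^+ alpha * rad ^+ 2 * K%:R ^- (2 * alpha))) +
    4 * (2 * V + 2 * rad ^+ 2 + 4 * sigma2 * (K%:R / m%:R)) *
      \tr (invmx (X^T *m X)))%:E)%E.
Proof.
move=> model unitX eps_ind eps_mean eps_var design a1 beta_sob xi_meas xi_sob
  xi_ind xi_mean xi_L2 Km.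
have /andP[K0 Km'] := Km; have m0 : (0 < m)%N by lia.
have m0' : 0 < m%:R :> R by rewrite ltr0n.
have grid (j : 'I_m) : 0 < (j.+1%:R / m%:R : R) <= 1.
  by rewrite divr_gt0//= ler_pdivrMr// mul1r ler_nat.
have grid01 (j : 'I_m) : 0 <= (j.+1%:R / m%:R : R) <= 1.
  by have /andP[/ltW -> ->] := grid j.
pose Z1 i (j : 'I_m) w := xi i w (j.+1%:R / m%:R).
pose Z2 i j w := eps i j w.
have sZ1 i j : sqintP P (Z1 i j).
  exact: (random_effect_sqint a1 xi_meas xi_sob xi_L2 i (grid01 j)).1.
have sZ2 i j : sqintP P (Z2 i j) by exact: (error_sqint eps_mean eps_var i j).1.
set H := hat_mx X; set b := 10 * 40 ^+ alpha * rad ^+ 2 * K%:R ^- (2 * alpha).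
pose En (Z : 'I_n -> 'I_m -> T -> R) w := \sum_(1 <= k < K.+1) \sum_l
  (H *m noise_coef (fun i j => Z i j w) k) l 0 ^+ 2.
have [i1 e1] : integrable_P P (En Z1) /\
    expect P (En Z1) <= (2 * V + 2 * rad ^+ 2) * \sum_l \sum_i H l i ^+ 2.
  apply: noise_energy_expect => //.
    move=> i i' j j' ii'.
    exact: (random_effect_uncorrelated a1 xi_meas xi_sob xi_ind xi_mean xi_L2).
  apply: (@noise_coef_sum_le _ _ _ P n m K Z1 sZ1 _ xi) => // i j.
  exact: (random_effect_sqint a1 xi_meas xi_sob xi_L2 i (grid01 j)).2.
have [i2 e2] : integrable_P P (En Z2) /\
    expect P (En Z2) <= (4 * sigma2 * (K%:R / m%:R)) * \sum_l \sum_i H l i ^+ 2.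
  apply: noise_energy_expect => //.
    move=> i i' j j' ii'; apply: (error_uncorrelated eps_ind eps_mean eps_var).
    by apply: contraNneq ii' => -[->].
  apply: noise_coef_sum_le_uncorrelated => //.
    move=> i j j' jj'; apply: (error_uncorrelated eps_ind eps_mean eps_var).
    by apply: contraNneq jj' => -[->].
  by move=> i j; rewrite (error_sqint eps_mean eps_var i j).2.
rewrite (trace_hat_mx unitX) in e1 e2; set tr := \tr _ in e1 e2 *.
(* The factor 4 is 2 . 2: one 2 separates bias from noise, the other separates random effects from
   errors. *)
pose Bd w := 2 * (p%:R * b) + 4 * (En Z1 w + En Z2 w).
have iBd : integrable_P P Bd.
  apply: integrable_PD; first exact: integrable_P_cst.
  by apply: integrable_PZ; exact: integrable_PD.
(* The bound is pointwise in the sample point. [Bd] is integrable, while the integrated error under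
   it only has to be nonnegative. *)
apply: (@le_trans _ _ (\int[P]_w (Bd w)%:E)%E).
  apply: le_integral_nonneg => w.
    by apply: integral_ge0 => s _; rewrite lee_fin sumr_ge0// => l _; exact: sqr_ge0.
  pose z i j := xi i w (t i j) + eps i j w.
  have model' i j : y w i j = (X *m beta (t i j)) i 0 + z i j.
    by rewrite model /z addrA.
  have a0 : (0 < alpha)%N by lia.
  have hb l := sobolev_bias a0 Km (beta_sob l).
  apply: (le_trans (LD_integrated_error_le (b := fun=> b) unitX design model' hb)).
  rewrite lee_fin /Bd sumr_const card_ord -[b *+ p]mulr_natl lerD2l.
  have -> : 4 * (En Z1 w + En Z2 w) = 2 * (2 * (En Z1 w + En Z2 w)) by ring.
  rewrite ler_pM2l// /En -big_split /= mulr_sumr; apply: ler_sum => k _.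
  rewrite -big_split /= mulr_sumr; apply: ler_sum => l _.
  have -> : noise_coef z k = noise_coef (fun i j => Z1 i j w) k +
      noise_coef (fun i j => Z2 i j w) k.
    apply/colP => i; rewrite !mxE -mulrDr -big_split /=; congr (_ * _).
    by apply: eq_bigr => j _; rewrite -mulrDl /z design.
  rewrite mulmxDr mxE; set u := (_ *m _) l 0; set v := (_ *m _) l 0.
  by have := sqr_ge0 (u - v); nra.
rewrite expect_fin// lee_fin /Bd expectD; last 2 first.
- exact: integrable_P_cst.
- by apply: integrable_PZ; exact: integrable_PD.
rewrite expect_cst expectZ; last exact: integrable_PD.
rewrite expectD// lerD2l -mulrA ler_pM2l// [leRHS]mulrDl.
exact: lerD.
Qed.

End mise_bound.

Theorem proposition4 (R : realType)
  (* dimensions, number of sampling times, truncation level *)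
  (p m K : nat -> nat)
  (d : nat -> measure_display) (T : forall n, measurableType (d n))
  (P : forall n, probability (T n) R)
  (X : forall n, 'M[R]_(n, p n))
  (beta : forall n, R -> 'cV[R]_(p n))
  (t : forall n, 'I_n -> 'I_(m n) -> R)
  (xi : forall n, 'I_n -> T n -> R -> R)
  (eps : forall n, 'I_n -> 'I_(m n) -> {RV (P n) >-> R})
  (y : forall n, T n -> 'I_n -> 'I_(m n) -> R)
  (sigma g : nat -> R)
  (alpha : nat) (rad : R)
  (* the model, with s_beta = p < n and X^T X invertible *)
  (model : \forall n \near \oo, forall w i j,
     y n w i j = (X n *m beta n (t n i j)) i 0 + xi n i w (t n i j)
                 + eps n i j w)
  (s_beta_p : \forall n \near \oo, num_nonzero_coords (beta n) = p n)
  (p_lt_n : \forall n \near \oo, (p n < n)%N)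
  (X_full_rank : \forall n \near \oo, (X n)^T *m X n \in unitmx)
  (* (i) *)
  (eps_iid : \forall n \near \oo,
     iid (P n) measurable
       (fun ij : 'I_n * 'I_(m n) => eps n ij.1 ij.2 : T n -> R))
  (eps_mean : \forall n \near \oo, forall i j, ('E_(P n)[eps n i j] = 0)%E)
  (eps_var : \forall n \near \oo, forall i j,
     'V_(P n)[eps n i j] = (sigma n ^+ 2)%:E)
  (sigma_bounded : bigO_seq (fun n => (sigma n ^+ 2)%:E) (fun=> 1))
  (* (ii) *)
  (design : \forall n \near \oo, forall i j,
     t n i j = (nat_of_ord j).+1%:R / (m n)%:R)
  (* (iii) *)
  (alpha_ge2 : (2 <= alpha)%N) (rad_gt0 : 0 < rad)
  (beta_sobolev : \forall n \near \oo, forall k : 'I_(p n),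
     periodic_sobolev alpha rad (fun s => beta n s k 0))
  (Xbeta_sobolev : exists C : R, \forall n \near \oo, forall i : 'I_n,
     periodic_sobolev alpha (C * `|g n|) (fun s => (X n *m beta n s) i 0))
  (Xbeta_L2 : bigO_seq
     (fun n => ereal_sup (range (fun i : 'I_n =>
        \int[@lebesgue_measure R]_(s in `[0%R, 1%R]%classic)
           (((X n *m beta n s) i 0) ^+ 2)%:E)%E)) g)
  (* (iv) *)
  (xi_meas : \forall n \near \oo, forall (i : 'I_n) (s : R), s \in `[0, 1] ->
     measurable_fun [set: T n] (fun w => xi n i w s))
  (xi_sobolev : \forall n \near \oo,
     {ae P n, forall w, forall i, periodic_sobolev alpha rad (xi n i w)})
  (xi_iid : \forall n \near \oo, iid (P n) (@path_sigma R) (xi n))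
  (xi_mean : \forall n \near \oo, forall (i : 'I_n) (s : R), s \in `]0, 1[ ->
     ('E_(P n)[fun w => xi n i w s] = 0)%E)
  (xi_L2 : exists V : R, \forall n \near \oo, forall i : 'I_n,
     (\int[P n]_w \int[@lebesgue_measure R]_(s in `[0%R, 1%R]%classic)
        ((xi n i w s) ^+ 2)%:E <= V%:E)%E)
  (K_range : \forall n \near \oo, (1 <= K n <= m n - 1)%N) :
  bigO_seq
    (fun n => MISE (P n)
       (fun w => LD_estimator (X n) (t n) (y n w) (K n)) (beta n))
    (fun n =>
       (num_nonzero_coords (beta n))%:R * (m n)%:R ^- (2 * alpha)
       + (1 + (K n)%:R / (m n)%:R) * \tr (invmx ((X n)^T *m X n))
       + (num_nonzero_coords (beta n))%:R * (K n)%:R ^- (2 * alpha)).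
Proof.
have [V hV] := xi_L2; have [S hS] := sigma_bounded.
(* The first summand is 2 . 10 . 40^alpha rad^2 from the bias, the second comes from the noise.
   Absolute values make both summands nonnegative whatever the signs of V and S. *)
exists (20 * 40 ^+ alpha * rad ^+ 2 + 4 * (2 * `|V| + 2 * rad ^+ 2 + 4 * `|S|)).
near=> n.
have Kr : (1 <= K n <= m n - 1)%N by near: n.
have Km : (0 < K n < m n)%N by lia.
have sp : num_nonzero_coords (beta n) = p n by near: n.
have Xu : (X n)^T *m X n \in unitmx by near: n.
have sS : sigma n ^+ 2 <= `|S|.
  have : (`|(sigma n ^+ 2)%:E| <= (S * `|1 : R|)%:E)%E by near: n.
  rewrite /= lee_fin normr1 mulr1 ger0_norm ?sqr_ge0// => /le_trans; apply.
  exact: ler_norm.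
have epsi : iid (P n) measurable
    (fun ij : 'I_n * 'I_(m n) => eps n ij.1 ij.2 : T n -> R) by near: n.
have xii : iid (P n) (@path_sigma R) (xi n) by near: n.
have M0 : (0 <= MISE (P n) (fun w => LD_estimator (X n) (t n) (y n w) (K n)) (beta n))%E.
  apply: integral_ge0 => w _; apply: integral_ge0 => s _.
  by rewrite lee_fin sumr_ge0// => l _; exact: sqr_ge0.
rewrite gee0_abs//.
apply: le_trans.
  apply: (@LD_MISE_le _ _ _ (P n) n (p n) (m n) (K n) alpha rad V (sigma n ^+ 2)
    (X n) (beta n) (t n) (xi n) (eps n) (y n)) => //; try by near: n.
  - by case: epsi.
  - by case: xii.
rewrite lee_fin sp.
set tr := \tr _; set kp : R := _ ^- _ in tr *.
have tr0 : 0 <= tr.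
  rewrite /tr -(trace_hat_mx Xu); apply: sumr_ge0 => l _; apply: sumr_ge0 => i _.
  exact: sqr_ge0.
set q : R := (K n)%:R / _; set A : R := (p n)%:R / _.
have kp0 : 0 <= kp by rewrite /kp invr_ge0 exprn_ge0.
have q0 : 0 <= q by rewrite /q divr_ge0.
have A0 : 0 <= A by rewrite /A divr_ge0 ?exprn_ge0 ?ler0n.
set B : R := (p n)%:R * kp; have B0 : 0 <= B by rewrite /B mulr_ge0.
set W := (1 + q) * tr; have W0 : 0 <= W by rewrite /W mulr_ge0 ?addr_ge0.
rewrite (@ger0_norm _ (A + W + B)) ?addr_ge0//.
set c1 : R := 20 * _ * _; set c2 : R := (X in (c1 + X) * _).
have c10 : 0 <= c1.
  by rewrite /c1 mulr_ge0 ?sqr_ge0// mulr_ge0 ?exprn_ge0// ler0n.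
have c20 : 0 <= c2.
  have := normr_ge0 V; have := normr_ge0 S; have := sqr_ge0 rad.
  by rewrite /c2; lra.
have -> : 2 * ((p n)%:R * (10 * 40 ^+ alpha * rad ^+ 2 * kp)) = c1 * B.
  by rewrite /c1 /B; ring.
have le2 : 4 * (2 * V + 2 * rad ^+ 2 + 4 * sigma n ^+ 2 * q) * tr <= c2 * W.
  rewrite /W [leRHS]mulrA ler_wpM2r// /c2 -[leRHS]mulrA ler_pM2l// [leRHS]mulrDr mulr1.
  apply: lerD.
    have := ler_norm V; have := normr_ge0 S; have := sqr_ge0 rad; lra.
  rewrite ler_wpM2r//.
  have := normr_ge0 V; have := sqr_ge0 rad; lra.
apply: (le_trans (lerD (lexx _) le2)).
rewrite mulrDl; apply: lerD; apply: ler_wpM2l => //; lra.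
Unshelve. all: by end_near.
Qed.
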